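(* Let $N,m\in\mathbb{N}$, let $A\in\mathbb{R}^{m\times N}$ be a Gaussian matrix, i.e. $A=m^{-1/2}[a_{ij}]$ with $a_{ij}$ i.i.d. $\mathcal{N}(0,1)$. Let $K\subset[N]$ with $|K|=k$ and $x_0=\mathbb{1}_K$ (the indicator vector of $K$). Fix $\varepsilon>0$. If $$m\ge \min\{\Delta_{\mathrm{bin}}(k),\Delta_{\mathrm{bin}}(N-k)\}+\sqrt{8\log(4/\varepsilon)N},$$ then with probability larger than $1-\varepsilon$, $x_0$ is the unique solution of MiBi-BP with $b=Ax_0$, i.e. for every choice of minimizers in its steps the algorithm returns $x_0$.
   Context: For $k\in\{0,\dots,N\}$, $$\Delta_{\mathrm{bin}}(k):=\inf_{\tau\ge0}\Big\{k\int_{-\infty}^{\tau}(u-\tau)^2\phi(u)\,du+(N-k)\int_{\tau}^{\infty}(u-\tau)^2\phi(u)\,du\Big\},\qquad \phi(u)=(2\pi)^{-1/2}e^{-u^2/2}.$$ Mirrored Binary Basis Pursuit (MiBi-BP) with data $A,b$: (1) let $\hat x_1$ be a solution of $\min\|x\|_1$ subject to $Ax=b$, $x\in[0,1]^N$; (2) let $\hat x_2$ be a solution of $\min\|\mathbb{1}-x\|_1$ subject to $Ax=b$, $x\in[0,1]^N$, where $\mathbb{1}\in\mathbb{R}^N$ is the all-ones vector; (3) output $\hat x=\hat x_{i^*}$ where $i^*\in\arg\min_{i=1,2}\|\mathrm{round}(\hat x_i)-\hat x_i\|$, with $\mathrm{round}(x)$ the vector of $\mathbb{Z}^N$ closest to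 $x$ (componentwise rounding) and $\|\cdot\|$ a norm on $\mathbb{R}^N$. *)

(* Defs.v *)
From HB Require Import structures.
From mathcomp Require Import all_boot all_order all_algebra.
From mathcomp Require Import all_classical all_reals all_analysis.
Set Implicit Arguments. Unset Strict Implicit. Unset Printing Implicit Defensive.
Import Order.TTheory GRing.Theory Num.Theory.
Import numFieldNormedType.Exports.
Local Open Scope classical_set_scope.
Local Open Scope ring_scope.

Section Defs.
Variable R : realType.

Definition phi (u : R) : R := (Num.sqrt (2 * pi))^-1 * expR (- (u ^+ 2) / 2).

(* Delta_bin(k) for ambient dimension N, as an extended real (it is finite). *)
Definition Delta_bin (N k : nat) : \bar R :=
  ereal_inf [set
    (k%:R%:E * (\int[lebesgue_measure]_(u in `]-oo, tau]) ((u - tau) ^+ 2 * phi u)%:E)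
     + (N - k)%:R%:E * (\int[lebesgue_measure]_(u in `[tau, +oo[) ((u - tau) ^+ 2 * phi u)%:E))%E
    | tau in `[0, +oo[%classic].

Definition l1norm (N : nat) (x : 'cV[R]_N) : R := \sum_(i < N) `|x i 0|.

Definition ones (N : nat) : 'cV[R]_N := \col_(i < N) 1.

Definition indicator (N : nat) (K : {set 'I_N}) : 'cV[R]_N :=
  \col_(i < N) (if i \in K then 1 else 0).

Definition feasible (m N : nat) (A : 'M[R]_(m, N)) (b : 'cV[R]_m) (x : 'cV[R]_N) : Prop :=
  A *m x = b /\ (forall i, 0 <= x i 0 <= 1).

Definition is_minimizer (m N : nat) (f : 'cV[R]_N -> R)
  (A : 'M[R]_(m, N)) (b : 'cV[R]_m) (x : 'cV[R]_N) : Prop :=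
  feasible A b x /\ (forall y, feasible A b y -> f x <= f y).

(* r is a componentwise rounding of x to a closest integer vector
   (ties may be broken either way). *)
Definition is_round (N : nat) (x r : 'cV[R]_N) : Prop :=
  forall i, (exists z : int, r i 0 = z%:~R) /\ `|x i 0 - r i 0| <= 2^-1.

Definition is_norm (N : nat) (nu : 'cV[R]_N -> R) : Prop :=
  [/\ (forall x, 0 <= nu x),
      (forall x, nu x = 0 -> x = 0),
      (forall (a : R) x, nu (a *: x) = `|a| * nu x) &
      (forall x y, nu (x + y) <= nu x + nu y)].

Definition MiBiBP_output (m N : nat) (nu : 'cV[R]_N -> R)
  (A : 'M[R]_(m, N)) (b : 'cV[R]_m) (x : 'cV[R]_N) : Prop :=
  exists x1 x2 r1 r2,
    [/\ is_minimizer (@l1norm N) A b x1,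
        is_minimizer (fun y => l1norm (ones N - y)) A b x2,
        is_round x1 r1, is_round x2 r2 &
        (x = x1 /\ nu (r1 - x1) <= nu (r2 - x2)) \/
        (x = x2 /\ nu (r2 - x2) <= nu (r1 - x1))].

Definition MiBiBP_unique (m N : nat) (nu : 'cV[R]_N -> R)
  (A : 'M[R]_(m, N)) (b : 'cV[R]_m) (x0 : 'cV[R]_N) : Prop :=
  MiBiBP_output nu A b x0 /\ (forall x, MiBiBP_output nu A b x -> x = x0).

Definition iid_std_gaussian (d : measure_display) (T : measurableType d)
  (P : probability T R) (m N : nat) (a : 'I_m -> 'I_N -> T -> R) : Prop :=
  [/\ (forall i j, measurable_fun setT (a i j)),
      (forall i j (B : set R), measurable B ->
          P (a i j @^-1` B) = normal_prob 0 1 B) &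
      (forall B : 'I_m -> 'I_N -> set R, (forall i j, measurable (B i j)) ->
          P [set w | forall i j, B i j (a i j w)] =
          (\prod_(i < m) \prod_(j < N) P (a i j @^-1` B i j))%E)].

Definition gauss_matrix (d : measure_display) (T : measurableType d)
  (m N : nat) (a : 'I_m -> 'I_N -> T -> R) (w : T) : 'M[R]_(m, N) :=
  (Num.sqrt (m%:R : R))^-1 *: \matrix_(i < m, j < N) a i j w.

End Defs.

(* Main.v *)
(* If x0 is not the only solution of the first program, the kernel of the Gaussian matrix G contains a
   nonzero z of the cone {z <= 0 on K, z >= 0 off K, sum z <= 0}; if it is not the only solution of the
   second one, the same holds for the complement of K. For a finite family of unit vectors x of the cone
   and lam > 0, an exponential form of Gordon's comparison reads
     exp (lam^2 / 2) E max_x exp (- lam |G x|) <= E exp (lam max_x <h, x>) E exp (- lam |g|)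
   with Gaussian vectors g and h. It is obtained by replacing every Gaussian coordinate by many small
   random signs and comparing second-order Taylor expansions. For tau >= 0 and x in the cone, <h, x> is
   at most the norm of the vector with entries (tau - h_j)_+ on K and (h_j - tau)_+ off K, whose mean
   square D is the objective of Delta_bin at tau. With lam = sqrt m - sqrt D this bounds the failure
   probability by 3 exp (- (m - D)^2 / (8 N)) when m <= N; when m > N, letting lam tend to infinity shows
   that G is almost surely injective on the cone. Rational points are dense in the cone, so finite
   families suffice.
   If one program returns x0, its rounding error is 0, so the output differs from x0 only if the other
   program returns a binary vector x <> x0; then x - x0 is one of finitely many nonzero vectors, each of
   which is almost surely outside the kernel of G. *)

Require Import Defs.
From HB Require Import structures.
From mathcomp Require Import all_boot all_order all_algebra.
From mathcomp Require Import all_classical all_reals all_analysis.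
From mathcomp Require Import measurable_realfun ring lra zify.
Set Implicit Arguments. Unset Strict Implicit. Unset Printing Implicit Defensive.
Import Order.TTheory GRing.Theory Num.Theory.
Import numFieldNormedType.Exports.
Local Open Scope classical_set_scope.
Local Open Scope ring_scope.

(** * Gaussian integrals on the line *)

(** Keeping an exponential moment throughout replaces the usual pair formed by Gordon's inequality
    for expectations and Gaussian concentration. The factor [exp (lam^2 / 2)] on the left comes from
    a scalar Gaussian that equalises the variances of the two processes. On the right, [h]
    contributes at most [exp (lam sqrt D + lam^2 / 2)], and [g], up to smaller terms,
    [exp (- lam sqrt m + lam^2 / 2)]. The quotient is [exp (lam^2 / 2 - lam (sqrt m - sqrt D))],
    smallest at [lam = sqrt m - sqrt D] with value [exp (- lam^2 / 2)]. Since [m - D = lam (sqrt m +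
    sqrt D) <= 2 lam sqrt m], this is at most [exp (- (m - D)^2 / (8 m))], the origin of the 8 under
    the square root of the hypothesis. The bound is a sum of three exponentials, while the
    hypothesis has [log (4 / eps)]. The spare factor 4/3 pays for the infimum in [Delta_bin], of
    which only near-minimizers are used, and gives the strict inequality. *)

Section GaussianLine.
Variable R : realType.
Notation gauss := (@normal_prob R 0 1).
Notation leb := (@lebesgue_measure R).

Lemma normal_pdf01 (x : R) : normal_pdf 0 1 x = phi x.
Proof.
rewrite normal_pdfE ?oner_eq0// /normal_peak /normal_fun /phi subr0 expr1n mul1r.
by rewrite -(mulr_natl pi).
Qed.

Lemma phi_gt0 (x : R) : 0 < phi x.
Proof. by rewrite /phi mulr_gt0// ?expR_gt0// invr_gt0 sqrtr_gt0 mulr_gt0// pi_gt0. Qed.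

Lemma phi_ge0 (x : R) : 0 <= phi x. Proof. exact/ltW/phi_gt0. Qed.

Lemma continuous_phi : continuous (@phi R).
Proof.
have -> : @phi R = normal_pdf 0 1 by apply/funext => x; rewrite normal_pdf01.
by apply: continuous_normal_pdf; rewrite oner_eq0.
Qed.

Lemma measurable_phi : measurable_fun setT (@phi R).
Proof. exact: continuous_measurable_fun continuous_phi. Qed.

(** Change of variables holds with the Radon-Nikodym derivative, which agrees with [phi] almost
    everywhere because both have the same integral over every measurable set. *)
Lemma integral_gauss (k : R -> \bar R) : (forall x, 0 <= k x)%E ->
  measurable_fun setT k ->
  (\int[gauss]_x k x = \int[leb]_x (k x * (phi x)%:E))%E.
Proof.
move=> k0 mk.
have dom := @normal_prob_dominates R 0 1.
rewrite -(Radon_Nikodym_SigmaFinite.change_of_variables dom)//.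
have iRN := Radon_Nikodym_SigmaFinite.f_integrable dom.
apply: ae_eq_integral => //.
- by apply: emeasurable_funM => //; exact: measurable_int iRN.
- by apply: emeasurable_funM => //; apply/measurable_EFinP; exact: measurable_phi.
- apply: ae_eqe_mul2l => /=.
  apply: integral_ae_eq => //=.
  + by apply/measurable_EFinP; exact: measurable_phi.
  + move=> E E01 mE.
    rewrite -(Radon_Nikodym_SigmaFinite.f_integral dom)//.
    by apply: eq_integral => x _; rewrite normal_pdf01.
Qed.

Lemma integral_affine (G : R -> R) (s b : R) : 0 < s -> continuous G ->
  (forall x, 0 <= G x) ->
  (\int[leb]_x (G x)%:E = \int[leb]_x (G (s * x + b) * s)%:E)%E.
Proof.
move=> s0 cG G0.
have dF x : is_derive (x : R) (1:R) (fun x : R => s * x + b) s.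
  by apply: is_derive_eq; rewrite scaler1 addr0.
have F'E : ((fun x : R => s * x + b)^`())%classic = cst s.
  by apply/funext => x; rewrite derive1E; exact: (@derive_val _ _ _ _ _ _ _ (dF x)).
rewrite (@increasing_ge0_integration_by_substitutionT R (fun x => s * x + b) G) //.
- by apply: eq_integral => x _; rewrite F'E.
- by move=> x y xy; rewrite ltrD2r ltr_pM2l.
- by rewrite F'E => x; exact: cvg_cst.
- by rewrite F'E; exact: is_cvg_cst.
- by rewrite F'E; exact: is_cvg_cst.
- apply: cvg_comp (cvg_addrr_Ny _); apply: gt0_cvgMrNy => //.
- apply: cvg_comp (cvg_addrr _); apply: gt0_cvgMry => //.
Qed.

Lemma normal_pdfE1 (b s x : R) : 0 < s ->
  normal_pdf b s x = phi ((x - b) / s) / s.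
Proof.
move=> s0; rewrite normal_pdfE ?gt_eqF// /normal_peak /normal_fun /phi.
rewrite -mulrnAr sqrtrM ?sqr_ge0// sqrtr_sqr gtr0_norm// -(mulr_natl pi) invfM.
have -> : - (x - b) ^+ 2 / (s ^+ 2 *+ 2) = - ((x - b) / s) ^+ 2 / 2.
  by field; rewrite gt_eqF.
by ring.
Qed.

Lemma integral_gauss_expR (c : R) :
  (\int[gauss]_x (expR (c * x))%:E = (expR (c ^+ 2 / 2))%:E)%E.
Proof.
rewrite integral_gauss; first last.
- by apply/measurable_EFinP; apply: measurableT_comp.
- by move=> x; rewrite lee_fin expR_ge0.
transitivity (\int[leb]_x ((expR (c ^+ 2 / 2))%:E * (normal_pdf c 1 x)%:E))%E.
  apply: eq_integral => x _; rewrite -!EFinM; congr EFin.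
  rewrite normal_pdfE1// !divr1 /phi mulrCA [RHS]mulrCA -!expRD.
  by congr (_ * expR _); field.
rewrite ge0_integralZl//; first by rewrite integral_normal_pdf mule1.
- by apply/measurable_EFinP; exact: measurable_normal_pdf.
- by move=> x _; rewrite lee_fin normal_pdf_ge0.
Qed.

Lemma integral_gauss_expRN2 (k : R) : 0 < 1 + 2 * k ->
  (\int[gauss]_x (expR (- k * x ^+ 2))%:E = ((Num.sqrt (1 + 2 * k))^-1)%:E)%E.
Proof.
move=> k1; set s := (Num.sqrt (1 + 2 * k))^-1.
have s0 : 0 < s by rewrite invr_gt0 sqrtr_gt0.
have s2 : s ^- 2 = 1 + 2 * k by rewrite exprVn invrK sqr_sqrtr// ltW.
rewrite integral_gauss; first last.
- apply/measurable_EFinP; apply: measurableT_comp => //.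
  by apply: measurable_funM => //; exact: measurable_funX.
- by move=> x; rewrite lee_fin expR_ge0.
transitivity (\int[leb]_x (s%:E * (normal_pdf 0 s x)%:E))%E.
  apply: eq_integral => x _; rewrite -!EFinM; congr EFin.
  rewrite normal_pdfE1// subr0 [s * _]mulrC divfK ?gt_eqF//.
  rewrite /phi mulrCA -expRD; congr (_ * expR _).
  by rewrite exprMn exprVn s2; field.
rewrite ge0_integralZl//; first by rewrite integral_normal_pdf mule1.
- by apply/measurable_EFinP; exact: measurable_normal_pdf.
- by move=> x _; rewrite lee_fin normal_pdf_ge0.
- by rewrite lee_fin ltW.
Qed.

Lemma continuous_phi_affine (a b : R) : continuous (fun y : R => phi ((y - a) / b)).
Proof.
move=> y; apply: (@continuous_comp _ _ _ (fun y : R => (y - a) / b) (@phi R)).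
  by apply: cvgM; [apply: cvgB; [exact: cvg_id|exact: cvg_cst]|exact: cvg_cst].
exact: continuous_phi.
Qed.

(** Stability of the Gaussian law under sums, by Tonelli. It serves to merge many small Gaussian
    steps into one step of size 1. *)
Lemma integral_gauss_convolution (k : R -> R) (s t : R) : 0 < s -> 0 < t ->
  continuous k -> (forall x, 0 <= k x) ->
  (\int[gauss]_x \int[gauss]_y (k (s * x + t * y))%:E =
   \int[gauss]_x (k (Num.sqrt (s ^+ 2 + t ^+ 2) * x))%:E)%E.
Proof.
move=> s0 t0 ck k0.
have mk : measurable_fun setT k by exact: continuous_measurable_fun.
set r := Num.sqrt _.
have st0 : 0 < s ^+ 2 + t ^+ 2 by rewrite addr_gt0// exprn_gt0.
have r0 : 0 < r by rewrite sqrtr_gt0.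
have r2 : r ^+ 2 = s ^+ 2 + t ^+ 2 by rewrite sqr_sqrtr// ltW.
pose F (z : R * R) : \bar R := ((k z.2)%:E * (phi ((z.2 - s * z.1) / t) / t * phi z.1)%:E)%E.
have mF : measurable_fun setT F.
  apply: emeasurable_funM; first by apply/measurable_EFinP; exact: measurableT_comp.
  apply/measurable_EFinP; apply: measurable_funM; last first.
    by apply: measurableT_comp => //; exact: measurable_phi.
  apply: measurable_funM => //; apply: measurableT_comp; first exact: measurable_phi.
  apply: measurable_funM => //; apply: measurable_funB => //.
  by apply: measurable_funM.
have F0 z : (0 <= F z)%E.
  by rewrite mule_ge0// lee_fin ?k0// mulr_ge0 ?phi_ge0// divr_ge0 ?phi_ge0// ltW.
transitivity (\int[leb]_x \int[leb]_y F (x, y))%E.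
  have Hin x : (\int[gauss]_y (k (s * x + t * y))%:E * (phi x)%:E = \int[leb]_y F (x, y))%E.
    rewrite integral_gauss; first last.
    - apply/measurable_EFinP; apply: measurableT_comp => //.
      by apply: measurable_funD => //; exact: measurable_funM.
    - by move=> y; rewrite lee_fin k0.
    rewrite -ge0_integralZr//; first last.
    - by rewrite lee_fin phi_ge0.
    - by move=> y _; rewrite mule_ge0// lee_fin ?phi_ge0.
    - apply: emeasurable_funM; apply/measurable_EFinP; last exact: measurable_phi.
      apply: measurableT_comp => //.
      by apply: measurable_funD => //; exact: measurable_funM.
    rewrite /F /=; under [RHS]eq_integral do rewrite -EFinM.
    rewrite (@integral_affine (fun y => k y * (phi ((y - s * x) / t) / t * phi x)) t (s * x))//.
    - apply: eq_integral => y _; rewrite -!EFinM; congr EFin.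
      rewrite [t * y + _]addrC [s * x + t * y - _]addrAC subrr add0r.
      by rewrite [t * y]mulrC mulfK ?gt_eqF// [y * t]mulrC; field; rewrite gt_eqF.
    - move=> y; apply: cvgM; first exact: ck.
      apply: cvgM; last exact: cvg_cst.
      apply: cvgM; last exact: cvg_cst.
      exact: continuous_phi_affine.
    - by move=> y; rewrite mulr_ge0// mulr_ge0 ?phi_ge0// divr_ge0 ?phi_ge0// ltW.
  rewrite integral_gauss; first last.
  - pose H (z : R * R) := (k (s * z.1 + t * z.2))%:E.
    apply: (@measurable_fun_fubini_tonelli_F _ _ _ _ R gauss H).
      apply/measurable_EFinP; apply: measurableT_comp => //.
      by apply: measurable_funD; exact: measurable_funM.
    by move=> z; rewrite lee_fin.
  - by move=> x; apply: integral_ge0 => y _; rewrite lee_fin.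
  by apply: eq_integral => x _; exact: Hin.
rewrite (@fubini_tonelli _ _ _ _ R leb leb F mF)//.
(* Completing the square in [x]: conditionally on the sum being [y], the first variable is normal
   with mean [s * y / r ^+ 2] and deviation [t / r], so its density integrates to 1. *)
have Gin y : (\int[leb]_x F (x, y) = (k y * (phi (y / r) / r))%:E)%E.
  rewrite /F /=.
  transitivity (\int[leb]_x ((k y * (phi (y / r) / r))%:E * (normal_pdf (s * y / r ^+ 2) (t / r) x)%:E))%E.
    apply: eq_integral => x _; rewrite -!EFinM -[k y * _ * _]mulrA; congr (_ * _)%:E.
    rewrite normal_pdfE1 ?divr_gt0// /phi.
    set c := (Num.sqrt (2 * pi))^-1.
    set e1 := expR _; set e2 := expR _; set e3 := expR _; set e4 := expR _.
    have -> : c * e1 / t * (c * e2) = c * c * (e1 * e2) / t by ring.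
    have -> : c * e3 / r * (c * e4 / (t / r)) = c * c * (e3 * e4) / t.
      by field; rewrite !gt_eqF.
    rewrite /e1 /e2 /e3 /e4 -!expRD; congr (_ * expR _ / _).
    have -> : (y / r) ^+ 2 = y ^+ 2 / (s ^+ 2 + t ^+ 2) by rewrite exprMn exprVn r2.
    have -> : ((x - s * y / r ^+ 2) / (t / r)) ^+ 2 = (x - s * y / (s ^+ 2 + t ^+ 2)) ^+ 2 * (s ^+ 2 + t ^+ 2) / t ^+ 2.
      by rewrite r2 exprMn exprVn expr_div_n r2 invf_div mulrA.
    by field; rewrite !gt_eqF.
  rewrite ge0_integralZl//; first by rewrite integral_normal_pdf mule1.
  - by apply/measurable_EFinP; exact: measurable_normal_pdf.
  - by move=> x _; rewrite lee_fin normal_pdf_ge0.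
  - by rewrite lee_fin mulr_ge0// divr_ge0 ?phi_ge0// ltW.
under eq_integral do rewrite Gin.
rewrite (@integral_affine (fun y => k y * (phi (y / r) / r)) r 0)//; first last.
- by move=> y; rewrite mulr_ge0// divr_ge0 ?phi_ge0// ltW.
- move=> y; apply: cvgM; first exact: ck.
  apply: cvgM; last exact: cvg_cst.
  have e : (fun y : R => phi ((y - 0) / r)) = (fun y => phi (y / r)).
    by apply/funext => u; rewrite subr0.
  by have := @continuous_phi_affine 0 r; rewrite e; apply.
rewrite integral_gauss; first last.
- by apply/measurable_EFinP; apply: measurableT_comp => //; exact: measurable_funM.
- by move=> x; rewrite lee_fin.
apply: eq_integral => y _; rewrite -EFinM; congr EFin.
rewrite addr0 [r * y]mulrC mulfK ?gt_eqF// [y * r]mulrC; field; by rewrite gt_eqF.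
Qed.

End GaussianLine.

(** * Distribution function, truncated moments and exponential moments *)

Section OneVariable.
Variable R : realType.
Notation gauss := (@normal_prob R 0 1).
Notation leb := (@lebesgue_measure R).

(** The one-variable inequalities below follow this pattern: a difference is followed from a point
    where it is known, along a derivative of constant sign. *)
Lemma is_derive_le (f f' : R -> R) (a b : R) :
  (forall x : R, is_derive x (1 : R) f (f' x)) -> a <= b ->
  (forall x, a <= x <= b -> 0 <= f' x) -> f a <= f b.
Proof.
move=> df; rewrite le_eqVlt => /predU1P[->//|ab] f'0.
have [|c cab] := @MVT R f f' a b ab (fun x _ => df x).
  apply: continuous_subspaceT => x.
  by apply: differentiable_continuous; apply/derivable1_diffP; case: (df x).
move=> e; rewrite -subr_ge0 e mulr_ge0 ?subr_ge0 ?(ltW ab)// f'0//.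
by move: cab; rewrite in_itv/= => /andP[/ltW-> /ltW->].
Qed.

Lemma integral_gauss_opp (k : R -> R) : continuous k -> (forall x, 0 <= k x) ->
  (\int[gauss]_x (k (- x))%:E = \int[gauss]_x (k x)%:E)%E.
Proof.
move=> ck k0.
have cN (G : R -> R) : continuous G -> continuous (fun x => G (- x)).
  move=> cG x; apply: (@continuous_comp _ _ _ (fun x : R => - x) G); last exact: cG.
  by apply: cvgN; exact: cvg_id.
have cNk := cN _ ck.
pose F x := k x * phi x.
have cF : continuous F by move=> x; apply: cvgM; [exact: ck|exact: continuous_phi].
have F0 x : 0 <= F x by rewrite mulr_ge0// phi_ge0.
have phiN x : phi (- x) = phi x :> R by rewrite /phi sqrrN.
rewrite !integral_gauss; first last.
- by apply/measurable_EFinP; exact: continuous_measurable_fun.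
- by move=> x; rewrite lee_fin.
- by apply/measurable_EFinP; exact: continuous_measurable_fun.
- by move=> x; rewrite lee_fin.
have mF : measurable_fun setT (EFin \o F) by apply/measurable_EFinP; exact: continuous_measurable_fun.
have mNF : measurable_fun setT (EFin \o (F \o -%R)).
  by apply/measurable_EFinP; apply: continuous_measurable_fun; exact: cN.
have e1 : (\int[leb]_x ((k (- x))%:E * (phi x)%:E) = \int[leb]_x (EFin \o (F \o -%R)) x)%E.
  by apply: eq_integral => x _; rewrite -EFinM /= /F phiN.
have e2 : (\int[leb]_x ((k x)%:E * (phi x)%:E) = \int[leb]_x (EFin \o F) x)%E.
  by apply: eq_integral => x _; rewrite -EFinM.
rewrite e1 e2.
have st : [set: R] = `]-oo, 0%R]%classic `|` `]0%R, +oo[%classic.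
  apply/esym; rewrite -subTset => x _ /=; rewrite !in_itv/= andbT.
  by case: (leP x 0) => ?; [left|right].
have dj : [disjoint `]-oo, 0%R]%classic & (`]0%R, +oo[%classic : set R)].
  apply/disj_setPS => x /= []; rewrite !in_itv/= andbT => h1 h2.
  by move: (le_lt_trans h1 h2); rewrite ltxx.
have half (G : R -> R) : continuous G -> (forall x, 0 <= G x) ->
    (\int[leb]_x (EFin \o G) x = \int[leb]_(x in `]-oo, 0%R]) (G x)%:E + \int[leb]_(x in `[0%R, +oo[) (G x)%:E)%E.
  move=> cG G0; rewrite {1}st ge0_integral_setU//=.
  - congr +%E; rewrite integral_itv_obnd_cbnd//.
    by apply/measurable_EFinP/measurable_funTS; exact: continuous_measurable_fun.
  - by rewrite -st; apply/measurable_EFinP; exact: continuous_measurable_fun.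
  - by move=> x _; rewrite lee_fin.
have refl (G : R -> R) : continuous G -> (forall x, 0 <= G x) ->
    (\int[leb]_(x in `]-oo, 0%R]) (G x)%:E = \int[leb]_(x in `[0%R, +oo[) (G (- x))%:E)%E.
  move=> cG G0; rewrite -{1}oppr0 ge0_integration_by_substitutionNy//.
  exact: continuous_subspaceT.
rewrite (half _ cF F0) (half (F \o -%R) (cN _ cF) (fun x => F0 (- x))).
rewrite addeC; congr +%E.
  by rewrite (refl F).
rewrite (refl (F \o -%R) (cN _ cF) (fun x => F0 (- x))).
by apply: eq_integral => x _; rewrite /= opprK.
Qed.

Definition cdf01 (x : R) : R := (\int[leb]_(t in `]-oo, x]) (phi t))%R.

Lemma integrable_phi (A : set R) : measurable A -> leb.-integrable A (EFin \o @phi R).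
Proof.
move=> mA; apply: (integrableS measurableT) => //.
have := @integrable_normal_pdf R 0 1; congr (integrable _ _ _).
by apply/funext => x /=; rewrite normal_pdf01.
Qed.

Lemma is_derive_cdf01 (x : R) : is_derive x (1 : R) cdf01 (phi x).
Proof.
have [||||d1 d2] := @continuous_FTC1 R (@phi R) -oo%O x (x + 1).
- by rewrite ltrDl.
- exact: integrable_phi.
- by rewrite ltNyr.
- exact: continuous_phi.
by split; [exact: d1|rewrite -derive1E; exact: d2].
Qed.

Lemma is_derive_phi (x : R) : is_derive x (1 : R) (@phi R) (- x * phi x).
Proof.
rewrite /phi; apply: is_derive_eq.
rewrite !scaler0 !scaler1 /GRing.scale/=; field.
by rewrite sqrtr_eq0 -ltNge mulr_gt0// pi_gt0.
Qed.

Lemma EFin_cdf01 (x : R) : ((cdf01 x)%:E = \int[leb]_(t in `]-oo, x]) (phi t)%:E)%E.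
Proof. by rewrite fineK//; apply: integrable_fin_num => //; exact: integrable_phi. Qed.

Lemma cdf01_ge0 (x : R) : 0 <= cdf01 x.
Proof. by apply: Rintegral_ge0 => // t _; exact: phi_ge0. Qed.

(** The identity is a random variable under [gauss] whose cumulative distribution function is
    [cdf01]; the limits at both infinities follow. *)
Let idR : measurableTypeR R -> R := idfun.

#[local] HB.instance Definition _ :=
  @isMeasurableFun.Build _ _ _ _ idR (@measurable_id _ _ setT).

Let cdf01E (x : R) : ((cdf01 x)%:E = cdf (idR : {RV gauss >-> R}) x)%E.
Proof.
rewrite EFin_cdf01 /cdf /distribution /pushforward /= /normal_prob.
by apply: eq_integral => t _; rewrite normal_pdf01.
Qed.

Lemma cdf01_cvgy : cdf01 x @[x --> +oo] --> (1 : R).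
Proof.
have := cvg_cdfy1 (idR : {RV gauss >-> R}).
rewrite (_ : cdf _ = EFin \o cdf01); last by apply/funext => x; rewrite -cdf01E.
by move=> /fine_cvgP[_].
Qed.

Lemma cdf01_cvgNy : cdf01 x @[x --> -oo] --> (0 : R).
Proof.
have := cvg_cdfNy0 (idR : {RV gauss >-> R}).
rewrite (_ : cdf _ = EFin \o cdf01); last by apply/funext => x; rewrite -cdf01E.
by move=> /fine_cvgP[_].
Qed.

Lemma cdf01_le1 (x : R) : cdf01 x <= 1.
Proof. by rewrite -lee_fin cdf01E cdf_le1. Qed.

(** The sum [cdf01 y + cdf01 (- y)] has derivative 0, hence equals its limit 1 at infinity. *)
Lemma cdf01N (x : R) : cdf01 (- x) = 1 - cdf01 x.
Proof.
pose h (y : R) : R := cdf01 y + cdf01 (- y).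
have dh (y : R) : is_derive y (1 : R) h 0.
  have d1 := is_derive_cdf01 y; have d2 := is_derive_cdf01 (- y).
  apply: is_derive_eq; rewrite /phi sqrrN.
  by rewrite /GRing.scale/= mulrN1 subrr.
have hc y : h y = h x by apply: is_derive_0_is_cst.
have h1 : h y @[y --> +oo] --> (1 + 0 : R).
  by apply: cvgD; [exact: cdf01_cvgy|have /cvgNy_compNP := cdf01_cvgNy].
have h2 : h y @[y --> +oo] --> h x.
  by rewrite (_ : h = cst (h x)); [exact: cvg_cst|apply/funext => y; exact: hc].
have := cvg_unique _ h1 h2; rewrite addr0 /h => ->; first by rewrite addrAC subrr add0r.
exact: norm_hausdorff.
Qed.

Lemma cdf01_gt0 (x : R) : 0 < cdf01 x.
Proof.
apply: (le_lt_trans (cdf01_ge0 (x - 1))).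
have x1 : x - 1 < x by rewrite ltrBlDr ltrDl.
have [|c _ e] := @MVT R (@cdf01) (@phi R) _ _ x1 (fun x _ => is_derive_cdf01 x).
  apply: continuous_subspaceT => y; apply: differentiable_continuous.
  by apply/derivable1_diffP; case: (is_derive_cdf01 y).
by rewrite -subr_gt0 e mulr_gt0 ?phi_gt0// subr_gt0.
Qed.

Lemma phi_le1 (x : R) : phi x <= 1.
Proof.
rewrite /phi -[leRHS]mulr1 ler_pM ?expR_ge0 ?invr_ge0//.
  rewrite invf_le1 ?sqrtr_gt0 ?mulr_gt0 ?pi_gt0//.
  rewrite -[leLHS]sqrtr1 ler_sqrt ?mulr_ge0 ?pi_ge0//.
  by have := @pi_ge2 R; lra.
by rewrite -[leRHS]expR0 ler_expR mulNr oppr_le0 divr_ge0 ?sqr_ge0.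
Qed.

(** From [x <= expR x] and [2 * x <= x ^+ 2 / 2], which is where the threshold 4 comes from. *)
Lemma phi_le_expRN (x : R) : 4 <= x -> x * phi x <= expR (- x).
Proof.
move=> x4; rewrite /phi.
have c1 : (Num.sqrt (2 * pi))^-1 <= 1 :> R.
  rewrite invf_le1 ?sqrtr_gt0 ?mulr_gt0 ?pi_gt0//.
  rewrite -[leLHS]sqrtr1 ler_sqrt ?mulr_ge0 ?pi_ge0//.
  by have := @pi_ge2 R; lra.
rewrite mulrCA; apply: (@le_trans _ _ (x * expR (- x ^+ 2 / 2))).
  by rewrite ler_piMl// mulr_ge0 ?expR_ge0//; lra.
apply: (@le_trans _ _ (expR x * expR (- x ^+ 2 / 2))).
  by rewrite ler_pM2r ?expR_gt0//; have := expR_ge1Dx x; lra.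
by rewrite -expRD ler_expR; nra.
Qed.

Lemma xphi_cvgy : (x : R) * phi x @[x --> +oo] --> (0 : R).
Proof.
apply: (@squeeze_cvgr _ _ _ _ (fun=> 0) (fun x : R => expR (- x))).
- near=> x; apply/andP; split.
    by rewrite mulr_ge0 ?phi_ge0//; near: x; exact: nbhs_pinfty_ge.
  by apply: phi_le_expRN; near: x; exact: nbhs_pinfty_ge.
- exact: cvg_cst.
- exact: cvgr_expR.
Unshelve. all: by end_near. Qed.

Lemma phi_cvgy : phi (x : R) @[x --> +oo] --> (0 : R).
Proof.
apply: (@squeeze_cvgr _ _ _ _ (fun=> 0) (fun x : R => x * phi x)).
- near=> x.
  have x1 : 1 <= x by near: x; exact: nbhs_pinfty_ge.
  by rewrite phi_ge0/= ler_peMl ?phi_ge0.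
- exact: cvg_cst.
- exact: xphi_cvgy.
Unshelve. all: by end_near. Qed.

Lemma integral_itvcy_primitive (f F : R -> R) (a l : R) :
  (forall x, a <= x -> 0 <= f x) -> continuous f ->
  (forall x : R, is_derive x (1 : R) F (f x)) ->
  F x @[x --> +oo] --> l ->
  (\int[leb]_(x in `[a, +oo[) (f x)%:E = (l - F a)%:E)%E.
Proof.
move=> f0 cf dF Fl.
have dF1 (x : R) : derivable F x 1 by case: (dF x).
have dF2 : {in `]a, +oo[, F^`()%classic =1 f}.
  by move=> x _; rewrite derive1E; case: (dF x).
have Fa : F x @[x --> a^'+] --> F a.
  apply: cvg_at_right_filter; apply: differentiable_continuous.
  exact/derivable1_diffP.
by rewrite (ge0_continuous_FTC2y f0 (continuous_subspaceT cf) Fl (fun x _ => dF1 x) Fa dF2).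
Qed.

(** Closed form of the mean of [(w + a)_+] for a standard Gaussian [w]; [sqmean] below is that of
    [(w + a)_+ ^+ 2]. Up to a factor 2, [cdf01], [eta01], [sqmean] are successive primitives, and
    [sqmean] is the integral that occurs in [Delta_bin]. *)
Definition eta01 (a : R) : R := a * cdf01 a + phi a.
Definition sqmean (a : R) : R := (1 + a ^+ 2) * cdf01 a + a * phi a.

Lemma continuous_eta_int (a : R) : continuous (fun w : R => (w + a) * phi w).
Proof.
move=> w; apply: cvgM; last exact: continuous_phi.
by apply: cvgD; [exact: cvg_id|exact: cvg_cst].
Qed.

Lemma eta01_ge0 (a : R) : 0 <= eta01 a.
Proof.
rewrite -lee_fin.
have -> : ((eta01 a)%:E = \int[leb]_(w in `[(- a)%R, +oo[) ((w + a) * phi w)%:E)%E.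
  have dF (x : R) : is_derive x (1 : R) (fun w => a * cdf01 w - phi w) ((x + a) * phi x).
    have d1 := is_derive_cdf01 x; have d2 := is_derive_phi x.
    by apply: is_derive_eq; rewrite /GRing.scale/=; ring.
  have Fl : (a * cdf01 w - phi w) @[w --> +oo] --> (a * 1 - 0 : R).
    by apply: cvgB; [apply: cvgM; [exact: cvg_cst|exact: cdf01_cvgy]|exact: phi_cvgy].
  rewrite (integral_itvcy_primitive _ (@continuous_eta_int a) dF Fl).
    rewrite /eta01 cdf01N; have -> : phi (- a) = phi a :> R by rewrite /phi sqrrN.
    by congr EFin; ring.
  by move=> x ax; rewrite mulr_ge0 ?phi_ge0// -lerBlDr sub0r.
by apply: integral_ge0 => w /=; rewrite in_itv/= andbT => aw; rewrite lee_fin mulr_ge0 ?phi_ge0// -lerBlDr sub0r.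
Qed.

(** Because [eta01 a - eta01 (- a) = a] and [eta01 (- a)] is nonnegative. *)
Lemma eta01_ge (a : R) : a <= eta01 a.
Proof.
have := eta01_ge0 (- a); rewrite /eta01 cdf01N.
have -> : phi (- a) = phi a :> R by rewrite /phi sqrrN.
by move=> ?; lra.
Qed.

Lemma continuous_sqmean_int (a : R) : continuous (fun w : R => (w + a) ^+ 2 * phi w).
Proof.
move=> w; apply: cvgM; last exact: continuous_phi.
rewrite /GRing.exp /=; apply: cvgM; by apply: cvgD; [exact: cvg_id|exact: cvg_cst].
Qed.

Lemma integral_sqmean (a : R) :
  (\int[leb]_(w in `[(- a)%R, +oo[) ((w + a) ^+ 2 * phi w)%:E = (sqmean a)%:E)%E.
Proof.
have dF (x : R) : is_derive x (1 : R)
    (fun w => (1 + a ^+ 2) * cdf01 w - w * phi w - (2 * a) * phi w) ((x + a) ^+ 2 * phi x).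
  have d1 := is_derive_cdf01 x; have d2 := is_derive_phi x.
  by apply: is_derive_eq; rewrite /GRing.scale/=; ring.
have Fl : ((1 + a ^+ 2) * cdf01 w - w * phi w - (2 * a) * phi w) @[w --> +oo]
    --> ((1 + a ^+ 2) * 1 - 0 - (2 * a) * 0 : R).
  apply: cvgB; last by apply: cvgM; [exact: cvg_cst|exact: phi_cvgy].
  by apply: cvgB; [apply: cvgM; [exact: cvg_cst|exact: cdf01_cvgy]|exact: xphi_cvgy].
rewrite (integral_itvcy_primitive _ (@continuous_sqmean_int a) dF Fl).
  rewrite /sqmean cdf01N; have -> : phi (- a) = phi a :> R by rewrite /phi sqrrN.
  by congr EFin; ring.
by move=> x ax; rewrite mulr_ge0 ?phi_ge0// sqr_ge0.
Qed.

Lemma sqmean_ge0 (a : R) : 0 <= sqmean a.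
Proof.
rewrite -lee_fin -integral_sqmean; apply: integral_ge0 => w _.
by rewrite lee_fin mulr_ge0 ?phi_ge0// sqr_ge0.
Qed.

Lemma is_derive_eta01 (a : R) : is_derive a (1 : R) eta01 (cdf01 a).
Proof.
have d1 := is_derive_cdf01 a; have d2 := is_derive_phi a.
by apply: is_derive_eq; rewrite /GRing.scale/=; ring.
Qed.

Lemma is_derive_sqmean (a : R) : is_derive a (1 : R) sqmean (2 * eta01 a).
Proof.
have d1 := is_derive_cdf01 a; have d2 := is_derive_phi a.
by apply: is_derive_eq; rewrite /GRing.scale/= /eta01; ring.
Qed.

Let tilt_derive (N P eta : R -> R) (c d a r : R) :
  (forall x : R, is_derive x (1 : R) N (P x)) ->
  (forall x : R, is_derive x (1 : R) eta (N x)) ->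
  let E r := expR ((r ^+ 2 - 1) * (a ^+ 2 / 2)) in
  is_derive r (1 : R) (fun r => c * (d + r * E r * N (r * a)) - E r * eta (r * a))
    (E r * (c * ((1 + (r * a) ^+ 2) * N (r * a) + r * a * P (r * a))
     - a * (r * a * eta (r * a) + N (r * a)))).
Proof.
move=> dN deta E.
have d1 := dN (r * a); have d2 := deta (r * a).
have dE : is_derive r (1 : R) E (r * a ^+ 2 * E r).
  by rewrite /E; apply: is_derive_eq; rewrite /GRing.scale/=; field.
move: dE; move: E => E dE.
by apply: is_derive_eq; rewrite /GRing.scale/=; ring.
Qed.

Let M_derive (N : R -> R) (P : R -> R) (l q a : R) :
  (forall x : R, is_derive x (1 : R) N (P x)) -> (forall x, P (- x) = P x) ->
  let E a := expR ((q ^+ 2 - 1) * (a ^+ 2 / 2)) in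
  E a * P (q * a) = P a -> 2 * l * q ^+ 2 = q ^+ 2 - 1 ->
  is_derive a (1 : R) (fun a => N (- a) + q * E a * N (q * a))
    (2 * l * q ^+ 2 * E a * (q * a * N (q * a) + P (q * a))).
Proof.
move=> dN PN E EP lq.
have d1 := dN (q * a); have d2 := dN (- a).
have dE : is_derive a (1 : R) E ((q ^+ 2 - 1) * a * E a).
  by rewrite /E; apply: is_derive_eq; rewrite /GRing.scale/=; field.
move: dE EP; move: E => E dE EP.
apply: is_derive_eq; rewrite /GRing.scale/= lq PN -EP; ring.
Qed.

(** * Exponential moment of the square of a positive part *)

Section Mgf.
Variable l : R.
Hypothesis l01 : 0 < l < 1 / 2.
Let q := (Num.sqrt (1 - 2 * l))^-1.

Let l_lt : 0 < 1 - 2 * l.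
Proof. by move: l01 => /andP[]; lra. Qed.

Let q2 : q ^+ 2 = (1 - 2 * l)^-1.
Proof. by rewrite exprVn sqr_sqrtr//; move: l01 => /andP[]; lra. Qed.

Let q_gt0 : 0 < q.
Proof. by rewrite invr_gt0 sqrtr_gt0; move: l01 => /andP[]; lra. Qed.

Let q_ge1 : 1 <= q.
Proof.
rewrite -(@ler_pXn2r _ 2)// ?nnegrE ?(ltW q_gt0)// expr1n q2.
by move: l01 => /andP[? ?]; rewrite invf_ge1; lra.
Qed.

Let twol : 2 * l * q ^+ 2 = q ^+ 2 - 1.
Proof. by rewrite q2; field; move: l01 => /andP[? ?]; apply/eqP; lra. Qed.

Let E (a r : R) : R := expR ((r ^+ 2 - 1) * (a ^+ 2 / 2)).
(* The integral of [expR (l * (w + a)_+ ^+ 2)] in closed form. *)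
Let M (a : R) : R := cdf01 (- a) + q * E a q * cdf01 (q * a).

Let E_phi (a r : R) : E a r * phi (r * a) = phi a.
Proof.
by rewrite /E /phi mulrCA -expRD; congr (_ * expR _); field.
Qed.

Let phiN (a : R) : phi (- a) = phi a :> R.
Proof. by rewrite /phi sqrrN. Qed.

(** Equivalent to saying that the logarithmic derivative of [M] is at most the derivative of
    [l / (1 - 2 * l) * sqmean]. When [q] is replaced by a variable [r], both sides agree at [r = 1],
    and their difference has derivative [E a r * (eta01 a - a) * sqmean (r * a)], which is
    nonnegative. *)
Let eta_tilt (a : R) : E a q * eta01 (q * a) <= eta01 a * M a.
Proof.
pose H (r : R) : R := eta01 a * (cdf01 (- a) + r * E a r * cdf01 (r * a)) - E a r * eta01 (r * a).
have H1 : H 1 = 0.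
  rewrite /H /E expr1n subrr mul0r expR0 !mul1r cdf01N; ring.
pose H' (r : R) : R := E a r * (eta01 a - a) * sqmean (r * a).
have dH (r : R) : is_derive r (1 : R) H (H' r).
  have := @tilt_derive _ _ _ (eta01 a) (cdf01 (- a)) a r is_derive_cdf01 is_derive_eta01.
  move=> /= d; apply: (is_derive_eq d).
  by rewrite /H' /sqmean /E /eta01; ring.
have : H 1 <= H q.
  apply: (is_derive_le dH q_ge1) => x _.
  by rewrite /H' !mulr_ge0 ?expR_ge0 ?sqmean_ge0// subr_ge0 eta01_ge.
by rewrite H1 /H subr_ge0.
Qed.

Let M_gt0 (a : R) : 0 < M a.
Proof.
rewrite /M ltr_wpDr ?cdf01_gt0// !mulr_ge0 ?expR_ge0 ?cdf01_ge0//.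
exact: ltW.
Qed.

Let M_derive' (a : R) : is_derive a (1 : R) M (2 * l * q ^+ 2 * (E a q * eta01 (q * a))).
Proof.
have := @M_derive _ _ l q a is_derive_cdf01 phiN (E_phi a q) twol.
by move=> /= d; apply: (is_derive_eq d); rewrite /E /eta01 -!mulrA.
Qed.

(** The inequality [0 <= eta01 (- y)] reads [y * cdf01 (- y) <= phi y], a Mills ratio bound; it
    makes the second term of [M (- x)] at most [phi x / x], while the first is at most 1. *)
Let M_tail (x : R) : 0 < x -> ln (M (- x)) <= x^-1.
Proof.
move=> x0.
have h1 : q * x * cdf01 (q * - x) <= phi (q * - x).
  by have := eta01_ge0 (q * - x); rewrite /eta01; lra.
have h2 : q * x * (E (- x) q * cdf01 (q * - x)) <= phi x.
  rewrite -phiN -(E_phi (- x) q) mulrCA.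
  by rewrite ler_pM2l ?expR_gt0.
have h3 : q * E (- x) q * cdf01 (q * - x) <= x^-1.
  rewrite -div1r ler_pdivlMr//.
  by apply: (le_trans _ (phi_le1 x)); apply: (le_trans _ h2); rewrite le_eqVlt; apply/orP; left; apply/eqP; ring.
rewrite -ler_expR lnK ?posrE ?M_gt0//.
apply: (@le_trans _ _ (1 + x^-1)); last exact: expR_ge1Dx.
rewrite /M opprK; apply: lerD => //.
exact: cdf01_le1.
Qed.

(* The difference of the logarithms is nondecreasing in [a] and tends to 0 at [-oo]. *)
Lemma mgf_sq_closed (a : R) : M a <= expR (l / (1 - 2 * l) * sqmean a).
Proof.
pose D (a : R) : R := l / (1 - 2 * l) * sqmean a - ln (M a).
have dD (x : R) : is_derive x (1 : R) D (2 * l * q ^+ 2 * (eta01 x - E x q * eta01 (q * x) / M x)).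
  have d1 := M_derive' x; have d2 := is_derive_sqmean x.
  have d3 := is_derive1_ln (M_gt0 x).
  have d4 := @is_derive1_comp R (@ln R) M x _ _ d3 d1.
  have dD := @is_deriveB _ _ _ (fun a => l / (1 - 2 * l) * sqmean a) (@ln R \o M) x 1 _ _ (@is_deriveZ _ _ _ sqmean (l / (1 - 2 * l)) x 1 _ d2) d4.
  apply: (is_derive_eq dD); rewrite /GRing.scale/= -q2; ring.
have D0 (x : R) : 0 < x -> - x^-1 <= D (- x).
  move=> x0; rewrite /D; have := M_tail x0.
  suff : 0 <= l / (1 - 2 * l) * sqmean (- x) by lra.
  by rewrite mulr_ge0 ?sqmean_ge0// divr_ge0//; move: l01 => /andP[? ?]; lra.
have Dmono (x y : R) : x <= y -> D x <= D y.
  move=> xy; apply: (is_derive_le dD xy) => z _.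
  rewrite mulr_ge0//.
    by move: l01 => /andP[/ltW l0 _]; rewrite mulr_ge0 ?sqr_ge0// mulr_ge0.
  by rewrite subr_ge0 ler_pdivrMr// eta_tilt.
have Da : 0 <= D a.
  rewrite leNgt; apply/negP => Dn.
  (* So large that [D a < - x^-1], against [- x^-1 <= D (- x) <= D a]. *)
  pose x : R := Num.max (- a) (Num.max 1 (2 / - D a)).
  have xa : - x <= a by rewrite lerNl /x le_max lexx.
  have x1 : 1 <= x by rewrite /x !le_max lexx orbT.
  have xD : 2 / - D a <= x by rewrite /x !le_max lexx !orbT.
  have x0 : 0 < x by lra.
  have := le_trans (D0 _ x0) (Dmono _ _ xa).
  rewrite lerNl => h.
  have : 2 <= x * - D a by rewrite -ler_pdivrMr//; lra.
  have : x * - D a <= 1 by rewrite mulrC -ler_pdivlMr// div1r.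
  lra.
by rewrite -[leLHS](lnK (M_gt0 a : M a \is Num.pos)) ler_expR -subr_ge0.
Qed.

(** The bound depends on the law of [(w + a)_+] only through its mean square, and exponentially. The
    product over all coordinates is therefore controlled by the sum of the mean squares, that is, by
    the objective of [Delta_bin]. *)
Lemma integral_gauss_expR_sq (a : R) :
  (\int[gauss]_w (expR (l * (Num.max (w + a) 0) ^+ 2))%:E
   <= (expR (l / (1 - 2 * l) * sqmean a))%:E)%E.
Proof.
apply: (@le_trans _ _ (M a)%:E); last by rewrite lee_fin mgf_sq_closed.
have cpos (w : R) : {for w, continuous (fun w : R => Num.max (w + a) 0)}.
  apply: (@continuous_comp _ _ _ (fun w : R => w + a) (fun w => Num.max w 0)).
    by apply: cvgD; [exact: cvg_id|exact: cvg_cst].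
  by apply: continuous_max; [exact: cvg_id|exact: cvg_cst].
have cf : continuous (fun w : R => expR (l * (Num.max (w + a) 0) ^+ 2)).
  move=> w; apply: (@continuous_comp _ _ _ (fun w : R => l * (Num.max (w + a) 0) ^+ 2) expR); last exact: continuous_expR.
  apply: cvgM; first exact: cvg_cst.
  by rewrite /GRing.exp/=; apply: cvgM; exact: cpos.
have mf := continuous_measurable_fun cf.
rewrite integral_gauss; first last.
- exact/measurable_EFinP.
- by move=> x; rewrite lee_fin expR_ge0.
have st : [set: R] = `]-oo, (- a)%R]%classic `|` `](- a)%R, +oo[%classic.
  apply/esym; rewrite -subTset => x _ /=; rewrite !in_itv/= andbT.
  by case: (leP x (- a)) => ?; [left|right].
have mG : measurable_fun setT (fun x : R => ((expR (l * Num.max (x + a) 0 ^+ 2))%:E * (phi x)%:E)%E).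
  by apply: emeasurable_funM; apply/measurable_EFinP => //; exact: measurable_phi.
rewrite {1}st ge0_integral_setU//=; first last.
- apply/disj_setPS => x /= []; rewrite !in_itv/= andbT => h1 h2.
  by move: (le_lt_trans h1 h2); rewrite ltxx.
- by move=> x _; rewrite mule_ge0// lee_fin ?phi_ge0 ?expR_ge0.
- by rewrite -st.
rewrite /M EFinD; apply: leeD.
  rewrite EFin_cdf01; apply: ge0_le_integral => //.
  - by move=> x _; rewrite mule_ge0// lee_fin ?phi_ge0 ?expR_ge0.
  - exact: measurable_funTS.
  - by apply/measurable_EFinP/measurable_funTS; exact: measurable_phi.
  - move=> x /=; rewrite in_itv/= => xa; rewrite -EFinM lee_fin.
    by rewrite (max_idPr _) ?expr0n/= ?mulr0 ?expR0 ?mul1r// -lerBrDr sub0r.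
(* Primitive found by completing the square: the tilted density is a multiple of the normal one with
   mean [(q ^+ 2 - 1) * a] and deviation [q]. *)
pose F (w : R) := q * E a q * cdf01 ((w - (q ^+ 2 - 1) * a) / q).
pose f (w : R) := expR (l * (w + a) ^+ 2) * phi w.
have dF (w : R) : is_derive w (1 : R) F (f w).
  have d1 := is_derive_cdf01 ((w - (q ^+ 2 - 1) * a) / q).
  have kE : E a q * phi ((w - (q ^+ 2 - 1) * a) / q) = f w.
    rewrite /E /f /phi mulrCA [RHS]mulrCA -!expRD; congr (_ * expR _).
    rewrite expr_div_n q2; field.
    by rewrite gt_eqF.
  rewrite -kE /F.
  have -> : q * E a q = E a q * q by rewrite mulrC.
  apply: is_derive_eq; rewrite /GRing.scale/=; field.
  by rewrite gt_eqF.
have Fl : F w @[w --> +oo] --> (q * E a q * 1 : R).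
  apply: cvgM; first exact: cvg_cst.
  apply: cvg_comp cdf01_cvgy; apply: gt0_cvgMly; first by rewrite invr_gt0.
  exact: cvg_addrr.
have cf' : continuous f.
  move=> w; apply: cvgM; last exact: continuous_phi.
  apply: (@continuous_comp _ _ _ (fun w : R => l * (w + a) ^+ 2) expR); last exact: continuous_expR.
  apply: cvgM; first exact: cvg_cst.
  by rewrite /GRing.exp/=; apply: cvgM; apply: cvgD; (exact: cvg_id || exact: cvg_cst).
rewrite integral_itv_obnd_cbnd; last exact: measurable_funTS.
apply: (@le_trans _ _ (\int[leb]_(x in `[(- a)%R, +oo[) (f x)%:E)%E).
  rewrite le_eqVlt; apply/orP; left; apply/eqP; apply: eq_integral => x.
  rewrite inE/= in_itv/= andbT => xa; rewrite -EFinM (max_idPl _)//.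
  by rewrite -lerBlDr sub0r.
rewrite (integral_itvcy_primitive _ cf' dF Fl).
  rewrite lee_fin /F.
  have -> : (- a - (q ^+ 2 - 1) * a) / q = - (q * a) by field; rewrite gt_eqF.
  by rewrite cdf01N; lra.
by move=> x _; rewrite /f mulr_ge0 ?phi_ge0 ?expR_ge0.
Qed.

End Mgf.

Lemma integral_sqdist_right (t : R) :
  (\int[leb]_(u in `[t, +oo[) ((u - t) ^+ 2 * phi u)%:E = (sqmean (- t))%:E)%E.
Proof. by rewrite -integral_sqmean opprK. Qed.

Lemma integral_sqdist_left (t : R) :
  (\int[leb]_(u in `]-oo, t]) ((u - t) ^+ 2 * phi u)%:E = (sqmean t)%:E)%E.
Proof.
rewrite -integral_sqmean -{1}(opprK t) ge0_integration_by_substitutionNy.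
- apply: eq_integral => x _ /=; congr EFin; rewrite /phi sqrrN; congr (_ * _).
  by rewrite -opprD sqrrN.
- exact/continuous_subspaceT/continuous_sqmean_int.
- by move=> x _; rewrite mulr_ge0 ?phi_ge0// sqr_ge0.
Qed.

(** Since [phi <= 1 / 2], the integral is at most that of [expR (- s * |w|) / 2] over the line. *)
Lemma integral_gauss_expRN_abs (s : R) : 0 < s ->
  (\int[gauss]_w (expR (- s * `|w|))%:E <= (s^-1)%:E)%E.
Proof.
move=> s0.
have cn : continuous (fun w : R => - s * `|w|).
  by move=> w; apply: cvgM; [exact: cvg_cst|exact: (@norm_continuous _ R^o)].
have cf : continuous (fun w : R => expR (- s * `|w|) * phi w).
  move=> w; apply: cvgM; last exact: continuous_phi.
  apply: (@continuous_comp _ _ _ (fun w : R => - s * `|w|) expR); first exact: cn.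
  exact: continuous_expR.
have cf' : continuous (fun w : R => expR (- s * `|w|)).
  move=> w; apply: (@continuous_comp _ _ _ (fun w : R => - s * `|w|) expR); first exact: cn.
  exact: continuous_expR.
rewrite integral_gauss; first last.
- by apply/measurable_EFinP; exact: continuous_measurable_fun.
- by move=> x; rewrite lee_fin expR_ge0.
under eq_integral do rewrite -EFinM.
rewrite (@ge0_symfun_integralT _ (fun w => expR (- s * `|w|) * phi w))//; first last.
- by move=> x /=; rewrite normrN /phi sqrrN.
- by move=> x; rewrite mulr_ge0 ?phi_ge0 ?expR_ge0.
have pi2 : 2 <= Num.sqrt (2 * pi) :> R.
  rewrite -(@ler_pXn2r _ 2)// ?nnegrE ?sqrtr_ge0// sqr_sqrtr ?mulr_ge0 ?pi_ge0//.
  by have := @pi_ge2 R; lra.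
have ph (x : R) : phi x <= 2^-1.
  rewrite /phi -[leRHS]mulr1 ler_pM ?expR_ge0 ?invr_ge0//.
    by rewrite lef_pV2 ?posrE//; lra.
  by rewrite -[leRHS]expR0 ler_expR mulNr oppr_le0 divr_ge0 ?sqr_ge0.
rewrite -set_itvcy.
have dF (x : R) : is_derive x (1 : R) (fun w => - (2 * s)^-1 * expR (- s * w)) (2^-1 * expR (- s * x)).
  apply: is_derive_eq; rewrite /GRing.scale/=; field.
  by rewrite gt_eqF.
have Fl : (- (2 * s)^-1 * expR (- s * w)) @[w --> +oo] --> (- (2 * s)^-1 * 0 : R).
  apply: cvgM; first exact: cvg_cst.
  have -> : (fun w : R => expR (- s * w)) = (fun w => expR (- (w * s))).
    by apply/funext => w; rewrite mulNr mulrC.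
  have h : (fun w : R => w * s) x @[x --> +oo] --> +oo.
    by apply: gt0_cvgMly => //; exact: cvg_id.
  exact: (cvg_comp _ _ h (@cvgr_expR R)).
have cg : continuous (fun x : R => 2^-1 * expR (- s * x)).
  move=> x; apply: cvgM; first exact: cvg_cst.
  apply: (@continuous_comp _ _ _ (fun w : R => - s * w) expR); last exact: continuous_expR.
  by apply: cvgM; [exact: cvg_cst|exact: cvg_id].
have -> : (s^-1%:E = 2%:E * \int[leb]_(x in `[0%R, +oo[) (2^-1 * expR (- s * x))%:E)%E.
  rewrite (integral_itvcy_primitive _ cg dF Fl).
    by rewrite -EFinM; congr EFin; rewrite !mulr0 expR0; field; rewrite gt_eqF.
  by move=> x _; rewrite mulr_ge0 ?expR_ge0.
apply: lee_wpmul2l; first by rewrite lee_fin.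
apply: ge0_le_integral => //.
- by move=> x _; rewrite lee_fin mulr_ge0 ?phi_ge0 ?expR_ge0.
- by apply/measurable_EFinP/measurable_funTS; exact: continuous_measurable_fun.
- by apply/measurable_EFinP/measurable_funTS; exact: continuous_measurable_fun.
- move=> x /=; rewrite in_itv/= andbT => x0; rewrite lee_fin ger0_norm// mulrC.
  by rewrite ler_pM2r ?expR_gt0.
Qed.

End OneVariable.

(** * Gaussian coordinates and random signs *)

Section Taylor.
Variable R : realType.
Notation gauss := (@normal_prob R 0 1).

Lemma taylor3_le (f f1 f2 f3 : R -> R) (c t : R) :
  (forall x : R, is_derive x (1 : R) f (f1 x)) ->
  (forall x : R, is_derive x (1 : R) f1 (f2 x)) ->
  (forall x : R, is_derive x (1 : R) f2 (f3 x)) ->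
  0 <= t -> (forall x, 0 <= x <= t -> f3 x <= c) ->
  f t <= f 0 + f1 0 * t + f2 0 / 2 * t ^+ 2 + c / 6 * t ^+ 3.
Proof.
move=> d1 d2 d3 t0 f3c.
have s2 x : 0 <= x <= t -> f2 x <= f2 0 + c * x.
  move=> /andP[x0 xt]; rewrite -subr_ge0.
  have : f2 0 + c * 0 - f2 0 <= f2 0 + c * x - f2 x.
    apply: (@is_derive_le _ (fun x => f2 0 + c * x - f2 x) (fun x => c - f3 x)) => //.
      by move=> y; apply: is_derive_eq; rewrite /GRing.scale/=; ring.
    by move=> y /andP[y0 yx]; rewrite subr_ge0 f3c// y0 (le_trans yx xt).
  by rewrite mulr0 addr0 subrr.
have s1 x : 0 <= x <= t -> f1 x <= f1 0 + f2 0 * x + c / 2 * x ^+ 2.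
  move=> /andP[x0 xt]; rewrite -subr_ge0.
  have : f1 0 + f2 0 * 0 + c / 2 * 0 ^+ 2 - f1 0 <= f1 0 + f2 0 * x + c / 2 * x ^+ 2 - f1 x.
    apply: (@is_derive_le _ (fun x => f1 0 + f2 0 * x + c / 2 * x ^+ 2 - f1 x) (fun x => f2 0 + c * x - f2 x)) => //.
      by move=> y; apply: is_derive_eq; rewrite /GRing.scale/=; field.
    by move=> y /andP[y0 yx]; rewrite subr_ge0 s2// y0 (le_trans yx xt).
  by rewrite expr0n/= !mulr0 !addr0 subrr.
rewrite -subr_ge0.
have : f 0 + f1 0 * 0 + f2 0 / 2 * 0 ^+ 2 + c / 6 * 0 ^+ 3 - f 0 <= f 0 + f1 0 * t + f2 0 / 2 * t ^+ 2 + c / 6 * t ^+ 3 - f t.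
  apply: (@is_derive_le _ (fun x => f 0 + f1 0 * x + f2 0 / 2 * x ^+ 2 + c / 6 * x ^+ 3 - f x) (fun x => f1 0 + f2 0 * x + c / 2 * x ^+ 2 - f1 x)) => //.
    by move=> y; apply: is_derive_eq; rewrite /GRing.scale/=; field.
  by move=> y yt; rewrite subr_ge0 s1.
by rewrite !expr0n/= !mulr0 !addr0 subrr.
Qed.

(* Derivatives are compared with [f] itself, so that the errors of order [e ^+ 3] stay
   multiplicative and can be iterated [e ^- 2] times. *)
Definition tame (K : R) (f f1 f2 : R -> R) : Prop :=
  exists f3 : R -> R,
  [/\ (forall x : R, is_derive x (1 : R) f (f1 x)),
      (forall x : R, is_derive x (1 : R) f1 (f2 x)),
      (forall x : R, is_derive x (1 : R) f2 (f3 x)),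
      (forall x, 0 < f x) &
      (forall x, [/\ `|f1 x| <= K * f x, `|f2 x| <= K * f x & `|f3 x| <= K * f x])].

Lemma tame_ge0 K f f1 f2 : tame K f f1 f2 -> 0 <= K.
Proof.
move=> [f3 [_ _ _ f0 /(_ 0)[h _ _]]].
by have := le_trans (normr_ge0 _) h; rewrite pmulr_lge0.
Qed.

Lemma tame_opp K f f1 f2 : tame K f f1 f2 ->
  tame K (fun x => f (- x)) (fun x => - f1 (- x)) (fun x => f2 (- x)).
Proof.
move=> [f3 [d1 d2 d3 f0 fK]]; exists (fun x => - f3 (- x)); split=> //.
- move=> x; have d := d1 (- x); apply: is_derive_eq; rewrite /GRing.scale/=; ring.
- move=> x; have d := d2 (- x); apply: is_derive_eq; rewrite /GRing.scale/=; ring.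
- move=> x; have d := d3 (- x); apply: is_derive_eq; rewrite /GRing.scale/=; ring.
- by move=> x; have [h1 h2 h3] := fK (- x); rewrite !normrN.
Qed.

(** Gronwall's argument: [f x * expR (- K * x)] is nonincreasing. *)
Lemma tame_growth K f f1 f2 (x : R) : tame K f f1 f2 -> 0 <= x ->
  f x <= f 0 * expR (K * x).
Proof.
move=> [f3 [d1 _ _ f0 fK]] x0.
have : - (f 0 * expR (- K * 0)) <= - (f x * expR (- K * x)).
  apply: (@is_derive_le _ (fun x => - (f x * expR (- K * x))) (fun x => (K * f x - f1 x) * expR (- K * x))) => //.
    by move=> y; apply: is_derive_eq; rewrite /GRing.scale/=; ring.
  move=> y _; rewrite mulr_ge0 ?expR_ge0// subr_ge0.
  by have [h _ _] := fK y; rewrite (le_trans (ler_norm _) h).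
rewrite lerN2 mulr0 expR0 mulr1 => h.
apply: (@le_trans _ _ (f x * expR (- K * x) * expR (K * x))).
  by rewrite -mulrA -expRD mulNr addNr expR0 mulr1.
by rewrite ler_pM2r ?expR_gt0.
Qed.

(** The third derivative is at most [K * f], and [f] between 0 and [t] is controlled by [f 0]
    through [tame_growth]. Negative [t] is reduced to positive [t] by reflection. *)
Lemma tame_taylor K f f1 f2 (t : R) : tame K f f1 f2 ->
  `|f t - (f 0 + f1 0 * t + f2 0 / 2 * t ^+ 2)| <= K * f 0 * `|t| ^+ 3 * expR (K * `|t|).
Proof.
wlog t0 : t f f1 f2 / 0 <= t.
  move=> H tf; case: (leP 0 t) => [t0|/ltW t0]; first exact: H.
  have := H (- t) _ _ _ _ (tame_opp tf); rewrite oppr_ge0 => /(_ t0).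
  by rewrite opprK oppr0 sqrrN mulrNN normrN.
move=> tf; have K0 := tame_ge0 tf; have gr x (x0 : 0 <= x) := tame_growth tf x0.
case: tf => f3 [d1 d2 d3 f0 fK].
rewrite (ger0_norm t0).
pose c := K * f 0 * expR (K * t).
have c0 : 0 <= c by rewrite !mulr_ge0 ?expR_ge0// ltW.
have f3c x : 0 <= x <= t -> `|f3 x| <= c.
  move=> /andP[x0 xt]; have [_ _ h] := fK x; apply: (le_trans h).
  rewrite /c -mulrA ler_wpM2l//; apply: (le_trans (gr _ x0)).
  by rewrite ler_pM2l// ler_expR ler_wpM2l.
have up := taylor3_le d1 d2 d3 t0 (fun x xt => le_trans (ler_norm _) (f3c x xt)).
have low : - f t <= - f 0 + - f1 0 * t + - f2 0 / 2 * t ^+ 2 + c / 6 * t ^+ 3.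
  apply: (@taylor3_le (fun x => - f x) (fun x => - f1 x) (fun x => - f2 x) (fun x => - f3 x)) => //.
  by move=> x xt; rewrite (le_trans (ler_norm _))// normrN f3c.
have t3 : 0 <= c * t ^+ 3 by rewrite mulr_ge0// exprn_ge0.
have -> : K * f 0 * t ^+ 3 * expR (K * t) = c * t ^+ 3 by rewrite /c; ring.
have e6 : c / 6 * t ^+ 3 = c * t ^+ 3 / 6 by ring.
by move: up low t3; rewrite ler_norml e6 => *; apply/andP; split; lra.
Qed.

Lemma tame_sym K f f1 f2 (t : R) : tame K f f1 f2 ->
  `|(f t + f (- t)) / 2 - (f 0 + f2 0 / 2 * t ^+ 2)| <= K * f 0 * `|t| ^+ 3 * expR (K * `|t|).
Proof.
move=> tf; have := tame_taylor t tf; have := tame_taylor (- t) tf.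
rewrite normrN sqrrN mulrN; move: (K * _ * _ * _) => c.
by rewrite !ler_norml => /andP[? ?] /andP[? ?]; apply/andP; split; lra.
Qed.

(** The derivatives of [S ^ r], divided by it, are polynomials in [S1 / S], [S2 / S], [S3 / S]. The
    third one is at most [B + 4 * B ^+ 2 + 3 * B ^+ 3], and [B >= 1] puts this below
    [10 * B ^+ 3]. *)
Lemma tame_powsum (S S1 S2 S3 : R -> R) (B r : R) :
  (forall x : R, is_derive x (1 : R) S (S1 x)) ->
  (forall x : R, is_derive x (1 : R) S1 (S2 x)) ->
  (forall x : R, is_derive x (1 : R) S2 (S3 x)) ->
  (forall x, 0 < S x) -> 1 <= B -> 0 <= r <= 1 ->
  (forall x, [/\ `|S1 x| <= B * S x, `|S2 x| <= B * S x & `|S3 x| <= B * S x]) ->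
  tame (10 * B ^+ 3) (fun x => expR (r * ln (S x)))
    (fun x => expR (r * ln (S x)) * (r * (S1 x / S x)))
    (fun x => expR (r * ln (S x)) * (r * (S2 x / S x) + r * (r - 1) * (S1 x / S x) ^+ 2)).
Proof.
move=> d1 d2 d3 S0 B1 /andP[r0 r1] SB.
have iS x : (S x)^-1 = expR (- ln (S x)) by rewrite expRN lnK// posrE.
pose l (x : R) : R := ln (S x).
have dl (x : R) : is_derive x (1 : R) l (S1 x * expR (- l x)).
  have d4 := is_derive1_ln (S0 x); have d1x := d1 x.
  have d5 := @is_derive1_comp R (@ln R) S x _ _ d4 d1x.
  by apply: (is_derive_eq d5); rewrite iS mulrC.
pose f3 (x : R) : R := let q1 := S1 x / S x in let q2 := S2 x / S x in let q3 := S3 x / S x in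
  expR (r * l x) * (r * q1 * (r * q2 + r * (r - 1) * q1 ^+ 2) + r * (q3 - q2 * q1)
   + 2 * (r * (r - 1)) * q1 * (q2 - q1 ^+ 2)).
exists f3; split.
- move=> x; have dlx := dl x.
  change (is_derive x (1 : R) (fun x => expR (r * l x)) (expR (r * l x) * (r * (S1 x / S x)))).
  by apply: is_derive_eq; rewrite /GRing.scale/= iS -/(l x); ring.
- move=> x; have dlx := dl x; have d2x := d2 x.
  have -> : (fun x => expR (r * ln (S x)) * (r * (S1 x / S x))) = (fun x => expR (r * l x) * (r * (S1 x * expR (- l x)))).
    by apply/funext => y; rewrite iS.
  by apply: is_derive_eq; rewrite /GRing.scale/= iS -/(l x); ring.
- move=> x; have dlx := dl x; have d2x := d2 x; have d3x := d3 x.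
  have -> : (fun x => expR (r * ln (S x)) * (r * (S2 x / S x) + r * (r - 1) * (S1 x / S x) ^+ 2)) = (fun x => expR (r * l x) * (r * (S2 x * expR (- l x)) + r * (r - 1) * (S1 x * expR (- l x)) ^+ 2)).
    by apply/funext => y; rewrite iS.
  by apply: is_derive_eq; rewrite /GRing.scale/= /f3 iS -/(l x); ring.
- by move=> x; exact: expR_gt0.
- move=> x; have [h1 h2 h3] := SB x.
  have q_le (y : R) : `|y| <= B * S x -> `|y / S x| <= B.
    by move=> h; rewrite normrM normfV (gtr0_norm (S0 x)) ler_pdivrMr.
  rewrite /f3 /=; move: (q_le _ h1) (q_le _ h2) (q_le _ h3).
  move: (S1 x / S x) (S2 x / S x) (S3 x / S x) => q1 q2 q3 {q_le h1 h2 h3} h1 h2 h3.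
  have B0 : 0 <= B by lra.
  have B2 : B <= B ^+ 2 by rewrite expr2 ler_peMl.
  have B3 : B ^+ 2 <= B ^+ 3 by rewrite exprS ler_peMl// sqr_ge0.
  have nr : `|r| <= 1 by rewrite ger0_norm.
  have nr1 : `|r - 1| <= 1 by rewrite ler_norml; apply/andP; split; lra.
  have M (a b A C : R) : `|a| <= A -> `|b| <= C -> `|a * b| <= A * C.
    by move=> ha hb; rewrite normrM ler_pM.
  have P (a b A C : R) : `|a| <= A -> `|b| <= C -> `|a + b| <= A + C.
    by move=> ha hb; rewrite (le_trans (ler_normD _ _))// lerD.
  have N (a A : R) : `|a| <= A -> `|- a| <= A by rewrite normrN.
  have key (y Y : R) : `|y| <= Y -> Y <= 10 * B ^+ 3 ->
      `|expR (r * ln (S x)) * y| <= 10 * B ^+ 3 * expR (r * ln (S x)).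
    move=> hy hY; rewrite normrM (gtr0_norm (expR_gt0 _)) mulrC.
    by rewrite ler_pM2r ?expR_gt0// (le_trans hy).
  have q11 := M _ _ _ _ h1 h1.
  have rr := M _ _ _ _ nr nr1.
  split.
  + by apply: (key _ _ (M _ _ _ _ nr h1)); nra.
  + rewrite expr2; apply: (key _ _ (P _ _ _ _ (M _ _ _ _ nr h2) (M _ _ _ _ rr q11))); nra.
  + rewrite expr2.
    have t1 := M _ _ _ _ (M _ _ _ _ nr h1) (P _ _ _ _ (M _ _ _ _ nr h2) (M _ _ _ _ rr q11)).
    have t2 := M _ _ _ _ nr (P _ _ _ _ h3 (N _ _ (M _ _ _ _ h2 h1))).
    have n2 : `|2 : R| <= 2 by rewrite normr_nat.
    have t3 := M _ _ _ _ (M _ _ _ _ (M _ _ _ _ n2 rr) h1) (P _ _ _ _ h2 (N _ _ q11)).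
    apply: (key _ _ (P _ _ _ _ (P _ _ _ _ t1 t2) t3)).
    have e2 : B * B = B ^+ 2 by rewrite expr2.
    have e3 : B * B ^+ 2 = B ^+ 3 by rewrite -exprS.
    have -> : 1 * B * (1 * B + 1 * 1 * (B * B)) + 1 * (B + B * B) + 2 * (1 * 1) * B * (B + B * B) = B + 4 * B ^+ 2 + 3 * B ^+ 3 by ring.
    lra.
Qed.

Let exp_chain (E G1 G2 G3 : R -> R) :
  (forall x : R, is_derive x (1 : R) E (E x * G1 x)) ->
  (forall x : R, is_derive x (1 : R) G1 (G2 x)) ->
  (forall x : R, is_derive x (1 : R) G2 (G3 x)) ->
  (forall x : R, is_derive x (1 : R) (fun t => E t * G1 t) (E x * (G1 x ^+ 2 + G2 x))) /\
  (forall x : R, is_derive x (1 : R) (fun t => E t * (G1 t ^+ 2 + G2 t))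
     (E x * (G1 x ^+ 3 + 3 * G1 x * G2 x + G3 x))).
Proof.
move=> d1 d2 d3; split => x; have h1 := d1 x; have h2 := d2 x; have h3 := d3 x.
  by apply: is_derive_eq; rewrite /GRing.scale/=; ring.
by apply: is_derive_eq; rewrite /GRing.scale/=; ring.
Qed.

(** One term of the soft maximum along a line. As the quadratic stays above [eta ^+ 2], the
    derivatives of its root of orders one to three are at most [kap], [kap ^+ 2 / eta] and
    [3 * kap ^+ 3 / eta ^+ 2]. These bounds involve neither [a] nor [v], so they are uniform in the
    base point. *)
Lemma tame_exp_sqrt (a b c v p beta eta kap : R) :
  0 < eta -> 0 <= kap -> 0 <= c <= kap ^+ 2 -> 0 < beta -> b ^+ 2 <= a * c ->
  (forall t : R, eta ^+ 2 <= a + 2 * b * t + c * t ^+ 2) -> `|p| <= kap ->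
  let sg t := Num.sqrt (a + 2 * b * t + c * t ^+ 2) in
  let sg1 t := (b + c * t) / sg t in
  let e t := expR (beta * (v + p * t - sg t)) in
  let e1 t := e t * (beta * (p - sg1 t)) in
  let e2 t := e t * ((beta * (p - sg1 t)) ^+ 2 - beta * ((c - sg1 t ^+ 2) / sg t)) in
  let B := 10 * (1 + 2 * (beta * kap) + beta * kap ^+ 2 / eta + 3 * (beta * kap ^+ 3 / eta ^+ 2)) ^+ 3 in
  exists e3 : R -> R,
  [/\ (forall x : R, is_derive x (1 : R) e (e1 x)),
      (forall x : R, is_derive x (1 : R) e1 (e2 x)),
      (forall x : R, is_derive x (1 : R) e2 (e3 x)) &
      forall x, [/\ `|e1 x| <= B * e x, `|e2 x| <= B * e x & `|e3 x| <= B * e x]].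
Proof.
move=> eta0 kap0 /andP[c0 ck] beta0 bac Q pk sg sg1 e e1 e2 B.
have Q0 t : 0 < a + 2 * b * t + c * t ^+ 2 by rewrite (lt_le_trans _ (Q t))// exprn_gt0.
have sg0 t : 0 < sg t by rewrite sqrtr_gt0.
have sg_eta t : eta <= sg t.
  by rewrite -(ger0_norm (ltW eta0)) -sqrtr_sqr ler_wsqrtr.
have sq t : sg t ^+ 2 = a + 2 * b * t + c * t ^+ 2 by rewrite sqr_sqrtr// ltW.
pose inv t := (sg t)^-1.
have sginv t : sg t * inv t = 1 by rewrite /inv mulfV// gt_eqF.
have inv0 t : 0 < inv t by rewrite invr_gt0.
have inv_eta t : inv t <= eta^-1 by rewrite lef_pV2 ?posrE.
have dsg (t : R) : is_derive t (1 : R) sg (sg1 t).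
  have dq : is_derive t (1 : R) (fun t => a + 2 * b * t + c * t ^+ 2) (2 * (b + c * t)).
    by apply: is_derive_eq; rewrite /GRing.scale/=; ring.
  have d5 := @is_derive1_comp R (@Num.sqrt R) (fun t => a + 2 * b * t + c * t ^+ 2) t _ _ (is_derive1_sqrt (Q0 t)) dq.
  apply: (is_derive_eq d5); rewrite /sg1 -/(sg t) invfM.
  by field; rewrite gt_eqF.
have dinv (t : R) : is_derive t (1 : R) inv (- ((b + c * t) * inv t) * inv t ^+ 2).
  have d := dsg t.
  have dl := @is_derive1_comp R (@ln R) sg t _ _ (is_derive1_ln (sg0 t)) d.
  have iE : inv = (fun t => expR (- (@ln R \o sg) t)).
    by apply/funext => s; rewrite /= expRN lnK// posrE.
  rewrite [X in is_derive _ _ X]iE; apply: is_derive_eq.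
  rewrite /GRing.scale/= expRN lnK ?posrE// /sg1 -/(inv t); ring.
pose G1 t := beta * (p - (b + c * t) * inv t).
pose G2 t := - beta * ((c - ((b + c * t) * inv t) ^+ 2) * inv t).
pose G3 t := 3 * beta * ((b + c * t) * inv t) * ((c - ((b + c * t) * inv t) ^+ 2) * inv t) * inv t.
have de (t : R) : is_derive t (1 : R) e (e t * G1 t).
  have d := dsg t; rewrite /e; apply: is_derive_eq.
  by rewrite /GRing.scale/= /G1 /sg1 /inv; ring.
have dG1 (t : R) : is_derive t (1 : R) G1 (G2 t).
  have d := dinv t; rewrite /G1; apply: is_derive_eq.
  by rewrite /GRing.scale/= /G2; ring.
have dG2 (t : R) : is_derive t (1 : R) G2 (G3 t).
  have d := dinv t; rewrite /G2; apply: is_derive_eq.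
  by rewrite /GRing.scale/= /G3; ring.
have e1E : e1 = (fun t => e t * G1 t) by [].
have e2E : e2 = (fun t => e t * (G1 t ^+ 2 + G2 t)).
  by apply/funext => t; rewrite /e2 /G1 /G2 /sg1 /inv; ring.
exists (fun t => e t * (G1 t ^+ 3 + 3 * G1 t * G2 t + G3 t)); split.
- by move=> x; rewrite e1E; exact: de.
- by rewrite e1E e2E; have [] := exp_chain de dG1 dG2.
- by rewrite e2E; have [] := exp_chain de dG1 dG2.
move=> x; rewrite e1E e2E.
(* The condition [b ^+ 2 <= a * c] is exactly [(b + c * x) ^+ 2 <= c * (a + 2 * b * x + c * x ^+
   2)]. *)
have sg1k : `|(b + c * x) * inv x| <= kap.
  rewrite -(@ler_pXn2r _ 2)// ?nnegrE ?normr_ge0// real_normK ?num_real//.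
  rewrite exprMn /inv exprVn ler_pdivrMr ?exprn_gt0//.
  apply: (@le_trans _ _ (c * sg x ^+ 2)); last by rewrite ler_pM2r ?exprn_gt0.
  by rewrite sq; nra.
have s2 : `|(c - ((b + c * x) * inv x) ^+ 2) * inv x| <= kap ^+ 2 / eta.
  rewrite normrM (gtr0_norm (inv0 x)) ler_pM//; first exact: ltW.
  have : ((b + c * x) * inv x) ^+ 2 <= c.
    rewrite exprMn /inv exprVn ler_pdivrMr ?exprn_gt0// sq; nra.
  have := sqr_ge0 ((b + c * x) * inv x).
  by move=> *; rewrite ler_norml; apply/andP; split; lra.
pose W1 := 2 * (beta * kap); pose W2 := beta * kap ^+ 2 / eta; pose W3 := 3 * (beta * kap ^+ 3 / eta ^+ 2).
have W10 : 0 <= W1 by rewrite /W1 !mulr_ge0// ltW.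
have W20 : 0 <= W2 by rewrite /W2 divr_ge0 ?mulr_ge0 ?exprn_ge0// ltW.
have W30 : 0 <= W3 by rewrite /W3 mulr_ge0// divr_ge0 ?mulr_ge0 ?exprn_ge0// ltW.
have b1 : `|G1 x| <= W1.
  rewrite /G1 normrM (gtr0_norm beta0) /W1 mulrCA ler_pM2l//.
  by rewrite mulr_natl mulr2n (le_trans (ler_normB _ _))// lerD.
have b2 : `|G2 x| <= W2.
  by rewrite /G2 normrM normrN (gtr0_norm beta0) /W2 -mulrA ler_pM2l.
have b3 : `|G3 x| <= W3.
  rewrite /G3; move: ((b + c * x) * inv x) sg1k s2 => A sg1k.
  move: ((c - A ^+ 2) * inv x) => D s2.
  rewrite !normrM (gtr0_norm beta0) normr_nat (gtr0_norm (inv0 x)).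
  have -> : W3 = 3 * beta * kap * (kap ^+ 2 / eta) * eta^-1 by rewrite /W3; field; rewrite gt_eqF.
  rewrite ler_pM ?mulr_ge0 ?normr_ge0 ?(ltW beta0) ?(ltW (inv0 x))//.
  by rewrite ler_pM ?mulr_ge0 ?normr_ge0 ?(ltW beta0)// ler_wpM2l// mulr_ge0// ltW.
rewrite /B -/W1 -/W2 -/W3.
move: (G1 x) (G2 x) (G3 x) b1 b2 b3 => g1 g2 g3 b1 b2 b3.
set W := 1 + W1 + W2 + W3.
have w1 : 1 <= W by rewrite /W; lra.
have {}b1 : `|g1| <= W by rewrite /W; lra.
have {}b2 : `|g2| <= W by rewrite /W; lra.
have {}b3 : `|g3| <= W by rewrite /W; lra.
have W0 : 0 <= W by lra.
have WW : W <= W ^+ 2 by rewrite expr2 ler_peMl.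
have WWW : W ^+ 2 <= W ^+ 3 by rewrite exprS ler_peMl// sqr_ge0.
have M (u w A C : R) : `|u| <= A -> `|w| <= C -> `|u * w| <= A * C.
  by move=> ha hb; rewrite normrM ler_pM.
have P (u w A C : R) : `|u| <= A -> `|w| <= C -> `|u + w| <= A + C.
  by move=> ha hb; rewrite (le_trans (ler_normD _ _))// lerD.
have key (y Y : R) : `|y| <= Y -> Y <= 10 * W ^+ 3 -> `|e x * y| <= 10 * W ^+ 3 * e x.
  move=> hy hY; rewrite normrM (gtr0_norm (expR_gt0 _)) mulrC.
  by rewrite ler_pM2r ?expR_gt0// (le_trans hy).
have e22 : W * W = W ^+ 2 by rewrite expr2.
have e3 : W * W * W = W ^+ 3 by rewrite !exprS expr0; ring.
have q11 := M _ _ _ _ b1 b1.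
have n3 : `|3 : R| <= 3 by rewrite normr_nat.
split.
- by apply: (key _ _ b1); lra.
- by rewrite expr2; apply: (key _ _ (P _ _ _ _ q11 b2)); lra.
- have -> : g1 ^+ 3 = g1 * g1 * g1 by rewrite !exprS expr0; ring.
  apply: (key _ _ (P _ _ _ _ (P _ _ _ _ (M _ _ _ _ q11 b1) (M _ _ _ _ (M _ _ _ _ n3 b1) b2)) b3)).
  have -> : 3 * W * W = 3 * (W * W) by ring.
  by lra.
Qed.

End Taylor.

(** * One small Gaussian step against one random sign *)

Section GaussStep.
Variable R : realType.
Notation gauss := (@normal_prob R 0 1).
Notation leb := (@lebesgue_measure R).

Lemma integral_gauss_sqr : (\int[gauss]_w (w ^+ 2)%:E = 1)%E.
Proof.
have mf : measurable_fun setT (fun w : R => w ^+ 2 * phi w).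
  by apply: measurable_funM; [exact: measurable_funX|exact: measurable_phi].
rewrite integral_gauss; first last.
- by apply/measurable_EFinP; exact: measurable_funX.
- by move=> x; rewrite lee_fin sqr_ge0.
under eq_integral do rewrite -EFinM.
have st : [set: R] = `]-oo, 0%R]%classic `|` `]0%R, +oo[%classic.
  apply/esym; rewrite -subTset => x _ /=; rewrite !in_itv/= andbT.
  by case: (leP x 0) => ?; [left|right].
rewrite {1}st ge0_integral_setU//=; first last.
- apply/disj_setPS => x /= []; rewrite !in_itv/= andbT => h1 h2.
  by move: (le_lt_trans h1 h2); rewrite ltxx.
- by move=> x _; rewrite lee_fin mulr_ge0 ?sqr_ge0 ?phi_ge0.
- by rewrite -st; exact/measurable_EFinP.
rewrite integral_itv_obnd_cbnd; last by apply/measurable_EFinP/measurable_funTS.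
have e2 := @integral_sqdist_right R 0; have e1 := @integral_sqdist_left R 0.
have -> : (\int[leb]_(x in `]-oo, 0%R]) (x ^+ 2 * phi x)%:E = (sqmean (0 : R))%:E)%E.
  by rewrite -e1; apply: eq_integral => x _; rewrite subr0.
have -> : (\int[leb]_(x in `[0%R, +oo[) (x ^+ 2 * phi x)%:E = (sqmean (- 0 : R))%:E)%E.
  by rewrite -e2; apply: eq_integral => x _; rewrite subr0.
have h : cdf01 (0 : R) = 1 - cdf01 0 by rewrite -cdf01N oppr0.
by rewrite oppr0 /sqmean -EFinD; congr EFin; rewrite expr0n /=; lra.
Qed.

Lemma integral_gauss_poly (A B D c : R) : 0 <= A -> 0 <= B -> 0 <= D ->
  (\int[gauss]_w (A + B * w ^+ 2 + D * (expR (c * w) + expR (- c * w)))%:E =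
   (A + B + 2 * D * expR (c ^+ 2 / 2))%:E)%E.
Proof.
move=> A0 B0 D0.
have mx c' : measurable_fun setT (fun w : R => expR (c' * w)).
  by apply: measurableT_comp => //.
have mex c' : measurable_fun setT (fun w : R => (expR (c' * w))%:E).
  exact/measurable_EFinP.
have m2 : measurable_fun setT (fun w : R => (w ^+ 2)%:E).
  by apply/measurable_EFinP; exact: measurable_funX.
transitivity (\int[gauss]_w (A%:E + B%:E * (w ^+ 2)%:E + D%:E * ((expR (c * w))%:E + (expR (- c * w))%:E)))%E.
  by apply: eq_integral.
rewrite ge0_integralD//; last 4 first.
- move=> w _; rewrite -EFinM -EFinD lee_fin.
  exact: addr_ge0 A0 (mulr_ge0 B0 (sqr_ge0 w)).
- by apply: emeasurable_funD => //; exact: measurable_funeM.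
- move=> w _; rewrite -EFinD -EFinM lee_fin.
  exact: mulr_ge0 D0 (addr_ge0 (expR_ge0 _) (expR_ge0 _)).
- by apply: measurable_funeM; apply: emeasurable_funD; exact: mex.
rewrite ge0_integralD//; last 2 first.
- by move=> w _; rewrite -EFinM lee_fin; exact: mulr_ge0 B0 (sqr_ge0 w).
- exact: measurable_funeM.
rewrite integral_cst//= probability_setT mule1.
rewrite ge0_integralZl//; last by move=> w _; rewrite lee_fin sqr_ge0.
rewrite integral_gauss_sqr mule1.
rewrite ge0_integralZl//; last 2 first.
- by apply: emeasurable_funD; exact: mex.
- by move=> w _; rewrite adde_ge0// lee_fin expR_ge0.
rewrite ge0_integralD//; [|exact: mex|exact: mex].
rewrite !integral_gauss_expR sqrrN.
transitivity (A + B + D * (expR (c ^+ 2 / 2) + expR (c ^+ 2 / 2)))%:E => //.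
by congr EFin; ring.
Qed.

(** A standard Gaussian and a random sign share mean and variance, so their averages of the
    second-order Taylor polynomial agree and only cubic remainders differ. For [e <= e0] both
    averages are at least [f 0 / 2], which turns errors of size [e ^+ 3 * f 0] into relative
    ones. *)
Lemma gauss_rademacher_step (K : R) : 0 <= K ->
  exists C e0 : R, [/\ 0 < C, 0 < e0 & forall f f1 f2, tame K f f1 f2 ->
    forall e, 0 < e <= e0 ->
    (\int[gauss]_w (f (e * w))%:E <= ((1 + C * e ^+ 3) * ((f e + f (- e)) / 2))%:E)%E /\
    (((f e + f (- e)) / 2)%:E <= (1 + C * e ^+ 3)%:E * \int[gauss]_w (f (e * w))%:E)%E].
Proof.
move=> K0.
pose c := K + 1.
pose C1 := 54 * (K + 1) * expR (c ^+ 2 / 2).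
have C10 : 0 < C1 by rewrite /C1 !mulr_gt0 ?expR_gt0//; lra.
exists (4 * C1), (K + 2 * C1 + 1)^-1; split.
- by rewrite mulr_gt0.
- by rewrite invr_gt0; lra.
move=> f f1 f2 tf e /andP[e0 ee].
have e1 : e <= 1 by rewrite (le_trans ee)// invf_le1; lra.
have [f3 [d1 d2 d3 f0 fK]] := tf.
have cf : continuous f.
  by move=> x; apply: differentiable_continuous; apply/derivable1_diffP; case: (d1 x).
have cfe : continuous (fun w : R => f (e * w)).
  move=> x; apply: (@continuous_comp _ _ _ (fun w : R => e * w) f); last exact: cf.
  by apply: cvgM; [exact: cvg_cst|exact: cvg_id].
have mfe : measurable_fun setT (fun w : R => f (e * w)) by exact: continuous_measurable_fun.
have mfeN : measurable_fun setT (fun w : R => f (e * - w)).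
  by apply: (measurableT_comp mfe).
have [F1 F2 F3] := fK 0.
set g := f 0 in F1 F2 F3 *.
have g0 : 0 < g by exact: f0.
set h := f2 0 in F2 *.
have /andP[h1 h2] : - (K * g) <= h <= K * g by rewrite -ler_norml.
set G := (\int[gauss]_w (f (e * w))%:E)%E.
have e30 : 0 < e ^+ 3 by rewrite exprn_gt0.
have e20 : 0 < e ^+ 2 by rewrite exprn_gt0.
pose E3 (w : R) : R := 27 * K * g * e ^+ 3 * (expR (c * w) + expR (- c * w)).
have err (w : R) : `|f (e * w) + f (e * - w) - (2 * g + h * e ^+ 2 * w ^+ 2)| <= 2 * E3 w.
  have := tame_sym (e * w) tf; rewrite -/g -/h.
  have -> : (f (e * w) + f (- (e * w))) / 2 - (g + h / 2 * (e * w) ^+ 2) =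
     (f (e * w) + f (e * - w) - (2 * g + h * e ^+ 2 * w ^+ 2)) / 2.
    by rewrite mulrN; field.
  rewrite normrM (ger0_norm (_ : 0 <= 2^-1))//.
  move=> H; suff : K * g * `|e * w| ^+ 3 * expR (K * `|e * w|) <= E3 w by move: H; lra.
  rewrite normrM (gtr0_norm e0) exprMn /E3.
  (* From [|w| / 3 <= expR (|w| / 3)], cubed. The extra [expR |w|] is absorbed by [c = K + 1]. *)
  have w3 : `|w| ^+ 3 <= 27 * expR `|w|.
    have -> : expR `|w| = expR (`|w| / 3) ^+ 3 by rewrite -expRM_natl; congr expR; field.
    have := expR_ge1Dx (`|w| / 3) => hh.
    have -> : 27 * expR (`|w| / 3) ^+ 3 = (3 * expR (`|w| / 3)) ^+ 3 by ring.
    rewrite ler_pXn2r ?nnegrE ?mulr_ge0 ?expR_ge0//; lra.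
  have ew : expR (K * (e * `|w|)) <= expR (K * `|w|).
    by rewrite ler_expR ler_wpM2l// ler_piMl.
  have ab : expR (c * `|w|) <= expR (c * w) + expR (- c * w).
    case: (leP 0 w) => w0; first by rewrite ger0_norm// lerDl expR_ge0.
    by rewrite ltr0_norm// mulrN -mulNr lerDr expR_ge0.
  apply: (@le_trans _ _ (K * g * e ^+ 3 * (27 * expR `|w| * expR (K * `|w|)))).
    have -> : K * g * (e ^+ 3 * `|w| ^+ 3) * expR (K * (e * `|w|)) = K * g * e ^+ 3 * (`|w| ^+ 3 * expR (K * (e * `|w|))) by ring.
    have Kge3 : 0 <= K * g * e ^+ 3 by rewrite mulr_ge0 ?(ltW e30)// mulr_ge0// ltW.
    by rewrite (ler_wpM2l Kge3)// ler_pM ?exprn_ge0 ?expR_ge0.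
  have -> : 27 * expR `|w| * expR (K * `|w|) = 27 * expR (c * `|w|).
    by rewrite -mulrA -expRD /c; congr (_ * expR _); ring.
  have -> : 27 * K * g * e ^+ 3 * (expR (c * w) + expR (- c * w)) = K * g * e ^+ 3 * (27 * (expR (c * w) + expR (- c * w))) by ring.
  have Kge3 : 0 <= K * g * e ^+ 3 by rewrite mulr_ge0 ?(ltW e30)// mulr_ge0// ltW.
  by rewrite (ler_wpM2l Kge3)// ler_wpM2l.
have GG : (\int[gauss]_w (f (e * w) + f (e * - w))%:E = G + G)%E.
  under eq_integral do rewrite EFinD.
  rewrite ge0_integralD//; last 4 first.
  - by move=> w _; rewrite lee_fin ltW.
  - exact/measurable_EFinP.
  - by move=> w _; rewrite lee_fin ltW.
  - exact/measurable_EFinP.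
  by rewrite (@integral_gauss_opp R (fun w => f (e * w)) cfe)// => x; rewrite ltW.
have Rerr : `|(f e + f (- e)) / 2 - (g + h / 2 * e ^+ 2)| <= C1 * e ^+ 3 * g.
  apply: (le_trans (tame_sym e tf)); rewrite -/g (gtr0_norm e0).
  have -> : K * g * e ^+ 3 * expR (K * e) = (K * expR (K * e)) * e ^+ 3 * g by ring.
  rewrite ler_pM2r// ler_pM2r// /C1.
  rewrite ler_pM ?expR_ge0//; first by lra.
  by rewrite ler_expR /c; nra.
pose X := 27 * K * g * e ^+ 3.
have Kg : 0 <= K * g by exact: mulr_ge0 K0 (ltW g0).
have X0 : 0 <= X by exact: mulr_ge0 (mulr_ge0 (mulr_ge0 (ler0n R 27) K0) (ltW g0)) (ltW e30).
have Kg0 : 0 <= K * g * e ^+ 2 by exact: mulr_ge0 Kg (ltW e20).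
have hKg0 : 0 <= (h + K * g) * e ^+ 2 by apply: mulr_ge0 (ltW e20); lra.
have mff : measurable_fun setT (fun w : R => (f (e * w) + f (e * - w))%:E).
  by apply/measurable_EFinP; exact: measurable_funD.
have mpoly A B D : measurable_fun setT (fun w : R => (A + B * w ^+ 2 + D * (expR (c * w) + expR (- c * w)))%:E).
  apply/measurable_EFinP; apply: measurable_funD.
    by apply: measurable_funD => //; apply: measurable_funM => //; exact: measurable_funX.
  by apply: measurable_funM => //; apply: measurable_funD; exact: measurableT_comp.
have ff0 w : (0 <= (f (e * w) + f (e * - w))%:E)%E by rewrite lee_fin addr_ge0 ?ltW.
have poly0 A B D w : 0 <= A -> 0 <= B -> 0 <= D ->
    (0 <= (A + B * w ^+ 2 + D * (expR (c * w) + expR (- c * w)))%:E)%E.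
  move=> A0 B0 D0; rewrite lee_fin addr_ge0 ?mulr_ge0 ?addr_ge0 ?expR_ge0//.
  by rewrite mulr_ge0 ?sqr_ge0.
have lin B D : 0 <= B -> 0 <= D ->
    (\int[gauss]_w ((f (e * w) + f (e * - w))%:E + (0 + B * w ^+ 2 + D * (expR (c * w) + expR (- c * w)))%:E)
     = G + G + (0 + B + 2 * D * expR (c ^+ 2 / 2))%:E)%E.
  move=> B0 D0; rewrite ge0_integralD//.
  - by rewrite GG integral_gauss_poly.
  - by move=> w _; exact: poly0.
  - exact: mpoly.
have g20 : 0 <= 2 * g by rewrite mulr_ge0// ltW.
have X20 : 0 <= 2 * X by rewrite mulr_ge0.
(* The term [K * g * e ^+ 2 * w ^+ 2] is added on both sides because [h] may be negative, whereas
   only nonnegative functions are integrated; [K * g] dominates [|h|]. *)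
have up2 : (G + G + (0 + K * g * e ^+ 2 + 2 * 0 * expR (c ^+ 2 / 2))%:E <=
    (2 * g + (h + K * g) * e ^+ 2 + 2 * (2 * X) * expR (c ^+ 2 / 2))%:E)%E.
  rewrite -(lin _ _ Kg0 (lexx 0)) -(integral_gauss_poly c g20 hKg0 X20).
  apply: ge0_le_integral => //.
  - by move=> w _; apply: adde_ge0; [exact: ff0|exact: poly0].
  - by apply: emeasurable_funD; [exact: mff|exact: mpoly].
  - exact: mpoly.
  - move=> w _; rewrite -EFinD lee_fin; have := err w.
    rewrite ler_norml /E3 -/X => /andP[_]; lra.
have low2 : ((2 * g + (h + K * g) * e ^+ 2 + 2 * 0 * expR (c ^+ 2 / 2))%:E <=
    G + G + (0 + K * g * e ^+ 2 + 2 * (2 * X) * expR (c ^+ 2 / 2))%:E)%E.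
  rewrite -(lin _ _ Kg0 X20) -(integral_gauss_poly c g20 hKg0 (lexx 0)).
  apply: ge0_le_integral => //.
  - by move=> w _; exact: poly0.
  - exact: mpoly.
  - by apply: emeasurable_funD; [exact: mff|exact: mpoly].
  - move=> w _; rewrite -EFinD lee_fin; have := err w.
    rewrite ler_norml /E3 -/X => /andP[+ _]; lra.
have G0 : (0 <= G)%E by apply: integral_ge0 => w _; rewrite lee_fin ltW.
have Gf : (G = (fine G)%:E)%E.
  rewrite fineK// ge0_fin_numE//.
  apply: (@le_lt_trans _ _ (G + G + (0 + K * g * e ^+ 2 + 2 * 0 * expR (c ^+ 2 / 2))%:E)%E).
    by rewrite -addeA leeDl// adde_ge0// lee_fin mulr0 mul0r add0r addr0.
  by rewrite (le_lt_trans up2)// ltry.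
have XC : X * expR (c ^+ 2 / 2) * 2 <= C1 * e ^+ 3 * g.
  have -> : X * expR (c ^+ 2 / 2) * 2 = 54 * K * expR (c ^+ 2 / 2) * e ^+ 3 * g by rewrite /X; ring.
  rewrite ler_pM2r// ler_pM2r// /C1 ler_pM2r ?expR_gt0//; lra.
have small : g / 2 <= g + h / 2 * e ^+ 2 - C1 * e ^+ 3 * g.
  have eK : e * (K + 2 * C1 + 1) <= 1 by rewrite -ler_pdivlMr ?div1r//; lra.
  have e2e : e ^+ 2 <= e by rewrite expr2 ler_piMl// ltW.
  have e3e : e ^+ 3 <= e by rewrite exprS (le_trans _ e2e)// expr2 ler_pM2l.
  have hh : - (K * g * e) <= h * e ^+ 2.
    apply: (@le_trans _ _ (- (K * g) * e ^+ 2)); last by rewrite ler_pM2r.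
    by rewrite mulNr lerN2 ler_wpM2l// mulr_ge0// ltW.
  have cc : C1 * e ^+ 3 * g <= C1 * e * g by rewrite ler_pM2r// ler_pM2l.
  have : g * (e * (K + 2 * C1 + 1)) <= g * 1 by rewrite ler_pM2l.
  have : 0 < g * e by rewrite mulr_gt0.
  have -> : h / 2 * e ^+ 2 = h * e ^+ 2 / 2 by ring.
  have -> : g * (e * (K + 2 * C1 + 1)) = K * g * e + 2 * (C1 * e * g) + g * e by ring.
  move: (C1 * e * g) (h * e ^+ 2) (C1 * e ^+ 3 * g) (K * g * e) (g * e) hh cc => *; lra.
move: up2 low2; rewrite Gf -!EFinD !lee_fin => up2 low2.
move: Rerr; rewrite ler_norml => /andP[r1 r2].
move: up2 low2 r1 r2 small XC.
have -> : 2 * (2 * X) * expR (c ^+ 2 / 2) = 2 * (X * expR (c ^+ 2 / 2) * 2) by ring.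
have -> : h / 2 * e ^+ 2 = h * e ^+ 2 / 2 by ring.
have -> : (h + K * g) * e ^+ 2 = h * e ^+ 2 + K * g * e ^+ 2 by ring.
set r := (f e + f (- e)) / 2.
have -> : (1 + 4 * C1 * e ^+ 3) * r = r + 4 * (C1 * e ^+ 3) * r by ring.
have -> : (1 + 4 * C1 * e ^+ 3) * fine G = fine G + 4 * (C1 * e ^+ 3) * fine G by ring.
have : 0 < C1 * e ^+ 3 by rewrite mulr_gt0.
move: (h * e ^+ 2) (K * g * e ^+ 2) (X * expR (c ^+ 2 / 2) * 2) (C1 * e ^+ 3) (fine G) r.
move=> he kg xx cc gg r cc0 up2 low2 r1 r2 small XC.
have rg : g / 2 <= r by lra.
have ggg : g / 2 <= gg by lra.
have k1 : cc * (g / 2) <= cc * r by rewrite ler_pM2l.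
have k2 : cc * (g / 2) <= cc * gg by rewrite ler_pM2l.
have k3 : 4 * cc * r = 4 * (cc * r) by ring.
have k4 : 4 * cc * gg = 4 * (cc * gg) by ring.
have k5 : cc * (g / 2) = cc * g / 2 by ring.
rewrite k3 k4; split; lra.
Qed.

(** By Lagrange's identity the defect is half of a double sum of squares. *)
Lemma cauchy_schwarz_sum (I : finType) (f g : I -> R) :
  (\sum_i f i * g i) ^+ 2 <= (\sum_i f i ^+ 2) * (\sum_i g i ^+ 2).
Proof.
have : 0 <= \sum_i \sum_j (f i * g j - f j * g i) ^+ 2.
  by apply: sumr_ge0 => i _; apply: sumr_ge0 => j _; exact: sqr_ge0.
have -> : \sum_i \sum_j (f i * g j - f j * g i) ^+ 2 =
  2 * ((\sum_i f i ^+ 2) * (\sum_i g i ^+ 2) - (\sum_i f i * g i) ^+ 2).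
  have e1 : (\sum_i f i ^+ 2) * (\sum_i g i ^+ 2) = \sum_i \sum_j f i ^+ 2 * g j ^+ 2.
    by rewrite mulr_suml; apply: eq_bigr => i _; rewrite mulr_sumr.
  have e2 : (\sum_i f i * g i) ^+ 2 = \sum_i \sum_j f i * g i * (f j * g j).
    by rewrite expr2 mulr_suml; apply: eq_bigr => i _; rewrite mulr_sumr.
  rewrite mulrBr {1}mulr_natl mulr2n {1}e1 e1 [X in _ + X - _]exchange_big/= e2 mulr_sumr.
  rewrite -big_split/= -sumrB; apply: eq_bigr => i _.
  rewrite mulr_sumr -big_split/= -sumrB; apply: eq_bigr => j _; ring.
by rewrite pmulr_rge0// subr_ge0.
Qed.

End GaussStep.

(** * Averages over independent random signs *)

Section SignAverage.
Variables (R : realType) (J : finType).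

Definition bump_at (z : J -> R) (j : J) (t : R) : J -> R :=
  fun i => z i + t * (i == j)%:R.

Fixpoint sign_avg (js : seq J) (H : (J -> R) -> R) (s : J -> R) : R :=
  if js is j :: js' then
    (sign_avg js' H (bump_at s j 1) + sign_avg js' H (bump_at s j (- 1))) / 2
  else H s.

(** Only points reachable from [s] matter, and they lie in a bounded box; the Taylor estimates to be
    averaged are uniform only for bounded directions. *)
Lemma sign_avg_le js (H H' : (J -> R) -> R) (b : R) s :
  (forall j, `|s j| <= b) ->
  (forall s', (forall j, `|s' j| <= b + (size js)%:R) -> H s' <= H' s') ->
  sign_avg js H s <= sign_avg js H' s.
Proof.
elim: js b s => [|j js IH] b s sb HH /=.
  by apply: HH => j; rewrite addr0.
have step t : `|t| <= 1 -> sign_avg js H (bump_at s j t) <= sign_avg js H' (bump_at s j t).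
  move=> t1; apply: (IH (b + 1)).
    move=> i; rewrite /bump_at (le_trans (ler_normD _ _))// lerD//.
    by rewrite normrM normr_nat; case: (i == j); rewrite ?mulr1// mulr0.
  by move=> s' s'b; apply: HH => i; rewrite -natr1 (addrC _ 1) addrA.
have h1 := step 1; have h2 := step (- 1).
rewrite normr1 in h1; rewrite normrN normr1 in h2.
by rewrite ler_pM2r// lerD// ?h1 ?h2.
Qed.

Lemma sign_avg_lin js (H H' : (J -> R) -> R) (a : R) s :
  sign_avg js (fun s => a * H s + H' s) s = a * sign_avg js H s + sign_avg js H' s.
Proof. by elim: js s => [|j js IH] s //=; rewrite !IH; field. Qed.

Lemma sign_avg_cst js (c : R) s : sign_avg js (fun=> c) s = c.
Proof. by elim: js s => [|j js IH] s //=; rewrite !IH; field. Qed.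

Lemma sign_avg_sum js (I : finType) (H : I -> (J -> R) -> R) s :
  sign_avg js (fun s => \sum_i H i s) s = \sum_i sign_avg js (H i) s.
Proof.
elim: js s => [|j js IH] s //=; rewrite !IH -big_split/= mulr_suml.
by apply: eq_bigr.
Qed.

(** Linearity is tested along coordinate bumps only, with coefficients [c]; sign averages move
    points in no other way. *)
Definition linform (l : (J -> R) -> R) (c : J -> R) : Prop :=
  forall s j t, l (bump_at s j t) = l s + t * c j.

Lemma sign_avg_linform js l c s : linform l c -> sign_avg js l s = l s.
Proof. by move=> lc; elim: js s => [|j js IH] s //=; rewrite !IH !lc; field. Qed.

(** Cross terms of independent signs cancel and the variances add. *)
Lemma sign_avg_sqr js l c s : linform l c ->
  sign_avg js (fun s => l s ^+ 2) s = l s ^+ 2 + \sum_(j <- js) c j ^+ 2.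
Proof.
move=> lc; elim: js s => [|j js IH] s /=; first by rewrite big_nil addr0.
by rewrite !IH !lc big_cons; field.
Qed.

Lemma linform_sum (I : finType) (a : I -> R) (l : I -> (J -> R) -> R) (c : I -> J -> R) :
  (forall i, linform (l i) (c i)) ->
  linform (fun s => \sum_i a i * l i s) (fun j => \sum_i a i * c i j).
Proof.
move=> lc s j t; rewrite mulr_sumr -big_split/=; apply: eq_bigr => i _.
by rewrite lc; ring.
Qed.

End SignAverage.

(** * Second-order comparison of the two processes *)

Section GordonStep.
Variables (R : realType) (m N n : nat).
Variable x : 'I_n.+1 -> 'I_N -> R.
Hypothesis x1 : forall k, \sum_j x k j ^+ 2 = 1.
Variables beta eta rho : R.
Hypotheses (beta0 : 0 < beta) (eta0 : 0 < eta) (rho01 : 0 < rho < 1).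

(* [inl (inl (i,j))]: the matrix G; [inl (inr tt)]: the scalar gamma;
   [inr (inl i)]: the vector g; [inr (inr j)]: the vector h. *)
Definition gidx : finType := ((('I_m * 'I_N) + unit) + ('I_m + 'I_N))%type.
Notation V := (gidx -> R).

Definition gu (z : V) (k : 'I_n.+1) (i : 'I_m) : R :=
  \sum_j z (inl (inl (i, j))) * x k j + z (inr (inl i)).
Definition gv (z : V) (k : 'I_n.+1) : R :=
  z (inl (inr tt)) + \sum_j z (inr (inr j)) * x k j.
Definition gsig (z : V) (k : 'I_n.+1) : R :=
  Num.sqrt (eta ^+ 2 + \sum_i gu z k i ^+ 2).
Definition gexp (z : V) (k : 'I_n.+1) : R := expR (beta * (gv z k - gsig z k)).
(* With [rho = lam / beta], this tends to [expR (lam * max_k (gv z k - |gu z k|))]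
   as [beta] grows and [eta] tends to 0. *)
Definition gPhi (z : V) : R := expR (rho * ln (\sum_k gexp z k)).

Definition gline (z s : V) (t : R) : V := fun j => z j + t * s j.
Local Notation line := gline.

Let gu_line z s k i t : gu (line z s t) k i = gu z k i + t * gu s k i.
Proof.
rewrite /gu mulrDr addrACA; congr (_ + _).
rewrite mulr_sumr -big_split/=; apply: eq_bigr => j _; rewrite /line; ring.
Qed.

Let gv_line z s k t : gv (line z s t) k = gv z k + t * gv s k.
Proof.
rewrite /gv mulrDr addrACA; congr (_ + _).
rewrite mulr_sumr -big_split/=; apply: eq_bigr => j _; rewrite /line; ring.
Qed.

Let x_le1 k j : `|x k j| <= 1.
Proof.
rewrite -(@ler_pXn2r _ 2)// ?nnegrE// real_normK ?num_real// expr1n -(x1 k).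
by rewrite (bigD1 j)//= lerDl sumr_ge0// => i _; exact: sqr_ge0.
Qed.

Let kap (D : R) : R := D * (N%:R + 1) * (m%:R + 1).

Let gu_bound D s k i : (forall j, `|s j| <= D) -> `|gu s k i| <= D * (N%:R + 1).
Proof.
move=> sD; rewrite /gu (le_trans (ler_normD _ _))// mulrDr mulr1 lerD//.
rewrite (le_trans (ler_norm_sum _ _ _))//.
apply: (@le_trans _ _ (\sum_(j < N) D)); last by rewrite sumr_const card_ord mulr_natr.
by apply: ler_sum => j _; rewrite normrM -[leRHS]mulr1 ler_pM.
Qed.

Let gv_bound D s k : (forall j, `|s j| <= D) -> `|gv s k| <= kap D.
Proof.
move=> sD.
have D0 : 0 <= D by apply: le_trans (sD (inl (inr tt))).
have : `|gv s k| <= D * (N%:R + 1).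
  rewrite /gv (le_trans (ler_normD _ _))// mulrDr mulr1 addrC lerD//.
  rewrite (le_trans (ler_norm_sum _ _ _))//.
  apply: (@le_trans _ _ (\sum_(j < N) D)); last by rewrite sumr_const card_ord mulr_natr.
  by apply: ler_sum => j _; rewrite normrM -[leRHS]mulr1 ler_pM.
move/le_trans; apply; rewrite /kap ler_peMr ?lerDr//.
by rewrite mulr_ge0// addr_ge0.
Qed.

(** The gradient of the smoothed norm [gsig] in the variable [gu]. Then [gL] is the derivative of
    the exponent of [gexp] in the direction [s], and [gw] are the Gibbs weights of the soft
    maximum. *)
Definition gdir (z : V) k i : R := gu z k i / gsig z k.
Definition gL (z s : V) k : R := beta * (gv s k - \sum_i gdir z k i * gu s k i).
Definition gw (z : V) k : R := gexp z k / (\sum_k gexp z k).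

(** The second derivative of [gPhi] at [z] along [s], divided by [gPhi z]. *)
Definition gquad (z s : V) : R :=
  rho * (\sum_k gw z k * (gL z s k ^+ 2
    - beta / gsig z k * (\sum_i gu s k i ^+ 2 - (\sum_i gdir z k i * gu s k i) ^+ 2)))
  + rho * (rho - 1) * (\sum_k gw z k * gL z s k) ^+ 2.

Let gexp0 z k : 0 < gexp z k. Proof. exact: expR_gt0. Qed.

Let sum_gexp0 z : 0 < \sum_k gexp z k.
Proof.
rewrite big_ord_recl ltr_pwDl// sumr_ge0// => k _; exact/ltW.
Qed.

(** What matters is that [K] is chosen before [z]: the one-step estimates must hold at every point
    reached while the coordinates are replaced. *)
Lemma gPhi_tame (D : R) : 0 <= D -> exists K : R, forall z s : V, (forall j, `|s j| <= D) ->
  exists f1 f2, tame K (fun t => gPhi (line z s t)) f1 f2 /\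
    [/\ f1 0 = gPhi z * (rho * \sum_k gw z k * gL z s k) & f2 0 = gPhi z * gquad z s].
Proof.
move=> D0.
pose B := 10 * (1 + 2 * (beta * kap D) + beta * kap D ^+ 2 / eta + 3 * (beta * kap D ^+ 3 / eta ^+ 2)) ^+ 3.
have kap0 : 0 <= kap D by rewrite /kap !mulr_ge0// addr_ge0.
have B1 : 1 <= B.
  rewrite /B; set Y := 1 + _ + _ + _.
  have Y1 : 1 <= Y.
    rewrite /Y -!addrA lerDl !addr_ge0 ?mulr_ge0 ?invr_ge0 ?exprn_ge0 ?(ltW beta0) ?(ltW eta0)//.
  have : 1 <= Y ^+ 3 by rewrite exprn_ege1.
  lra.
exists (10 * B ^+ 3) => z s sD.
pose a k := eta ^+ 2 + \sum_i gu z k i ^+ 2.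
pose b k := \sum_i gu z k i * gu s k i.
pose c k := \sum_i gu s k i ^+ 2.
have sumQ k t : eta ^+ 2 + \sum_i gu (line z s t) k i ^+ 2 = a k + 2 * b k * t + c k * t ^+ 2.
  rewrite /a /b /c -!addrA; congr (_ + _); rewrite mulr_suml -mulrA mulr_suml mulr_sumr -!big_split/=.
  by apply: eq_bigr => i _; rewrite gu_line; ring.
have c0 k : 0 <= c k by apply: sumr_ge0 => i _; exact: sqr_ge0.
have ck k : c k <= kap D ^+ 2.
  apply: (@le_trans _ _ (\sum_(i < m) (D * (N%:R + 1)) ^+ 2)).
    apply: ler_sum => i _; rewrite -real_normK ?num_real// ler_pXn2r ?nnegrE//.
      exact: gu_bound.
    by rewrite mulr_ge0// addr_ge0.
  have mm : (m%:R : R) <= (m%:R + 1) ^+ 2 by have : (0 : R) <= m%:R by []; nra.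
  rewrite sumr_const card_ord -[leLHS]mulr_natr /kap exprMn.
  have -> : (D * (N%:R + 1) * (m%:R + 1)) ^+ 2 = D ^+ 2 * (N%:R + 1) ^+ 2 * (m%:R + 1) ^+ 2 by ring.
  exact: (ler_wpM2l (mulr_ge0 (sqr_ge0 _) (sqr_ge0 _)) mm).
have bac k : b k ^+ 2 <= a k * c k.
  apply: (le_trans (cauchy_schwarz_sum _ _)); apply: ler_wpM2r; first exact: c0.
  by rewrite /a; have := sqr_ge0 eta; lra.
have Q k t : eta ^+ 2 <= a k + 2 * b k * t + c k * t ^+ 2.
  by rewrite -sumQ lerDl sumr_ge0// => i _; exact: sqr_ge0.
pose sg k t := Num.sqrt (a k + 2 * b k * t + c k * t ^+ 2).
pose e k t := expR (beta * (gv z k + gv s k * t - sg k t)).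
have eE k t : gexp (line z s t) k = e k t.
  by rewrite /gexp /e /sg -sumQ /gsig gv_line [t * _]mulrC.
have [e3 He] : exists e3 : 'I_n.+1 -> R -> R, forall k,
   [/\ (forall x : R, is_derive x (1 : R) (e k) (e k x * (beta * (gv s k - (b k + c k * x) / sg k x)))),
      (forall x : R, is_derive x (1 : R) (fun t => e k t * (beta * (gv s k - (b k + c k * t) / sg k t)))
         (e k x * ((beta * (gv s k - (b k + c k * x) / sg k x)) ^+ 2 - beta * ((c k - ((b k + c k * x) / sg k x) ^+ 2) / sg k x)))),
      (forall x : R, is_derive x (1 : R) (fun t => e k t * ((beta * (gv s k - (b k + c k * t) / sg k t)) ^+ 2 - beta * ((c k - ((b k + c k * t) / sg k t) ^+ 2) / sg k t))) (e3 k x)) &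
      forall x, [/\ `|e k x * (beta * (gv s k - (b k + c k * x) / sg k x))| <= B * e k x, `|e k x * ((beta * (gv s k - (b k + c k * x) / sg k x)) ^+ 2 - beta * ((c k - ((b k + c k * x) / sg k x) ^+ 2) / sg k x))| <= B * e k x & `|e3 k x| <= B * e k x]].
  have H k := @tame_exp_sqrt R (a k) (b k) (c k) (gv z k) (gv s k) beta eta (kap D) eta0 kap0 (introT andP (conj (c0 k) (ck k))) beta0 (bac k) (Q k) (gv_bound k sD).
  have [e3 He3] := choice H.
  by exists e3 => k; exact: (He3 k).
pose e1 k t := e k t * (beta * (gv s k - (b k + c k * t) / sg k t)).
pose e2 k t := e k t * ((beta * (gv s k - (b k + c k * t) / sg k t)) ^+ 2 - beta * ((c k - ((b k + c k * t) / sg k t) ^+ 2) / sg k t)).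
have dsum (F F' : 'I_n.+1 -> R -> R) (t : R) : (forall k, is_derive t (1 : R) (F k) (F' k t)) ->
   is_derive t (1 : R) (fun t => \sum_k F k t) (\sum_k F' k t).
  move=> dF; have := @is_derive_sum R R R n.+1 F t 1 (F' ^~ t) dF.
  by congr is_derive; apply/funext => y; rewrite fct_sumE.
have T := @tame_powsum R (fun t => \sum_k e k t) (fun t => \sum_k e1 k t) (fun t => \sum_k e2 k t) (fun t => \sum_k e3 k t) B rho.
have bsum (F : 'I_n.+1 -> R) t : (forall k, `|F k| <= B * e k t) -> `|\sum_k F k| <= B * \sum_k e k t.
  move=> h; rewrite (le_trans (ler_norm_sum _ _ _))// mulr_sumr; exact: ler_sum.
have {}T := T (fun t => dsum _ _ t (fun k => let: And4 h _ _ _ := He k in h t))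
  (fun t => dsum _ _ t (fun k => let: And4 _ h _ _ := He k in h t))
  (fun t => dsum _ _ t (fun k => let: And4 _ _ h _ := He k in h t)).
do 2 eexists; split.
  have -> : (fun t => gPhi (line z s t)) = (fun t => expR (rho * ln (\sum_k e k t))).
    by apply/funext => t; rewrite /gPhi; congr (expR (_ * ln _)); apply: eq_bigr => k _; exact: eE.
  apply: T => //.
  - by move=> t; rewrite big_ord_recl ltr_pwDl ?expR_gt0// sumr_ge0// => k _; exact: expR_ge0.
  - by case/andP: rho01 => /ltW-> /ltW->.
  - by move=> t; split; apply: bsum => k; have [_ _ _ /(_ t)[]] := He k.
have lz : line z s 0 = z by apply/funext => j; rewrite /line mul0r addr0.
have e0 k : e k 0 = gexp z k by rewrite -eE lz.
have S0 : \sum_k e k 0 = \sum_k gexp z k by apply: eq_bigr => k _.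
have sg0 k : sg k 0 = gsig z k by rewrite /sg -sumQ lz.
have b0 k : (b k + c k * 0) / sg k 0 = \sum_i gdir z k i * gu s k i.
  rewrite mulr0 addr0 sg0 /b mulr_suml; apply: eq_bigr => i _; rewrite /gdir; ring.
have P0 : expR (rho * ln (\sum_k e k 0)) = gPhi z by rewrite S0.
split.
  rewrite P0; congr (_ * (_ * _)); rewrite S0 mulr_suml; apply: eq_bigr => k _.
  by rewrite /e1 b0 e0 /gw /gL; ring.
rewrite P0; congr (_ * (_ * _ + _ * _ ^+ 2)); rewrite S0 mulr_suml; apply: eq_bigr => k _.
  by rewrite /e2 b0 e0 sg0 /gw /gL /c; ring.
by rewrite /e1 b0 e0 /gw /gL; ring.
Qed.

(** Both processes live on one array: randomising only [gX] gives the process of the matrix and the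
    scalar, only [gY] that of the two vectors. Comparing processes becomes comparing lists of
    coordinates for one function [gPhi]. *)
Definition gX : seq gidx := [seq inl j | j <- enum {: ('I_m * 'I_N) + unit}].
Definition gY : seq gidx := [seq inr j | j <- enum {: 'I_m + 'I_N}].

Let unit_at (j : gidx) : V := bump_at (fun=> 0) j 1.

Let gu_linform k i : linform (fun s => gu s k i) (fun j => gu (unit_at j) k i).
Proof.
move=> s j t; have := gu_line s (unit_at j) k i t.
by move=> <-; congr (gu _ _ _); apply/funext => i'; rewrite /line /unit_at /bump_at add0r mul1r.
Qed.

Let gv_linform k : linform (fun s => gv s k) (fun j => gv (unit_at j) k).
Proof.
move=> s j t; have := gv_line s (unit_at j) k t.
by move=> <-; congr (gv _ _); apply/funext => i'; rewrite /line /unit_at /bump_at add0r mul1r.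
Qed.

Let gL_linform z k : linform (fun s => gL z s k) (fun j => gL z (unit_at j) k).
Proof.
move=> s j t; rewrite /gL gv_linform.
have := linform_sum (gdir z k) (gu_linform k) s j t => /= ->; ring.
Qed.

Let gu_unit k i :
  [/\ forall i0 j0, gu (unit_at (inl (inl (i0, j0)))) k i = (i == i0)%:R * x k j0,
      gu (unit_at (inl (inr tt))) k i = 0,
      forall i0, gu (unit_at (inr (inl i0))) k i = (i == i0)%:R &
      forall j0, gu (unit_at (inr (inr j0))) k i = 0].
Proof.
rewrite /gu /unit_at /bump_at; split=> [i0 j0||i0|j0] /=.
- rewrite mulr0n mulr0 !addr0 (bigD1 j0)//= big1 ?addr0.
    rewrite add0r mul1r; congr (_%:R * _).
    have -> : (inl (inl (i, j0)) == inl (inl (i0, j0)) :> gidx) = ((i, j0) == (i0, j0)) by [].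
    by rewrite xpair_eqE eqxx andbT.
  move=> j jj0; rewrite add0r mul1r.
  have -> : (inl (inl (i, j)) == inl (inl (i0, j0)) :> gidx) = ((i, j) == (i0, j0)) by [].
  by rewrite xpair_eqE (negbTE jj0) andbF mulr0n mul0r.
- by rewrite big1 => [|j _]; rewrite ?add0r ?mul1r ?mulr0n// mul0r.
- by rewrite big1 => [|j _]; rewrite ?add0r ?mul1r ?mulr0n// mul0r.
- by rewrite big1 => [|j _]; rewrite ?add0r ?mul1r ?mulr0n// mul0r.
Qed.

Let gv_unit k :
  [/\ forall i0 j0, gv (unit_at (inl (inl (i0, j0)))) k = 0,
      gv (unit_at (inl (inr tt))) k = 1,
      forall i0, gv (unit_at (inr (inl i0))) k = 0 &
      forall j0, gv (unit_at (inr (inr j0))) k = x k j0].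
Proof.
rewrite /gv /unit_at /bump_at; split=> [i0 j0||i0|j0] /=.
- by rewrite big1 => [|j _]; rewrite ?add0r ?mul1r ?mulr0n ?addr0// mul0r.
- by rewrite big1 => [|j _]; rewrite ?add0r ?mul1r ?mulr0n ?addr0// mul0r.
- by rewrite big1 => [|j _]; rewrite ?add0r ?mul1r ?mulr0n ?addr0// mul0r.
- rewrite mulr0n mulr0 !addr0 add0r (bigD1 j0)//= big1 ?addr0.
    by rewrite add0r mul1r eqxx mul1r.
  move=> j jj0; rewrite add0r mul1r.
  have -> : (inr (inr j) == inr (inr j0) :> gidx) = (j == j0) by [].
  by rewrite (negbTE jj0) mul0r.
Qed.

Let sumX (F : gidx -> R) : \sum_(j <- gX) F j =
  \sum_i0 \sum_j0 F (inl (inl (i0, j0))) + F (inl (inr tt)).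
Proof.
rewrite /gX big_map big_enum /= big_sumType /= pair_bigA /=.
congr (_ + _); first by apply: eq_bigr => -[].
by rewrite (big_pred1 tt)// => -[].
Qed.

Let sumY (F : gidx -> R) : \sum_(j <- gY) F j =
  \sum_i0 F (inr (inl i0)) + \sum_j0 F (inr (inr j0)).
Proof. by rewrite /gY big_map big_enum /= big_sumType. Qed.

Let sum_delta (F : 'I_m -> R) i0 : \sum_i F i * (i == i0)%:R = F i0.
Proof.
rewrite (bigD1 i0)//= eqxx mulr1 big1 ?addr0// => i ii0.
by rewrite (negbTE ii0) mulr0.
Qed.

Let gL_unit z k :
  [/\ forall i0 j0, gL z (unit_at (inl (inl (i0, j0)))) k = - beta * (gdir z k i0 * x k j0),
      gL z (unit_at (inl (inr tt))) k = beta,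
      forall i0, gL z (unit_at (inr (inl i0))) k = - beta * gdir z k i0 &
      forall j0, gL z (unit_at (inr (inr j0))) k = beta * x k j0].
Proof.
have [v1 v2 v3 v4] := gv_unit k.
split=> [i0 j0||i0|j0]; rewrite /gL ?v1 ?v2 ?v3 ?v4.
- have e i : gu (unit_at (inl (inl (i0, j0)))) k i = (i == i0)%:R * x k j0.
    by have [] := gu_unit k i.
  under eq_bigr do rewrite e mulrA; rewrite -mulr_suml sum_delta; ring.
- by rewrite big1 ?subr0 ?mulr1// => i _; have [_ -> _ _] := gu_unit k i; rewrite mulr0.
- have e i : gu (unit_at (inr (inl i0))) k i = (i == i0)%:R by have [] := gu_unit k i.
  under eq_bigr do rewrite e; rewrite sum_delta; ring.
- by rewrite big1 ?subr0// => i _; have [_ _ _ ->] := gu_unit k i; rewrite mulr0.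
Qed.

Let gu0 k i : gu (fun=> 0) k i = 0.
Proof. by rewrite /gu big1 ?addr0// => j _; rewrite mul0r. Qed.

Let gL0 z k : gL z (fun=> 0) k = 0.
Proof.
rewrite /gL /gv !big1 ?addr0 ?subr0 ?mulr0// => j _; first by rewrite gu0 mulr0.
by rewrite mul0r.
Qed.

Let avg_gquad js z : sign_avg js (gquad z) (fun=> 0) =
  rho * (\sum_k gw z k * (\sum_(j <- js) gL z (unit_at j) k ^+ 2
    - beta / gsig z k * (\sum_i \sum_(j <- js) gu (unit_at j) k i ^+ 2
       - \sum_(j <- js) (\sum_i gdir z k i * gu (unit_at j) k i) ^+ 2)))
  + rho * (rho - 1) * \sum_(j <- js) (\sum_k gw z k * gL z (unit_at j) k) ^+ 2.
Proof.
have avgD (F G : V -> R) s : sign_avg js (fun s => F s + G s) s = sign_avg js F s + sign_avg js G s.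
  have := sign_avg_lin js F G 1 s; rewrite mul1r => <-.
  by congr (sign_avg js _ s); apply/funext => y; rewrite mul1r.
have avgZ (a : R) (F : V -> R) s : sign_avg js (fun s => a * F s) s = a * sign_avg js F s.
  have := sign_avg_lin js F (fun=> 0) a s; rewrite sign_avg_cst addr0 => <-.
  by congr (sign_avg js _ s); apply/funext => y; rewrite addr0.
have avgB (F G : V -> R) s : sign_avg js (fun s => F s - G s) s = sign_avg js F s - sign_avg js G s.
  rewrite avgD; congr (_ + _).
  have := avgZ (-1) G s; rewrite mulN1r => <-.
  by congr (sign_avg js _ s); apply/funext => y; rewrite mulN1r.
rewrite /gquad avgD !avgZ sign_avg_sum; congr (_ * _ + _ * _).
  apply: eq_bigr => k _; rewrite avgZ avgB avgZ avgB sign_avg_sum.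
  rewrite (sign_avg_sqr _ _ (gL_linform z k)) gL0 expr0n/= add0r.
  congr (_ * (_ - _ * (_ - _))).
    by apply: eq_bigr => i _; rewrite (sign_avg_sqr _ _ (gu_linform k i)) gu0 expr0n/= add0r.
  rewrite (sign_avg_sqr _ _ (linform_sum (gdir z k) (gu_linform k))).
  by rewrite big1 ?expr0n/= ?add0r// => i _; rewrite gu0 mulr0.
rewrite (sign_avg_sqr _ _ (linform_sum (gw z) (gL_linform z))).
by rewrite big1 ?expr0n/= ?add0r// => k _; rewrite gL0 mulr0.
Qed.

Let gdir_le1 z k : \sum_i gdir z k i ^+ 2 <= 1.
Proof.
have s0 : 0 < eta ^+ 2 + \sum_i gu z k i ^+ 2.
  by rewrite ltr_pwDl ?exprn_gt0// sumr_ge0// => i _; exact: sqr_ge0.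
have -> : \sum_i gdir z k i ^+ 2 = (\sum_i gu z k i ^+ 2) / (eta ^+ 2 + \sum_i gu z k i ^+ 2).
  rewrite mulr_suml; apply: eq_bigr => i _.
  by rewrite /gdir expr_div_n /gsig sqr_sqrtr// ltW.
by rewrite ler_pdivrMr// mul1r lerDr sqr_ge0.
Qed.

Let dot_le1 (I : finType) (f g : I -> R) :
  \sum_i f i ^+ 2 <= 1 -> \sum_i g i ^+ 2 <= 1 -> \sum_i f i * g i <= 1.
Proof.
move=> f1 g1; apply: (le_trans (ler_norm _)).
rewrite -(@ler_pXn2r _ 2)// ?nnegrE// real_normK ?num_real// expr1n.
apply: (le_trans (cauchy_schwarz_sum _ _)).
by rewrite -[leRHS]mulr1 ler_pM// sumr_ge0// => i _; exact: sqr_ge0.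
Qed.

Let sum_sq (I : finType) (w : 'I_n.+1 -> R) (F : I -> 'I_n.+1 -> R) :
  \sum_i (\sum_k w k * F i k) ^+ 2 =
  \sum_k \sum_l w k * w l * (\sum_i F i k * F i l).
Proof.
transitivity (\sum_i \sum_k \sum_l w k * w l * (F i k * F i l)).
  apply: eq_bigr => i _; rewrite expr2 mulr_suml; apply: eq_bigr => k _.
  by rewrite mulr_sumr; apply: eq_bigr => l _; ring.
rewrite exchange_big/=; apply: eq_bigr => k _.
rewrite exchange_big/=; apply: eq_bigr => l _.
by rewrite mulr_sumr.
Qed.

(* The right side minus the left one is [beta ^+ 2 * rho * (1 - rho)] times the sum over [k, k']
   of [gw z k * gw z k' * (1 - <x k, x k'>) * (1 - <gdir z k, gdir z k'>)]. *)
Lemma gquad_XY z : sign_avg gX (gquad z) (fun=> 0) <= sign_avg gY (gquad z) (fun=> 0).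
Proof.
pose A k := \sum_i gdir z k i ^+ 2.
pose w k := gw z k.
rewrite !avg_gquad.
(* The scalar coordinate and the unit norm of [x k] give both processes equal variances: the three
   sums attached to a single [k] agree for [gX] and [gY], so only the squared averages over [k] can
   differ. *)
have LX k : \sum_(j <- gX) gL z (unit_at j) k ^+ 2 = beta ^+ 2 * (1 + A k).
  have [l1 l2 l3 l4] := gL_unit z k; rewrite sumX l2.
  under eq_bigr do under eq_bigr do rewrite l1.
  rewrite [X in X + _](_ : _ = beta ^+ 2 * A k); first by ring.
  rewrite /A mulr_sumr; apply: eq_bigr => i _.
  transitivity (beta ^+ 2 * gdir z k i ^+ 2 * \sum_j x k j ^+ 2); last by rewrite x1 mulr1.
  by rewrite mulr_sumr; apply: eq_bigr => j _; ring.
have LY k : \sum_(j <- gY) gL z (unit_at j) k ^+ 2 = beta ^+ 2 * (1 + A k).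
  have [l1 l2 l3 l4] := gL_unit z k; rewrite sumY.
  under eq_bigr do rewrite l3; under [X in _ + X]eq_bigr do rewrite l4.
  rewrite /A mulrDr mulr1 addrC; congr (_ + _).
    by rewrite -[RHS]mulr1 -(x1 k) mulr_sumr; apply: eq_bigr => j _; ring.
  by rewrite mulr_sumr; apply: eq_bigr => j _; ring.
have UX k i : \sum_(j <- gX) gu (unit_at j) k i ^+ 2 = 1.
  have [l1 l2 l3 l4] := gu_unit k i; rewrite sumX l2 expr0n/= addr0.
  under eq_bigr do under eq_bigr do rewrite l1.
  rewrite (bigD1 i)//= [X in _ + X]big1 ?addr0; last first.
    by move=> i0 ii0; rewrite big1// => j _; rewrite eq_sym (negbTE ii0) mul0r expr0n.
  by rewrite -[RHS](x1 k); apply: eq_bigr => j _; rewrite eqxx mul1r.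
have UY k i : \sum_(j <- gY) gu (unit_at j) k i ^+ 2 = 1.
  have [l1 l2 l3 l4] := gu_unit k i; rewrite sumY.
  rewrite [X in _ + X]big1 ?addr0; last by move=> j _; rewrite l4 expr0n.
  rewrite (bigD1 i)//= big1 ?addr0; last first.
    by move=> i0 ii0; rewrite l3 eq_sym (negbTE ii0) expr0n.
  by rewrite l3 eqxx expr1n.
have DX k : \sum_(j <- gX) (\sum_i gdir z k i * gu (unit_at j) k i) ^+ 2 = A k.
  have e j : \sum_i gdir z k i * gu (unit_at j) k i = gv (unit_at j) k - gL z (unit_at j) k / beta.
    by rewrite /gL; field; rewrite gt_eqF.
  have [l1 l2 l3 l4] := gL_unit z k; have [v1 v2 v3 v4] := gv_unit k.
  rewrite sumX e l2 v2 divff ?gt_eqF// subrr expr0n/= addr0 /A.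
  apply: eq_bigr => i _; rewrite -[RHS]mulr1 -(x1 k) mulr_sumr; apply: eq_bigr => j _.
  by rewrite e l1 v1; field; rewrite gt_eqF.
have DY k : \sum_(j <- gY) (\sum_i gdir z k i * gu (unit_at j) k i) ^+ 2 = A k.
  have e j : \sum_i gdir z k i * gu (unit_at j) k i = gv (unit_at j) k - gL z (unit_at j) k / beta.
    by rewrite /gL; field; rewrite gt_eqF.
  have [l1 l2 l3 l4] := gL_unit z k; have [v1 v2 v3 v4] := gv_unit k.
  rewrite sumY [X in _ + X]big1 ?addr0; last first.
    by move=> j _; rewrite e l4 v4 [beta * _]mulrC mulfK ?gt_eqF// subrr expr0n.
  by rewrite /A; apply: eq_bigr => i _; rewrite e l3 v3; field; rewrite gt_eqF.
under eq_bigr => k _ do [rewrite LX DX; under eq_bigr do rewrite UX].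
under [in X in _ <= X]eq_bigr => k _ do [rewrite LY DY; under eq_bigr do rewrite UY].
rewrite lerD2l.
have [r0 r1] : 0 < rho /\ rho < 1 by apply/andP.
(* The coefficient [rho * (rho - 1)] is negative, so the inequality between the squared averages is
   reversed. *)
rewrite ler_nM2l; last by rewrite nmulr_llt0// subr_lt0.
have TX : \sum_(j <- gX) (\sum_k gw z k * gL z (unit_at j) k) ^+ 2 =
  beta ^+ 2 * \sum_k \sum_l w k * w l * (1 + (\sum_i gdir z k i * gdir z l i) * (\sum_j x k j * x l j)).
  rewrite sumX pair_bigA/=.
  transitivity (beta ^+ 2 * (\sum_(p : 'I_m * 'I_N) (\sum_k w k * (gdir z k p.1 * x k p.2)) ^+ 2)
     + beta ^+ 2 * \sum_k \sum_l w k * w l * 1).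
    congr (_ + _).
      rewrite mulr_sumr; apply: eq_bigr => p _; rewrite -exprMn -[RHS]sqrrN; congr (_ ^+ 2).
      rewrite mulr_sumr -sumrN; apply: eq_bigr => k _.
      by have [-> _ _ _] := gL_unit z k; rewrite /w; ring.
    transitivity ((beta * \sum_k w k) ^+ 2).
      congr (_ ^+ 2); rewrite mulr_sumr; apply: eq_bigr => k _.
      by have [_ -> _ _] := gL_unit z k; rewrite /w mulrC.
    rewrite exprMn; congr (_ * _); rewrite expr2 mulr_suml; apply: eq_bigr => k _.
    by rewrite mulr_sumr; apply: eq_bigr => l _; rewrite mulr1.
  rewrite (sum_sq w (fun (p : 'I_m * 'I_N) k => gdir z k p.1 * x k p.2)) -mulrDr; congr (_ * _).
  rewrite -big_split/=; apply: eq_bigr => k _; rewrite -big_split/=; apply: eq_bigr => l _.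
  rewrite -mulrDr addrC; congr (_ * (_ + _)).
  rewrite -(pair_bigA _ (fun i j => gdir z k i * x k j * (gdir z l i * x l j)))/= mulr_suml.
  by apply: eq_bigr => i _; rewrite mulr_sumr; apply: eq_bigr => j _; ring.
have TY : \sum_(j <- gY) (\sum_k gw z k * gL z (unit_at j) k) ^+ 2 =
  beta ^+ 2 * \sum_k \sum_l w k * w l * ((\sum_i gdir z k i * gdir z l i) + (\sum_j x k j * x l j)).
  rewrite sumY.
  transitivity (beta ^+ 2 * (\sum_i (\sum_k w k * gdir z k i) ^+ 2) + beta ^+ 2 * \sum_j (\sum_k w k * x k j) ^+ 2).
    congr (_ + _); rewrite mulr_sumr; apply: eq_bigr => i _; rewrite -exprMn.
      rewrite -[RHS]sqrrN; congr (_ ^+ 2); rewrite mulr_sumr -sumrN; apply: eq_bigr => k _.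
      by have [_ _ -> _] := gL_unit z k; rewrite /w; ring.
    congr (_ ^+ 2); rewrite mulr_sumr; apply: eq_bigr => k _.
    by have [_ _ _ ->] := gL_unit z k; rewrite /w; ring.
  rewrite (sum_sq w (fun i k => gdir z k i)) (sum_sq w (fun j k => x k j)) -mulrDr; congr (_ * _).
  rewrite -big_split/=; apply: eq_bigr => k _; rewrite -big_split/=; apply: eq_bigr => l _.
  by rewrite -mulrDr.
rewrite TX TY ler_pM2l ?exprn_gt0//.
apply: ler_sum => k _; apply: ler_sum => l _.
have w0 k' : 0 <= w k' by rewrite /w /gw divr_ge0 ?ltW.
rewrite (ler_wpM2l (mulr_ge0 (w0 k) (w0 l)))//.
have d1 : \sum_i gdir z k i * gdir z l i <= 1 by exact: dot_le1.
have d2 : \sum_j x k j * x l j <= 1 by apply: dot_le1; rewrite x1.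
move: (\sum_i _) (\sum_j _) d1 d2 => p q d1 d2.
have : 0 <= (1 - p) * (1 - q) by rewrite mulr_ge0// subr_ge0.
by lra.
Qed.

(** First-order terms average to 0, second-order ones are ordered by [gquad_XY], and the cubic
    remainder is a multiple of [gPhi z], itself at most twice the average over [gY] when [e] is
    small. *)
Lemma sign_avg_gPhi_XY : exists C e0 : R, [/\ 0 < C, 0 < e0 & forall z e, 0 < e <= e0 ->
  sign_avg gX (fun s => gPhi (line z s e)) (fun=> 0) <=
  (1 + C * e ^+ 3) * sign_avg gY (fun s => gPhi (line z s e)) (fun=> 0)].
Proof.
pose D : R := (size gX + size gY)%:R.
have [K HK] := gPhi_tame (ler0n R (size gX + size gY)).
have DX : 0 + (size gX)%:R <= D :> R by rewrite add0r ler_nat leq_addr.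
have DY : 0 + (size gY)%:R <= D :> R by rewrite add0r ler_nat leq_addl.
have K0 : 0 <= K.
  have [|f1 [f2 [tf _]]] := HK (fun=> 0) (fun=> 0); first by move=> j; rewrite normr0.
  exact: tame_ge0 tf.
pose C1 := K * expR K.
have C10 : 0 <= C1 by rewrite mulr_ge0 ?expR_ge0.
(* A bound uniform in [z], used to keep the average over [gY] above [gPhi z / 2]. *)
have [f2b] : exists f2b : R, 0 <= f2b /\ forall z, `|sign_avg gY (gquad z) (fun=> 0)| <= f2b.
  exists K; split => // z.
  have b s : (forall j, `|s j| <= 0 + (size gY)%:R) -> `|gquad z s| <= K.
    move=> sb; have [|f1 [f2 [tf [_ e2]]]] := HK z s.
      by move=> j; rewrite (le_trans (sb j)).
    case: tf => f3 [_ _ _ _ /(_ 0)[_ h _]]; move: h; rewrite e2.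
    have -> : line z s 0 = z by apply/funext => j; rewrite /line mul0r addr0.
    by rewrite normrM (gtr0_norm (expR_gt0 _)) mulrC ler_pM2r ?expR_gt0.
  rewrite ler_norml; apply/andP; split.
    rewrite -(sign_avg_cst gY (- K) (fun=> 0)); apply: (@sign_avg_le _ _ _ _ _ 0).
      by move=> j; rewrite normr0.
    by move=> s sb; have := b s sb; rewrite ler_norml => /andP[].
  rewrite -[leRHS](sign_avg_cst gY K (fun=> 0)); apply: (@sign_avg_le _ _ _ _ _ 0).
    by move=> j; rewrite normr0.
  by move=> s sb; have := b s sb; rewrite ler_norml => /andP[].
move=> [f2b0 Hf2b].
exists (4 * C1 + 1), (f2b + 2 * C1 + 1)^-1; split.
- lra.
- by rewrite invr_gt0; lra.
move=> z e /andP[e0 ee].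
have e1 : e <= 1 by rewrite (le_trans ee)// invf_le1; lra.
have P0 : 0 < gPhi z by exact: expR_gt0.
pose l (s : V) := \sum_k gw z k * gL z s k.
pose lc (j : gidx) := \sum_k gw z k * gL z (unit_at j) k.
have ll : linform l lc := linform_sum (gw z) (gL_linform z).
pose Q (s : V) : R := gPhi z * (1 + (e * rho) * l s + (e ^+ 2 / 2) * gquad z s).
have avgQ js : sign_avg js Q (fun=> 0) = gPhi z * (1 + (e ^+ 2 / 2) * sign_avg js (gquad z) (fun=> 0)).
  pose H1 (s : V) := 1 + e * rho * l s.
  have -> : Q = (fun s => gPhi z * ((e ^+ 2 / 2) * gquad z s + (e * rho * l s + 1)) + 0).
    by apply/funext => s; rewrite /Q; ring.
  rewrite (sign_avg_lin _ _ (fun=> 0)) (sign_avg_lin _ _ (fun s => e * rho * l s + 1)).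
  rewrite (sign_avg_lin _ l (fun=> 1)) !sign_avg_cst (sign_avg_linform _ _ ll).
  rewrite {1}/l big1; last by move=> k _; rewrite gL0 mulr0.
  by ring.
have approx s : (forall j, `|s j| <= D) -> `|gPhi (line z s e) - Q s| <= C1 * e ^+ 3 * gPhi z.
  move=> sb; have [f1 [f2 [tf [E1 E2]]]] := HK z s sb.
  have lz : line z s 0 = z by apply/funext => j; rewrite /line mul0r addr0.
  have := tame_taylor e tf; rewrite E1 E2 lz (gtr0_norm e0).
  have -> : gPhi z + gPhi z * (rho * \sum_k gw z k * gL z s k) * e + gPhi z * gquad z s / 2 * e ^+ 2 = Q s.
    by rewrite /Q /l; field.
  move/le_trans; apply.
  have -> : C1 * e ^+ 3 * gPhi z = K * gPhi z * e ^+ 3 * expR K by rewrite /C1; ring.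
  rewrite ler_wpM2l ?ler_expR ?ler_piMr//.
  by apply: mulr_ge0; [exact: mulr_ge0 K0 (ltW P0)|exact: exprn_ge0 (ltW e0)].
have upX : sign_avg gX (fun s => gPhi (line z s e)) (fun=> 0) <=
    gPhi z * (1 + (e ^+ 2 / 2) * sign_avg gX (gquad z) (fun=> 0)) + C1 * e ^+ 3 * gPhi z.
  rewrite -avgQ.
  have -> : sign_avg gX Q (fun=> 0) + C1 * e ^+ 3 * gPhi z = sign_avg gX (fun s => 1 * Q s + C1 * e ^+ 3 * gPhi z) (fun=> 0).
    by rewrite (sign_avg_lin _ Q (fun=> C1 * e ^+ 3 * gPhi z)) sign_avg_cst mul1r.
  apply: (@sign_avg_le _ _ _ _ _ 0); first by move=> j; rewrite normr0.
  move=> s sb; rewrite mul1r -lerBlDl.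
  by rewrite (le_trans (ler_norm _))// approx// => j; rewrite (le_trans (sb j)).
have lowY : gPhi z * (1 + (e ^+ 2 / 2) * sign_avg gY (gquad z) (fun=> 0)) - C1 * e ^+ 3 * gPhi z <=
    sign_avg gY (fun s => gPhi (line z s e)) (fun=> 0).
  rewrite -avgQ.
  have -> : sign_avg gY Q (fun=> 0) - C1 * e ^+ 3 * gPhi z = sign_avg gY (fun s => 1 * Q s + - (C1 * e ^+ 3 * gPhi z)) (fun=> 0).
    by rewrite (sign_avg_lin _ Q (fun=> - (C1 * e ^+ 3 * gPhi z))) sign_avg_cst mul1r.
  apply: (@sign_avg_le _ _ _ _ _ 0); first by move=> j; rewrite normr0.
  move=> s sb; rewrite mul1r lerBlDl -lerBlDr.
  rewrite (le_trans (ler_norm _))// distrC approx// => j; by rewrite (le_trans (sb j)).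
have := gquad_XY z; have := Hf2b z; rewrite ler_norml => /andP[hb _].
move: (sign_avg gX (gquad z) (fun=> 0)) (sign_avg gY (gquad z) (fun=> 0)) upX lowY hb => qX qY.
move: (sign_avg gX _ _) (sign_avg gY _ _) => aX aY upX lowY hb XY.
set g := gPhi z in P0 upX lowY.
have e20 : 0 < e ^+ 2 by rewrite exprn_gt0.
have e30 : 0 < e ^+ 3 by rewrite exprn_gt0.
have e2e : e ^+ 2 <= e by rewrite expr2 ler_piMl// ltW.
have e3e : e ^+ 3 <= e by rewrite exprS (le_trans _ e2e)// expr2 ler_pM2l.
have eK : e * (f2b + 2 * C1 + 1) <= 1 by rewrite -ler_pdivlMr ?div1r//; lra.
have q1 : g * (1 + e ^+ 2 / 2 * qX) <= g * (1 + e ^+ 2 / 2 * qY).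
  by rewrite ler_pM2l// lerD2l ler_pM2l// divr_gt0.
have q2 : - (f2b * e) <= e ^+ 2 * qY.
  apply: (@le_trans _ _ (e ^+ 2 * - f2b)); last by rewrite ler_pM2l.
  by rewrite mulrN lerN2 mulrC ler_wpM2l.
have q3 : C1 * e ^+ 3 <= C1 * e by rewrite ler_wpM2l.
have half : g / 2 <= aY.
  apply: (le_trans _ lowY).
  have -> : g * (1 + e ^+ 2 / 2 * qY) - C1 * e ^+ 3 * g = g * (1 + e ^+ 2 * qY / 2 - C1 * e ^+ 3) by ring.
  rewrite ler_pM2l//.
  have : e * (f2b + 2 * C1 + 1) = f2b * e + 2 * (C1 * e) + e by ring.
  move: (e ^+ 2 * qY) (C1 * e ^+ 3) (f2b * e) (C1 * e) q2 q3 eK => *; lra.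
have c4 : C1 * e ^+ 3 * (g / 2) <= C1 * e ^+ 3 * aY by rewrite ler_wpM2l// mulr_ge0// ltW.
have -> : (1 + (4 * C1 + 1) * e ^+ 3) * aY = aY + 4 * (C1 * e ^+ 3 * aY) + e ^+ 3 * aY by ring.
have : 0 <= e ^+ 3 * aY by rewrite mulr_ge0 ?(ltW e30)// (le_trans _ half)// divr_ge0// ltW.
have e4 : C1 * e ^+ 3 * (g / 2) = C1 * e ^+ 3 * g / 2 by ring.
rewrite e4 in c4 => {e4}.
move: (C1 * e ^+ 3 * aY) (e ^+ 3 * aY) (C1 * e ^+ 3 * g) c4 upX lowY => *; lra.
Qed.

End GordonStep.

(** * Averaging operators and the passage from signs to Gaussians *)

Section Operators.
Variables (R : realType) (J : finType).
Notation gauss := (@normal_prob R 0 1).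
Notation V := (J -> R).
Implicit Types (F : V -> \bar R) (z : V).
Local Open Scope ereal_scope.

Definition gauss_op (e : R) (j : J) F : V -> \bar R :=
  fun z => \int[gauss]_w F (bump_at z j (e * w)).

Definition rad_op (e : R) (j : J) F : V -> \bar R :=
  fun z => (2^-1)%:E * (F (bump_at z j e) + F (bump_at z j (- e)%R)).

(* Nonnegative and measurable along every measurable family of points:
   this avoids choosing a sigma-algebra on [J -> R]. *)
Definition pmeas F : Prop := (forall z, 0 <= F z) /\
  forall d (T : measurableType d) (c : J -> T -> R),
    (forall j, measurable_fun setT (c j)) ->
    measurable_fun setT (fun x => F (fun j => c j x)).

Lemma pmeas_gauss_op e j F : pmeas F -> pmeas (gauss_op e j F).
Proof.
move=> [F0 mF]; split=> [z|d T c mc]; first by apply: integral_ge0 => w _; exact: F0.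
pose f (p : T * R) : \bar R := F (bump_at (c ^~ p.1) j (e * p.2)).
apply: (@measurable_fun_fubini_tonelli_F _ _ _ _ R gauss f).
  apply: (mF _ _ (fun i p => (c i p.1 + e * p.2 * (i == j)%:R)%R)) => i.
  apply: measurable_funD; first by apply: measurableT_comp => //; exact: mc.
  by apply: measurable_funM => //; exact: measurable_funM.
by move=> p; exact: F0.
Qed.

Lemma pmeas_rad_op e j F : pmeas F -> pmeas (rad_op e j F).
Proof.
move=> [F0 mF]; split=> [z|d T c mc].
  by rewrite mule_ge0 ?adde_ge0// lee_fin.
apply: measurable_funeM; apply: emeasurable_funD.
  by apply: (mF _ _ (fun i p => (c i p + e * (i == j)%:R)%R)) => i; exact: measurable_funD.
by apply: (mF _ _ (fun i p => (c i p + - e * (i == j)%:R)%R)) => i; exact: measurable_funD.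
Qed.

Lemma pmeas_line F z j (e : R) : pmeas F -> measurable_fun setT (fun w : R => F (bump_at z j (e * w))).
Proof.
move=> [_ mF]; apply: (mF _ _ (fun i w => (z i + e * w * (i == j)%:R)%R)) => i.
by apply: measurable_funD => //; apply: measurable_funM => //; exact: measurable_funM.
Qed.

Lemma gauss_op_le e j F F' : pmeas F -> pmeas F' -> (forall z, F z <= F' z) ->
  forall z, gauss_op e j F z <= gauss_op e j F' z.
Proof.
move=> mF mF' FF' z; apply: ge0_le_integral => //.
- by move=> w _; exact: mF.1.
- exact: pmeas_line.
- exact: pmeas_line.
Qed.

Lemma rad_op_le e j F F' : (forall z, F z <= F' z) ->
  forall z, rad_op e j F z <= rad_op e j F' z.
Proof. by move=> FF' z; rewrite lee_wpmul2l ?lee_fin// leeD. Qed.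

Lemma pmeasZ (c : R) F : (0 <= c)%R -> pmeas F -> pmeas (fun z => c%:E * F z).
Proof.
move=> c0 [F0 mF]; split=> [z|d T k mk]; first by rewrite mule_ge0.
by apply: measurable_funeM; exact: mF.
Qed.

Lemma gauss_opZ (c : R) e j F : (0 <= c)%R -> pmeas F ->
  gauss_op e j (fun z => c%:E * F z) = fun z => c%:E * gauss_op e j F z.
Proof.
move=> c0 mF; apply/funext => z; rewrite /gauss_op ge0_integralZl//.
- exact: pmeas_line.
- by move=> w _; exact: mF.1.
Qed.

Lemma rad_opZ (c : R) e j F : (0 <= c)%R -> pmeas F ->
  rad_op e j (fun z => c%:E * F z) = fun z => c%:E * rad_op e j F z.
Proof.
move=> c0 [F0 _]; apply/funext => z; rewrite /rad_op -ge0_muleDr//.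
by rewrite muleCA.
Qed.

Lemma bump_atC z i j (s t : R) : bump_at (bump_at z i s) j t = bump_at (bump_at z j t) i s.
Proof. by apply/funext => k; rewrite /bump_at; ring. Qed.

Lemma bump_atD z j (s t : R) : bump_at (bump_at z j s) j t = bump_at z j (s + t)%R.
Proof. by apply/funext => k; rewrite /bump_at; ring. Qed.

Lemma gauss_rad_opC e e' i j F : pmeas F ->
  gauss_op e j (rad_op e' i F) = rad_op e' i (gauss_op e j F).
Proof.
move=> mF; apply/funext => z; rewrite /gauss_op /rad_op.
have m1 t : measurable_fun setT (fun w : R => F (bump_at (bump_at z j (e * w)) i t)).
  under eq_fun do rewrite bump_atC.
  exact: (pmeas_line (bump_at z i t)).
rewrite ge0_integralZl//; last 2 first.
- by apply: emeasurable_funD; exact: m1.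
- by move=> w _; rewrite adde_ge0// mF.1.
congr (_ * _); rewrite ge0_integralD//; try exact: m1; try by move=> w _; exact: mF.1.
by congr (_ + _); apply: eq_integral => w _; rewrite bump_atC.
Qed.

Lemma rad_opC e e' i j F : pmeas F ->
  rad_op e j (rad_op e' i F) = rad_op e' i (rad_op e j F).
Proof.
move=> [F0 _]; apply/funext => z; rewrite /rad_op -!ge0_muleDr//; last 4 first.
- exact: adde_ge0.
- exact: adde_ge0.
- exact: adde_ge0.
- exact: adde_ge0.
congr (_ * (_ * _)); rewrite addeACA.
by congr (_ + _ + (_ + _)); rewrite bump_atC.
Qed.

Definition gauss_list (js : seq J) F : V -> \bar R := foldr (gauss_op 1) F js.
Definition rad_list (e : R) (js : seq J) F : V -> \bar R := foldr (rad_op e) F js.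

Lemma rad_list_sign_avg e js (P : V -> R) z s :
  rad_list e js (EFin \o P) (fun j => z j + e * s j)%R =
  (sign_avg js (fun s => P (fun j => z j + e * s j)%R) s)%:E.
Proof.
elim: js s => [|j js IH] s //=.
have sh t : bump_at (fun i => z i + e * s i)%R j (e * t)%R = (fun i => z i + e * bump_at s j t i)%R.
  by apply/funext => i; rewrite /bump_at; ring.
transitivity ((2^-1)%:E * (rad_list e js (EFin \o P) (bump_at (fun i => z i + e * s i)%R j (e * 1)%R)
   + rad_list e js (EFin \o P) (bump_at (fun i => z i + e * s i)%R j (e * -1)%R))).
  by rewrite mulr1 mulrN1.
by rewrite !sh !IH -EFinD -EFinM mulrC.
Qed.

Notation operator := ((V -> \bar R) -> (V -> \bar R)).

Definition posop (S : operator) : Prop :=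
  [/\ forall F, pmeas F -> pmeas (S F),
      forall F F', pmeas F -> pmeas F' -> (forall z, F z <= F' z) -> forall z, S F z <= S F' z &
      forall (c : R) F, (0 <= c)%R -> pmeas F -> S (fun z => c%:E * F z) = fun z => c%:E * S F z].

Definition commop (S T : operator) : Prop := forall F, pmeas F -> S (T F) = T (S F).

Lemma posop_gauss e j : posop (gauss_op e j).
Proof.
by split; [exact: pmeas_gauss_op|exact: gauss_op_le|move=> c F c0 mF; exact: gauss_opZ].
Qed.

Lemma posop_rad e j : posop (rad_op e j).
Proof.
split; [exact: pmeas_rad_op|move=> F F' _ _; exact: rad_op_le|].
by move=> c F c0 mF; exact: rad_opZ.
Qed.

Lemma posop_iter n S : posop S -> posop (iter n S).
Proof.
move=> [S1 S2 S3]; elim: n => [|n [I1 I2 I3]] /=; first by split.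
split=> [F mF|F F' mF mF' FF'|c F c0 mF]; first exact/S1/I1.
- by apply: S2; [exact: I1|exact: I1|exact: I2].
- by rewrite !iterS I3// S3//; exact: I1.
Qed.

Lemma posop_foldr (S : J -> operator) js : (forall j, posop (S j)) ->
  posop (fun F => foldr S F js).
Proof.
move=> pS; elim: js => [|j js [I1 I2 I3]] /=; first by split.
have [S1 S2 S3] := pS j.
split=> [F mF|F F' mF mF' FF'|c F c0 mF]; first exact/S1/I1.
- by apply: S2; [exact: I1|exact: I1|exact: I2].
- by rewrite I3// S3//; exact: I1.
Qed.

Lemma commop_sym S T : commop S T -> commop T S.
Proof. by move=> ST F mF; rewrite ST. Qed.

Lemma commop_iter n S T : posop T -> commop S T -> commop S (iter n T).
Proof.
move=> pT ST F mF; elim: n => //= n IH; rewrite ST ?IH//.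
by have [h _ _] := posop_iter n pT; exact: h.
Qed.

Lemma commop_foldr (T : J -> operator) S js : (forall j, posop (T j)) ->
  (forall j, commop S (T j)) -> commop S (fun F => foldr T F js).
Proof.
move=> pT ST F mF; elim: js => //= j js IH; rewrite ST ?IH//.
by have [h _ _] := posop_foldr js pT; exact: h.
Qed.

(** The hypothesis compares [S] and [T] at this single [F]. Commutation brings [S] back next to [F]:
    [S (iter n T F) = iter n T (S F)]. *)
Lemma posop_iter_le n S T F (c : R) : posop S -> posop T -> commop S T -> pmeas F ->
  (0 <= c)%R -> (forall z, S F z <= c%:E * T F z) ->
  forall z, iter n S F z <= (c ^+ n)%:E * iter n T F z.
Proof.
move=> pS pT ST mF c0 SF; elim: n => [z|n IH z] /=; first by rewrite mul1e.
have [S1 S2 S3] := pS; have [T1 T2 T3] := pT.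
have [In1 In2 In3] := posop_iter n pT; have [Jn1 _ _] := posop_iter n pS.
have cn : (0 <= c ^+ n)%R by rewrite exprn_ge0.
apply: (@le_trans _ _ (S (fun z => (c ^+ n)%:E * iter n T F z) z)).
  by apply: S2 => //; [exact: Jn1|apply: pmeasZ => //; exact: In1].
rewrite S3//; last exact: In1.
rewrite exprSr EFinM -muleA lee_wpmul2l ?lee_fin//.
rewrite (commop_iter n pT ST)//.
apply: (@le_trans _ _ (iter n T (fun z => c%:E * T F z) z)).
  apply: In2 => //; first exact: S1.
  by apply: pmeasZ => //; exact: T1.
rewrite In3//; last exact: T1.
by rewrite -iterSr.
Qed.

(** Again one operator has to be moved next to [F]. Commutation inside either family suffices; in
    the applications it is always the family of sign averages. *)
Lemma posop_foldr_le (S T : J -> operator) js F (c : R) :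
  (forall j, posop (S j)) -> (forall j, posop (T j)) ->
  (forall i j, commop (S i) (T j)) -> pmeas F -> (0 <= c)%R ->
  (forall i j, commop (S i) (S j)) \/ (forall i j, commop (T i) (T j)) ->
  (forall j z, S j F z <= c%:E * T j F z) ->
  forall z, foldr S F js z <= (c ^+ size js)%:E * foldr T F js z.
Proof.
move=> pS pT ST mF c0 com SF; elim: js => [z|j js IH z] /=; first by rewrite mul1e.
have [S1 S2 S3] := pS j; have [T1 T2 T3] := pT j.
have [In1 In2 In3] := posop_foldr js pT; have [Jn1 Jn2 Jn3] := posop_foldr js pS.
have cn : (0 <= c ^+ size js)%R by rewrite exprn_ge0.
case: com => com.
  rewrite (commop_foldr js pS (com j))//.
  apply: (@le_trans _ _ (foldr S (fun z => c%:E * T j F z) js z)).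
    apply: Jn2 => //; first exact: S1.
    by apply: pmeasZ => //; exact: T1.
  rewrite Jn3//; last exact: T1.
  rewrite exprS EFinM -muleA lee_wpmul2l ?lee_fin//.
  rewrite -(commop_foldr js pS (fun i => commop_sym (ST i j)))//.
  apply: (@le_trans _ _ (T j (fun z => (c ^+ size js)%:E * foldr T F js z) z)).
    by apply: T2 => //; [exact: Jn1|apply: pmeasZ => //; exact: In1].
  by rewrite T3//; exact: In1.
apply: (@le_trans _ _ (S j (fun z => (c ^+ size js)%:E * foldr T F js z) z)).
  by apply: S2 => //; [exact: Jn1|apply: pmeasZ => //; exact: In1].
rewrite S3//; last exact: In1.
rewrite exprSr EFinM -muleA lee_wpmul2l ?lee_fin//.
rewrite (commop_foldr js pT (ST j))//.
apply: (@le_trans _ _ (foldr T (fun z => c%:E * T j F z) js z)).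
  apply: In2 => //; first exact: S1.
  by apply: pmeasZ => //; exact: T1.
rewrite In3//; last exact: T1.
by rewrite (commop_foldr js pT (com j)).
Qed.

(** Reconciles two orders: [gX] and [gY] are compared sweep by sweep over all coordinates, Gaussians
    and signs are compared coordinate by coordinate. *)
Lemma iter_foldr n (T : J -> operator) js F : (forall j, posop (T j)) ->
  (forall i j, commop (T i) (T j)) -> pmeas F ->
  iter n (fun F => foldr T F js) F = foldr (fun j => iter n (T j)) F js.
Proof.
move=> pT com mF; elim: js F mF => [|j js IH] F mF /=; first by elim: n => //= n ->.
have pf := posop_foldr js pT.
have cj : commop (T j) (fun F => foldr T F js) by apply: commop_foldr.
rewrite -IH// => {IH}; elim: n => //= n ->.
have [h _ _] := posop_iter n pf.
have := commop_iter n (pT j) (commop_sym cj) => <-//.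
exact: h.
Qed.

Lemma gauss_op_iter (P : V -> R) j (e : R) n : (0 < e)%R -> (0 < n)%N ->
  (forall z, continuous (fun t : R => P (bump_at z j t))) -> (forall z, 0 <= P z)%R ->
  iter n (gauss_op e j) (EFin \o P) = gauss_op (Num.sqrt n%:R * e) j (EFin \o P).
Proof.
move=> e0 n0 cP P0; case: n n0 => // n _; elim: n => [|n IH].
  by rewrite /= sqrtr1 mul1r.
rewrite iterS IH; apply/funext => z; rewrite {1}/gauss_op /=.
have := @integral_gauss_convolution R (fun t => P (bump_at z j t)) e (Num.sqrt n.+1%:R * e) e0 _ (cP z) (fun t => P0 _).
rewrite mulr_gt0 ?sqrtr_gt0// => /(_ isT).
have -> : (Num.sqrt (e ^+ 2 + (Num.sqrt n.+1%:R * e) ^+ 2) = Num.sqrt n.+2%:R * e :> R)%R.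
  rewrite exprMn sqr_sqrtr//.
  have -> : (e ^+ 2 + n.+1%:R * e ^+ 2 = n.+2%:R * e ^+ 2 :> R)%R by rewrite -[n.+2%:R]natr1; ring.
  by rewrite sqrtrM// sqrtr_sqr gtr0_norm.
rewrite /gauss_op /= => <-; apply: eq_integral => w _.
by apply: eq_integral => w' _ /=; rewrite bump_atD.
Qed.

(* [n] sign changes of size [n ^- (1/2)] simulate a Gaussian coordinate, each with relative error
   of order [n ^- (3/2)]; for the signs, [X] and [Y] are compared in one step. *)
Lemma gauss_list_compare (P : V -> R) (X Y : seq J) (C e0 : R) :
  pmeas (EFin \o P) -> (forall z j, continuous (fun t : R => P (bump_at z j t))) ->
  (0 < C)%R -> (0 < e0)%R ->
  (forall z j e, (0 < e <= e0)%R ->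
     gauss_op e j (EFin \o P) z <= (1 + C * e ^+ 3)%:E * rad_op e j (EFin \o P) z /\
     rad_op e j (EFin \o P) z <= (1 + C * e ^+ 3)%:E * gauss_op e j (EFin \o P) z) ->
  (forall z e, (0 < e <= e0)%R ->
     rad_list e X (EFin \o P) z <= (1 + C * e ^+ 3)%:E * rad_list e Y (EFin \o P) z) ->
  forall z, gauss_list X (EFin \o P) z <= gauss_list Y (EFin \o P) z.
Proof.
move=> mP cP C0 e00 GR XY z.
have P0 z' : (0 <= P z')%R by have := mP.1 z'; rewrite lee_fin.
pose D : R := ((size X + size Y).+1)%:R.
have step (n : nat) : (0 < n)%N -> ((Num.sqrt n%:R)^-1 <= e0)%R ->
    gauss_list X (EFin \o P) z <= (expR (C * D * (Num.sqrt n%:R)^-1))%:E * gauss_list Y (EFin \o P) z.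
  move=> n0 ne.
  (* For this size, [n] Gaussian steps compose to one standard Gaussian coordinate. *)
  set e : R := ((Num.sqrt n%:R)^-1)%R.
  have sn0 : (0 < Num.sqrt n%:R :> R)%R by rewrite sqrtr_gt0 ltr0n.
  have ep : (0 < e)%R by rewrite invr_gt0.
  have ee : (0 < e <= e0)%R by rewrite ep.
  have c0 : (0 <= 1 + C * e ^+ 3)%R by rewrite addr_ge0// mulr_ge0 ?exprn_ge0// ltW.
  have se : (Num.sqrt n%:R * e = 1)%R by rewrite mulfV// gt_eqF.
  set c := (1 + C * e ^+ 3)%R in c0.
  have cn0 : (0 <= c ^+ n)%R by rewrite exprn_ge0.
  have Gn j : iter n (gauss_op e j) (EFin \o P) = gauss_op 1 j (EFin \o P).
    by rewrite gauss_op_iter// se.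
  have GRc i j e1 e2 : commop (gauss_op e1 i) (rad_op e2 j) by move=> F mF; exact: gauss_rad_opC.
  have RRc i j e1 e2 : commop (rad_op e1 i) (rad_op e2 j) by move=> F mF; exact: rad_opC.
  have up j z' : gauss_op 1 j (EFin \o P) z' <= (c ^+ n)%:E * iter n (rad_op e j) (EFin \o P) z'.
    rewrite -Gn; apply: posop_iter_le => //; [exact: posop_gauss|exact: posop_rad|].
    by move=> y; have [] := GR y j e ee.
  have low j z' : iter n (rad_op e j) (EFin \o P) z' <= (c ^+ n)%:E * gauss_op 1 j (EFin \o P) z'.
    rewrite -Gn; apply: posop_iter_le => //; [exact: posop_rad|exact: posop_gauss|exact/commop_sym|].
    by move=> y; have [] := GR y j e ee.
  have pI j : posop (iter n (rad_op e j)) by apply: posop_iter; exact: posop_rad.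
  have GI i j : commop (gauss_op 1 i) (iter n (rad_op e j)).
    by apply: commop_iter; [exact: posop_rad|exact: GRc].
  have II i j : commop (iter n (rad_op e i)) (iter n (rad_op e j)).
    apply: commop_iter; first exact: posop_rad.
    by apply: commop_sym; apply: commop_iter; [exact: posop_rad|exact: RRc].
  have s1 : gauss_list X (EFin \o P) z <= ((c ^+ n) ^+ size X)%:E * foldr (fun j => iter n (rad_op e j)) (EFin \o P) X z.
    apply: posop_foldr_le => //; [by move=> j; exact: posop_gauss|by right].
  have s3 : foldr (fun j => iter n (rad_op e j)) (EFin \o P) Y z <= ((c ^+ n) ^+ size Y)%:E * gauss_list Y (EFin \o P) z.
    apply: posop_foldr_le => //; [by move=> j; exact: posop_gauss|by move=> i j; exact/commop_sym|by left].
  have s2 : foldr (fun j => iter n (rad_op e j)) (EFin \o P) X z <= (c ^+ n)%:E * foldr (fun j => iter n (rad_op e j)) (EFin \o P) Y z.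
    rewrite -!iter_foldr//; try (by move=> j; exact: posop_rad); try (by move=> i j; exact: RRc).
    apply: posop_iter_le => //.
    - by apply: posop_foldr => j; exact: posop_rad.
    - by apply: posop_foldr => j; exact: posop_rad.
    - apply: commop_foldr; first by move=> j; exact: posop_rad.
      move=> j; apply: commop_sym; apply: commop_foldr; first by move=> i; exact: posop_rad.
      by move=> i; exact: RRc.
    - by move=> y; exact: XY.
  apply: (le_trans s1); apply: (@le_trans _ _ (((c ^+ n) ^+ size X)%:E * ((c ^+ n)%:E * (((c ^+ n) ^+ size Y)%:E * gauss_list Y (EFin \o P) z)))).
    rewrite lee_wpmul2l ?lee_fin ?exprn_ge0//; apply: (le_trans s2).
    by rewrite lee_wpmul2l ?lee_fin.
  rewrite !muleA -!EFinM; apply: lee_wpmul2r.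
    have [h _ _] := posop_foldr Y (fun j => posop_gauss 1 j); exact: (h _ mP).1.
  rewrite lee_fin -exprSr -exprD -exprM.
  have cE : (c <= expR (C * e ^+ 3))%R by exact: expR_ge1Dx.
  (* A factor [c ^+ n] is lost for each coordinate of [X] and of [Y], and once more in passing from
     [X] to [Y]; as [n * e ^+ 2 = 1], the total exponent is of order [e]. *)
  have -> : (C * D * e = (n * ((size X).+1 + size Y))%:R * (C * e ^+ 3))%R.
    have ne2 : (n%:R * e ^+ 2 = 1 :> R)%R by rewrite /e exprVn sqr_sqrtr// divff// pnatr_eq0 -lt0n.
    rewrite natrM addSn -/D.
    by transitivity (n%:R * e ^+ 2 * (C * D * e))%R; [rewrite ne2 mul1r|ring].
  by rewrite expRM_natl lerXn2r// nnegrE ?expR_ge0.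
have [h1 _ _] := posop_foldr Y (fun j => posop_gauss 1 j).
have GY0 : 0 <= gauss_list Y (EFin \o P) z by exact: (h1 _ mP).1.
move: step GY0; move: (gauss_list X _ z) (gauss_list Y _ z) => A B step.
case: B step => [b step|_ _|_ //]; last first.
  by rewrite leey.
rewrite lee_fin => b0; apply/lee_addgt0Pr => eta eta0.
(* Chosen so that [expR l * b <= b + eta]; [n] below makes the total error exponent at most [l] and
   the step at most [e0]. *)
pose l := ln (1 + eta / (b + 1))%R.
have eb : (0 < eta / (b + 1))%R by rewrite divr_gt0//; lra.
have l0 : (0 < l)%R by rewrite ln_gt0// ltrDl.
have CD0 : (0 < C * D)%R by rewrite mulr_gt0// ltr0n.
pose M := Num.max e0^-1%R (C * D / l)%R.
have M0 : (0 < M)%R by rewrite /M lt_max invr_gt0 e00.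
pose n := (Num.truncn (M ^+ 2)).+1.
have nY : (M <= Num.sqrt n%:R)%R.
  rewrite -(ger0_norm (ltW M0)) -sqrtr_sqr ler_wsqrtr// ltW//.
  exact: truncnS_gt.
have sn0 : (0 < Num.sqrt n%:R :> R)%R by rewrite (lt_le_trans M0).
have n_e0 : ((Num.sqrt n%:R)^-1 <= e0)%R.
  rewrite -[leRHS]invrK lef_pV2 ?posrE ?invr_gt0//.
  by rewrite (le_trans _ nY)// /M le_max lexx.
have n_l : (C * D * (Num.sqrt n%:R)^-1 <= l)%R.
  rewrite ler_pdivrMr// -ler_pdivrMl// mulrC.
  by rewrite (le_trans _ nY)// /M le_max lexx orbT.
apply: (le_trans (step n isT n_e0)).
rewrite -EFinM -EFinD lee_fin.
apply: (@le_trans _ _ ((1 + eta / (b + 1)) * b)%R).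
  by rewrite ler_wpM2r// -[leRHS]lnK ?posrE ?addr_gt0// ler_expR.
rewrite mulrDl mul1r lerD2l mulrAC ler_pdivrMr; last lra.
by rewrite ler_pM2l//; lra.
Qed.

End Operators.

(** * Iterated integrals as the law of a Gaussian array *)

Section Law.
Variables (R : realType) (J : finType).
Notation gauss := (@normal_prob R 0 1).
Notation V := (J -> R).
Implicit Types (F : V -> \bar R) (z : V).
Local Open Scope ereal_scope.

Lemma posop_gauss_list js : posop (@gauss_list R J js).
Proof. by apply: posop_foldr => j; exact: posop_gauss. Qed.

Lemma pmeas_gauss_list js F : pmeas F -> pmeas (gauss_list js F).
Proof. by case: (posop_gauss_list js) => h _ _; exact: h. Qed.

Lemma gauss_listZ js (c : R) F : (0 <= c)%R -> pmeas F ->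
  gauss_list js (fun z => c%:E * F z) = fun z => c%:E * gauss_list js F z.
Proof. by case: (posop_gauss_list js) => _ _ h; exact: h. Qed.

Lemma gauss_listD js F F' : pmeas F -> pmeas F' ->
  gauss_list js (fun z => F z + F' z) = fun z => gauss_list js F z + gauss_list js F' z.
Proof.
move=> mF mF'; elim: js => //= j js ->; apply/funext => z; rewrite /gauss_op.
have h := pmeas_gauss_list js mF; have h' := pmeas_gauss_list js mF'.
rewrite ge0_integralD//.
- by move=> w _; exact: h.1.
- exact: (pmeas_line z j 1 h).
- by move=> w _; exact: h'.1.
- exact: (pmeas_line z j 1 h').
Qed.

Lemma gauss_list_prod js (H : J -> R -> \bar R) z : uniq js ->
  (forall j, measurable_fun setT (H j)) -> (forall j w, 0 <= H j w) ->
  gauss_list js (fun z => \prod_j H j (z j)) z =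
  \prod_j (if j \in js then \int[gauss]_w H j (z j + w)%R else H j (z j)).
Proof.
move=> ujs mH H0; elim: js ujs z => [_ z|j js IH /= /andP[jjs ujs] z] //=.
rewrite /gauss_op; under eq_integral do rewrite IH//.
set Q := \prod_(i | i != j) (if i \in js then \int[gauss]_w H i (z i + w)%R else H i (z i)).
transitivity (\int[gauss]_w (H j (z j + w)%R * Q)).
  apply: eq_integral => w _; rewrite (bigD1 j)//= (negPf jjs); congr (H j _ * _).
    by rewrite /bump_at eqxx mul1r mulr1.
  apply: eq_bigr => i ij; by rewrite /bump_at (negPf ij) mulr0 addr0.
have Q0 : 0 <= Q.
  by apply: prode_ge0 => i _; case: ifP => // _; apply: integral_ge0 => w _; exact: H0.
rewrite ge0_integralZr//; last by apply: measurableT_comp => //; exact: measurable_funD.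
rewrite [RHS](bigD1 j)//= inE eqxx/=; congr (_ * _).
by apply: eq_bigr => i ij; rewrite inE (negPf ij).
Qed.

(** Generators of the product sigma-algebra, stable under intersection as the uniqueness theorem for
    measures requires. *)
Definition boxes : set (set V) :=
  [set A | exists2 B : J -> set R, (forall j, measurable (B j)) & A = [set z | forall j, B j (z j)]].

Let M := g_sigma_algebraType boxes.

Lemma measurable_boxes d (T : measurableType d) (c : J -> T -> R) :
  (forall j, measurable_fun setT (c j)) ->
  measurable_fun setT ((fun x j => c j x) : T -> M).
Proof.
move=> mc; apply: (@measurability _ _ T M setT _ boxes) => //= _ [_ [B mB ->] <-].
rewrite setTI.
rewrite (_ : _ @^-1` _ = \bigcap_(j in [set: J]) (c j @^-1` B j)).
  apply: fin_bigcap_measurable; first exact: finite_finset.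
  by move=> j _; rewrite -[X in measurable X]setTI; exact: mc.
by apply/seteqP; split=> x /= h j => [_|]; exact: h.
Qed.

Lemma pmeas_indic (A : set M) : measurable A -> pmeas (fun z => (\1_A z)%:E).
Proof.
move=> mA; split=> [z|d T c mc]; first by rewrite lee_fin.
have := measurable_boxes mc => mf.
apply/measurable_EFinP; apply: (measurableT_comp _ mf).
exact: measurable_indic.
Qed.

Lemma measurable_coord (j : J) : measurable_fun setT ((fun z => z j) : M -> R).
Proof.
move=> _ B mB; rewrite setTI; apply: sub_sigma_algebra.
exists (fun i => if i == j then B else setT).
  by move=> i; case: ifP.
apply/seteqP; split=> z /=; last by move/(_ j); rewrite eqxx.
by move=> h i; case: eqP => // ->.
Qed.

Definition gauss_law js z (A : set M) : \bar R :=
  gauss_list js (fun z => (\1_(A : set V) z)%:E) z.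

(** Induction on the list, starting from a Dirac measure and exchanging the series with one integral
    at each step. *)
Lemma gauss_law_sigma_additive js z : semi_sigma_additive (gauss_law js z).
Proof.
move=> F mF tF mU.
have F0 (js' : seq J) z' n : 0 <= gauss_law js' z' (F n).
  by have [h _] := pmeas_gauss_list js' (pmeas_indic (mF n)); exact: h.
suff -> : gauss_law js z (\bigcup_n F n) = \sum_(0 <= n <oo) gauss_law js z (F n).
  by apply: is_cvg_nneseries => n _ _; exact: F0.
elim: js z => [|j js IH] z.
  apply/esym/cvg_lim => //.
  exact: (@measure_semi_sigma_additive _ M R (dirac (z : M)) F mF tF mU).
rewrite {1}/gauss_law /= {1}/gauss_op -/(gauss_law js).
under eq_integral do rewrite -/(gauss_law js _ _) IH.
rewrite integral_nneseries//.
- by move=> n; apply: (pmeas_line z j 1); apply: pmeas_gauss_list; exact: pmeas_indic.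
Qed.

Lemma gauss_law_ge0 js z A : 0 <= gauss_law js z A.
Proof.
rewrite /gauss_law; elim: js z => [|j js IH] z /=; first by rewrite lee_fin.
by apply: integral_ge0 => w _; exact: IH.
Qed.

Lemma gauss_law0 js z : gauss_law js z set0 = 0.
Proof.
rewrite /gauss_law; elim: js z => [|j js IH] z /=; first by rewrite indic0.
by apply: integral0_eq => w _; exact: IH.
Qed.

HB.instance Definition _ js z := isMeasure.Build _ M R (gauss_law js z)
  (gauss_law0 js z) (gauss_law_ge0 js z) (@gauss_law_sigma_additive js z).

Lemma setI_closed_boxes : setI_closed boxes.
Proof.
move=> _ _ [B mB ->] [B' mB' ->]; exists (fun j => B j `&` B' j).
  by move=> j; exact: measurableI.
apply/seteqP; split=> z /=; first by move=> [h h'] j.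
by move=> h; split=> j; have [] := h j.
Qed.

(** Independence is available as a product formula on boxes; uniqueness of measures on a pi-system
    extends it to every measurable event. Coordinates outside [js] have the point mass at 0 as
    law. *)
Lemma law_gauss_list d (T : measurableType d) (P : probability T R) (X : J -> T -> R) js :
  uniq js -> (forall j, measurable_fun setT (X j)) ->
  (forall B : J -> set R, (forall j, measurable (B j)) ->
    P [set w | forall j, B j (X j w)] =
    \prod_j (if j \in js then gauss (B j) else (\1_(B j) 0%R)%:E)) ->
  forall A : set M, measurable A ->
    P [set w | A (fun j => X j w)] = gauss_list js (fun z => (\1_(A : set V) z)%:E) (fun=> 0%R).
Proof.
move=> ujs mX law A mA.
have mf := measurable_boxes mX.
pose f : T -> M := fun w j => X j w.
have mf0 : measurable_fun setT f := mf.
rewrite -[LHS]/(pushforward P f A) -[RHS]/(gauss_law js (fun=> 0%R) A).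
apply: (@measure_unique _ R M boxes (fun=> setT)) => //.
- exact: setI_closed_boxes.
- by move=> _; exists (fun=> setT) => //; apply/seteqP; split.
- by rewrite bigcup_const.
- move=> _ [B mB ->].
  rewrite [LHS](law B mB) -[RHS]/(gauss_list js (fun z => (\1_[set z | forall j, B j (z j)] z)%:E) (fun=> 0%R)).
  apply/esym.
  transitivity (gauss_list js (fun z => \prod_j (\1_(B j) (z j))%:E) (fun=> 0%R)).
    congr (gauss_list js _ _); apply/funext => z.
    rewrite prodEFin indicE; congr EFin.
    have [h|h] := pselect (forall j, B j (z j)).
      rewrite mem_set//= big1// => j _; rewrite indicE mem_set//; exact: h.
    rewrite memNset//=; move/existsNP : h => [j h].
    by rewrite (bigD1 j)//= indicE memNset// mul0r.
  rewrite (gauss_list_prod (H := fun j w => (\1_(B j) w)%:E))//.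
  + apply: eq_bigr => j _; case: ifP => // _.
    under eq_integral do rewrite add0r.
    by rewrite (@integral_indic _ _ _ gauss setT measurableT (B j) (mB j)) setIT.
  + by move=> j; apply/measurable_EFinP; exact: measurable_indic.
- move=> _; rewrite /= /pushforward preimage_setT probability_setT; exact: ltry.
Qed.
End Law.

(** * Gordon's comparison inequality *)

Section Gordon.
Variables (R : realType) (m N n : nat).
Variable x : 'I_n.+1 -> 'I_N -> R.
Hypothesis x1 : forall k, \sum_j x k j ^+ 2 = 1.
Local Notation gidx := (gidx m N).
Notation V := (gidx -> R).
Local Open Scope ereal_scope.

Section FixedParameters.
Variables beta eta rho : R.
Hypotheses (beta0 : (0 < beta)%R) (eta0 : (0 < eta)%R) (rho01 : (0 < rho < 1)%R).

Let Phi : V -> R := gPhi x beta eta rho.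

Lemma pmeas_gPhi : pmeas (EFin \o Phi).
Proof.
split=> [z|d T c mc]; first by rewrite lee_fin expR_ge0.
apply/measurable_EFinP; apply: measurableT_comp => //.
apply: measurable_funM => //; apply: measurableT_comp; first exact: measurable_ln.
apply: measurable_sum => k; apply: measurableT_comp => //.
apply: measurable_funM => //; apply: measurable_funB.
  apply: measurable_funD => //; apply: measurable_sum => j; exact: measurable_funM.
apply: (measurableT_comp (f := fun t : R => Num.sqrt t)).
  apply: continuous_measurable_fun; exact: sqrt_continuous.
apply: measurable_funD => //; apply: measurable_sum => i; apply: measurable_funX.
apply: measurable_funD => //; apply: measurable_sum => j; exact: measurable_funM.
Qed.

Let gline_unit (z : V) j t : gline z (bump_at (fun=> 0%R) j 1) t = bump_at z j t.
Proof. by apply/funext => i; rewrite /gline /bump_at add0r mul1r. Qed.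

Let unit_le1 (j i : gidx) : (`|bump_at (fun=> 0) j 1 i| <= 1 :> R)%R.
Proof.
by rewrite /bump_at add0r mul1r; case: (i == j); rewrite ?normr1 ?normr0.
Qed.

Lemma gordon_gPhi z : gauss_list (gX m N) (EFin \o Phi) z <= gauss_list (gY m N) (EFin \o Phi) z.
Proof.
have [K HK] := gPhi_tame m x1 beta0 eta0 rho01 (@ler01 R).
have K0 : (0 <= K)%R.
  by have [f1 [f2 [/tame_ge0]]] := HK (fun=> 0%R) (bump_at (fun=> 0%R) (inl (inr tt)) 1) (unit_le1 _).
have [C1 [e1 [C10 e10 H1]]] := gauss_rademacher_step K0.
have [C2 [e2 [C20 e20 H2]]] := sign_avg_gPhi_XY m x1 beta0 eta0 rho01.
pose C := Num.max C1 C2; pose e0 := Num.min e1 e2.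
have C1C (e : R) : (0 < e)%R -> (1 + C1 * e ^+ 3 <= 1 + C * e ^+ 3)%R.
  by move=> ep; rewrite lerD2l ler_wpM2r ?exprn_ge0 ?(ltW ep)// /C le_max lexx.
have C2C (e : R) : (0 < e)%R -> (1 + C2 * e ^+ 3 <= 1 + C * e ^+ 3)%R.
  by move=> ep; rewrite lerD2l ler_wpM2r ?exprn_ge0 ?(ltW ep)// /C le_max lexx orbT.
have ee1 (e : R) : (0 < e <= e0)%R -> (0 < e <= e1)%R.
  by case/andP => -> /=; rewrite le_min => /andP[].
have ee2 (e : R) : (0 < e <= e0)%R -> (0 < e <= e2)%R.
  by case/andP => -> /=; rewrite le_min => /andP[].
have tm z' j : exists f1 f2, tame K (fun t => Phi (bump_at z' j t)) f1 f2.
  have [f1 [f2 [t _]]] := HK z' (bump_at (fun=> 0%R) j 1) (unit_le1 j).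
  exists f1, f2.
  have E : (fun t => Phi (bump_at z' j t)) =
      (fun t => Phi (gline z' (bump_at (fun=> 0%R) j 1) t)).
    by apply/funext => s; congr Phi; exact/esym/gline_unit.
  rewrite E; exact: t.
apply: (@gauss_list_compare _ _ Phi _ _ C e0).
- exact: pmeas_gPhi.
- move=> z' j t; have [f1 [f2 [f3 [d1 _ _ _ _]]]] := tm z' j.
  apply: differentiable_continuous; apply/derivable1_diffP.
  by have [h _] := d1 t; exact: h.
- by rewrite lt_max C10.
- by rewrite lt_min e10.
- move=> z' j e ee; have [f1 [f2 t]] := tm z' j.
  have [h1 h2] := H1 _ _ _ t e (ee1 _ ee).
  have e_gt0 : (0 < e)%R by case/andP: ee.
  have radE : rad_op e j (EFin \o Phi) z' = ((Phi (bump_at z' j e) + Phi (bump_at z' j (- e))) / 2)%:E.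
    by rewrite /rad_op /= -EFinD -EFinM mulrC.
  rewrite radE; split.
    apply: (le_trans h1); rewrite -EFinM lee_fin ler_wpM2r ?C1C//.
    by rewrite divr_ge0// addr_ge0// expR_ge0.
  apply: (le_trans h2); rewrite lee_wpmul2r ?lee_fin ?C1C//.
  by apply: integral_ge0 => w _; rewrite lee_fin expR_ge0.
- move=> z' e ee.
  have e_gt0 : (0 < e)%R by case/andP: ee.
  have -> : z' = (fun j => z' j + e * (fun=> 0) j)%R by apply/funext => j; rewrite mulr0 addr0.
  rewrite !rad_list_sign_avg -EFinM lee_fin.
  apply: (le_trans (H2 z' e (ee2 _ ee))); rewrite ler_wpM2r ?C2C//.
  have nn js s : (0 <= sign_avg js (fun s => Phi (fun j => z' j + e * s j)%R) s)%R.
    elim: js s => [|j js IH] s /=; first exact: expR_ge0.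
    by rewrite divr_ge0// addr_ge0.
  exact: nn.
Qed.

End FixedParameters.

(** [Q] records that coordinates outside the list keep their initial value 0; the pointwise bounds
    to be integrated hold only there. *)
Lemma gauss_list_le_on (Q : V -> Prop) (js : seq gidx) (F F' : V -> \bar R) :
  pmeas F -> pmeas F' ->
  (forall z j t, j \in js -> Q z -> Q (bump_at z j t)) ->
  (forall z, Q z -> F z <= F' z) ->
  forall z, Q z -> gauss_list js F z <= gauss_list js F' z.
Proof.
move=> mF mF'; elim: js => [//|j js IH] Qb FF' z Qz /=.
have h := pmeas_gauss_list js mF; have h' := pmeas_gauss_list js mF'.
apply: ge0_le_integral => //.
- by move=> w _; exact: h.1.
- exact: pmeas_line.
- exact: pmeas_line.
- move=> w _; apply: IH => //.
    by move=> z' j' t j'js; apply: Qb; rewrite inE j'js orbT.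
  by apply: Qb => //; rewrite inE eqxx.
Qed.

Definition gentries : seq gidx := [seq inl (inl p) | p <- enum {: 'I_m * 'I_N}].

Lemma gXE : gX m N = gentries ++ [:: inl (inr tt)].
Proof.
rewrite /gX /gentries enumT unlock /= /sum_enum map_cat -!map_comp; congr (_ ++ _).
by rewrite unlock.
Qed.

Definition small_image (delta : R) : set (g_sigma_algebraType (@boxes R gidx)) :=
  [set z | exists k, (\sum_i (\sum_j (z : V) (inl (inl (i, j))) * x k j) ^+ 2 < delta ^+ 2)%R].

Lemma measurable_small_image delta : measurable (small_image delta).
Proof.
rewrite (_ : small_image delta = \bigcup_(k in [set: 'I_n.+1])
   [set z | (\sum_i (\sum_j (z : V) (inl (inl (i, j))) * x k j) ^+ 2 < delta ^+ 2)%R]); last first.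
  by apply/seteqP; split=> z /= [k] => [h|_ h]; exists k.
apply: fin_bigcup_measurable; first exact: finite_finset.
move=> k _.
rewrite -[X in measurable X]setTI; apply: measurable_fun_ltr => //.
apply: measurable_sum => i; apply: measurable_funX; apply: measurable_sum => j.
by apply: measurable_funM => //; exact: measurable_coord.
Qed.

Lemma law_entries d (T : measurableType d) (P : probability T R) (a : 'I_m -> 'I_N -> T -> R)
  (A : set (g_sigma_algebraType (@boxes R gidx))) : iid_std_gaussian P a -> measurable A ->
  P [set w | A (fun j => if j is inl (inl p) then a p.1 p.2 w else 0%R)] =
  gauss_list gentries (fun z => (\1_(A : set V) z)%:E) (fun=> 0%R).
Proof.
move=> [ma aG ai] mA.
apply: (@law_gauss_list R gidx d T P
  (fun j w => if j is inl (inl p) then a p.1 p.2 w else 0%R) gentries) => //.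
- by rewrite map_inj_uniq ?enum_uniq// => p q [].
- by case=> [[p|u]|[i|j]] //; exact: ma.
- move=> B mB.
  have ent p : inl (inl p) \in gentries by rewrite map_f ?mem_enum.
  have notent j : j \notin gentries -> (if j is inl (inl p) then False else True).
    by case: j => [[p|u]|u] //; rewrite ent.
  (* If some side of the box outside the matrix misses 0, both probabilities vanish. *)
  have [h|/existsNP[j /not_implyP[jn jB]]] := pselect (forall j, j \notin gentries -> B j 0%R); last first.
    rewrite (bigD1 j)//= (negPf jn) indicE memNset// mul0e -(measure0 P); congr (P _).
    apply/seteqP; split=> w //= /(_ j).
    by move: (notent _ jn) jB; case: (j) => [[p|u]|u].
  transitivity (P [set w | forall i j, B (inl (inl (i, j))) (a i j w)]).
    congr (P _); apply/seteqP; split=> w /=; first by move=> H i j; exact: (H (inl (inl (i, j)))).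
    move=> H [[[i j]|u]|u]; first exact: H.
      by apply: h; apply/mapP => -[].
    by apply: h; apply/mapP => -[].
  rewrite (ai (fun i j => B (inl (inl (i, j)))))// big_sumType/= big_sumType/=.
  rewrite [X in _ = _ * X * _]big1 ?mule1; last first.
    move=> u _; case: ifPn => [/mapP[]//|/h hB]; by rewrite indicE mem_set.
  rewrite [X in _ = _ * X]big1 ?mule1; last first.
    move=> u _; case: ifPn => [/mapP[]//|/h hB]; by rewrite indicE mem_set.
  rewrite pair_bigA; apply: eq_bigr => -[i j] _ /=.
  by rewrite ent aG.
Qed.

Section Probability.
Variables (lam : R) (F : V -> \bar R).
Hypotheses (lam0 : (0 < lam)%R) (mF : pmeas F).
Hypothesis hF : forall z k, (expR (lam * (\sum_j z (inr (inr j)) * x k j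
  - Num.sqrt (\sum_i z (inr (inl i)) ^+ 2))))%:E <= F z.

Let F0 z : 0 <= F z. Proof. exact: mF.1. Qed.

(** Each of the [n.+1] terms of the soft maximum is at most [F z] to the power [1 / rho], so [gPhi]
    exceeds [F] by a factor at most [n.+1] to the power [rho]. *)
Let gPhi_le beta eta : (lam < beta)%R -> (0 < eta)%R ->
  gauss_list (gY m N) (EFin \o gPhi x beta eta (lam / beta)) (fun=> 0%R) <=
  (expR (lam / beta * ln n.+1%:R))%:E * gauss_list (gY m N) F (fun=> 0%R).
Proof.
move=> lb eta0; set rho := (lam / beta)%R.
have beta0 : (0 < beta)%R by exact: lt_trans lb.
have rho0 : (0 < rho)%R by rewrite divr_gt0.
rewrite -[leRHS]/((fun z => (expR (rho * ln n.+1%:R))%:E * gauss_list (gY m N) F z) (fun=> 0%R)).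
rewrite -gauss_listZ ?expR_ge0//.
apply: (@gauss_list_le_on (fun z => forall p, z (inl p) = 0%R)) => //.
- exact: pmeas_gPhi.
- by apply: pmeasZ => //; exact: expR_ge0.
- move=> z j t /mapP[q _ ->] z0 p; rewrite /bump_at z0 add0r.
  by rewrite (_ : (inl p == inr q :> gidx) = false)// mulr0.
move=> z z0; have := hF z; move: (mF.1 z); case: (F z) => [f||]//= f0 hf.
  have f_gt0 : (0 < f)%R by have := hf ord0; rewrite lee_fin; apply: lt_le_trans; exact: expR_gt0.
  have ek k : (gexp x beta eta z k <= expR (ln f / rho))%R.
    rewrite ler_expR ler_pdivlMr// -ler_expR lnK ?posrE//.
    have := hf k; rewrite lee_fin; apply: le_trans; rewrite ler_expR.
    have -> : (beta * (gv x z k - gsig x eta z k) * rho = lam * (gv x z k - gsig x eta z k))%R.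
      by rewrite /rho; field; rewrite gt_eqF.
    rewrite ler_pM2l// /gv z0 add0r lerB// /gsig ler_wsqrtr//.
    rewrite -[leLHS]add0r lerD ?sqr_ge0//; apply: ler_sum => i _.
    by rewrite /gu big1 ?add0r// => j _; rewrite z0 mul0r.
  rewrite -EFinM lee_fin -[X in (_ <= _ * X)%R]lnK ?posrE//.
  rewrite -expRD ler_expR.
  have -> : (rho * ln n.+1%:R + ln f = rho * (ln n.+1%:R + ln f / rho))%R.
    by field; rewrite gt_eqF.
  rewrite ler_pM2l//.
  have -> : (ln f / rho = ln (expR (ln f / rho)))%R by rewrite expRK.
  rewrite -lnM ?posrE ?expR_gt0 ?ltr0n//.
  rewrite ler_ln ?posrE; last 2 first.
  - rewrite big_ord_recl ltr_pwDl ?expR_gt0// sumr_ge0// => k _; exact: expR_ge0.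
  - by rewrite mulr_gt0 ?expR_gt0// ltr0n.
  apply: (@le_trans _ _ (\sum_(k < n.+1) expR (ln f / rho))%R); first exact: ler_sum.
  by rewrite sumr_const card_ord mulr_natl.
by rewrite gt0_muley ?lte_fin ?expR_gt0// leey.
Qed.

Variables (d : measure_display) (T : measurableType d) (P : probability T R).
Variable a : 'I_m -> 'I_N -> T -> R.
Hypothesis iid : iid_std_gaussian P a.

(** On the event one term of the soft maximum is already large, since its [gsig] is at most
    [eta + delta]. The scalar coordinate is integrated separately and yields
    [expR (lam ^+ 2 / 2)]. *)
Let gPhi_ge beta eta delta : (lam < beta)%R -> (0 < eta)%R -> (0 < delta)%R ->
  (expR (lam ^+ 2 / 2 - lam * (eta + delta)))%:E *
    P [set w | exists k, (\sum_i (\sum_j a i j w * x k j) ^+ 2 < delta ^+ 2)%R] <=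
  gauss_list (gX m N) (EFin \o gPhi x beta eta (lam / beta)) (fun=> 0%R).
Proof.
move=> lb eta0 delta0; set rho := (lam / beta)%R.
have beta0 : (0 < beta)%R by exact: lt_trans lb.
have rho0 : (0 < rho)%R by rewrite divr_gt0.
pose c := expR (- lam * (eta + delta)).
have -> : expR (lam ^+ 2 / 2 - lam * (eta + delta)) = (c * expR (lam ^+ 2 / 2))%R.
  by rewrite -expRD; congr expR; ring.
pose Ind z : \bar R := (\1_(small_image delta : set V) z)%:E.
have mInd : pmeas Ind by apply: pmeas_indic; exact: measurable_small_image.
pose L z : \bar R := (expR (lam * z (inl (inr tt))))%:E * Ind z.
have mL : pmeas L.
  split=> [z|d' T' b mb]; first by rewrite mule_ge0 ?lee_fin ?expR_ge0.
  apply: emeasurable_funM; last exact: mInd.2.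
  apply/measurable_EFinP; apply: measurableT_comp => //.
  exact: measurable_funM.
have -> : P [set w | exists k, (\sum_i (\sum_j a i j w * x k j) ^+ 2 < delta ^+ 2)%R] =
    gauss_list gentries Ind (fun=> 0%R).
  by rewrite -(law_entries iid (measurable_small_image delta)).
rewrite EFinM -muleA.
apply: (@le_trans _ _ (c%:E * gauss_list (gX m N) L (fun=> 0%R))).
  rewrite lee_wpmul2l ?lee_fin ?expR_ge0// gXE /gauss_list foldr_cat -!/(gauss_list _ _).
  rewrite -[leLHS]/((fun z => (expR (lam ^+ 2 / 2))%:E * gauss_list gentries Ind z) (fun=> 0%R)).
  rewrite -gauss_listZ ?expR_ge0//.
  apply: (@gauss_list_le_on (fun z => z (inl (inr tt)) = 0%R)) => //.
  - by apply: pmeasZ => //; exact: expR_ge0.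
  - exact: pmeas_gauss_op.
  - move=> z j t /mapP[q _ ->] z0; rewrite /bump_at z0 add0r.
    by rewrite (_ : (inl (inr tt) == inl (inl q) :> gidx) = false)// mulr0.
  move=> z z0; rewrite /= /gauss_op /L.
  have E w : Ind (bump_at z (inl (inr tt)) (1 * w)) = Ind z.
    rewrite /Ind; congr EFin; rewrite !indicE; congr (_%:R : R); congr nat_of_bool.
    apply/idP/idP => /set_mem [k hk]; apply/mem_set; exists k; move: hk; congr (_ < _)%R;
      apply: eq_bigr => i _; congr (_ ^+ 2)%R; apply: eq_bigr => j _; rewrite /bump_at;
      by rewrite (_ : (inl (inl (i, j)) == inl (inr tt) :> gidx) = false)// mulr0 addr0.
  under eq_integral do rewrite E.
  rewrite ge0_integralZr//; last 2 first.
  - apply/measurable_EFinP; apply: measurableT_comp => //; apply: measurable_funM => //.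
    apply: measurable_funD => //; apply: measurable_funM => //; exact: measurable_funM.
  - exact: mInd.1.
  rewrite -(integral_gauss_expR lam); apply: lee_wpmul2r; first exact: mInd.1.
  rewrite le_eqVlt; apply/orP; left; apply/eqP; apply: eq_integral => w _.
  by rewrite /bump_at z0 eqxx add0r mul1r mulr1.
rewrite -[leLHS]/((fun z => c%:E * gauss_list (gX m N) L z) (fun=> 0%R)).
rewrite -gauss_listZ ?expR_ge0//.
apply: (@gauss_list_le_on (fun z => forall p, z (inr p) = 0%R)) => //.
- by apply: pmeasZ => //; exact: expR_ge0.
- exact: pmeas_gPhi.
- move=> z j t /mapP[q _ ->] z0 p; rewrite /bump_at z0 add0r.
  by rewrite (_ : (inr p == inl q :> gidx) = false)// mulr0.
move=> z z0; rewrite /= /L /Ind indicE.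
have [h|h] := pselect (small_image delta z); last by rewrite memNset//= !mule0 lee_fin expR_ge0.
rewrite mem_set// mule1 -EFinM -expRD lee_fin ler_expR.
have {h} [k hk] := h.
have guE i : gu x z k i = (\sum_j z (inl (inl (i, j))) * x k j)%R by rewrite /gu z0 addr0.
apply: (@le_trans _ _ (rho * ln (gexp x beta eta z k))%R).
  rewrite /gexp expRK.
  have -> : (rho * (beta * (gv x z k - gsig x eta z k)) = lam * (gv x z k - gsig x eta z k))%R.
    by rewrite /rho; field; rewrite gt_eqF.
  rewrite /gv big1 ?addr0; last by move=> j _; rewrite z0 mul0r.
  have : (gsig x eta z k <= eta + delta)%R.
    have ed : (0 <= eta + delta)%R by rewrite addr_ge0// ltW.
    rewrite /gsig -[leRHS]ger0_norm// -sqrtr_sqr ler_wsqrtr//.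
    under eq_bigr do rewrite guE.
    have := mulr_ge0 (ltW eta0) (ltW delta0); move: hk => /=; nra.
  by move=> h; have := ler_wpM2l (ltW lam0) h; rewrite mulNr mulrBr; lra.
rewrite ler_pM2l// ler_ln ?posrE ?expR_gt0//; last first.
  rewrite big_ord_recl ltr_pwDl ?expR_gt0// sumr_ge0// => k' _; exact: expR_ge0.
by rewrite (bigD1 k)//= lerDl sumr_ge0// => k' _; exact: expR_ge0.
Qed.

Lemma gordon_prob delta : (0 < delta)%R ->
  (expR (lam ^+ 2 / 2 - lam * delta))%:E *
    P [set w | exists k, (\sum_i (\sum_j a i j w * x k j) ^+ 2 < delta ^+ 2)%R] <=
  gauss_list (gY m N) F (fun=> 0%R).
Proof.
move=> delta0; apply/lee_mul01Pr; first by rewrite mule_ge0 ?lee_fin ?expR_ge0.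
move=> r /andP[r0 r1].
(* The loss allowed by [r < 1] is split in two equal parts: [eta] is small enough that
   [lam * eta = th / 2], and [beta] large enough that the soft maximum costs at most
   [expR (th / 2)]. *)
pose th := (- ln r)%R.
have th0 : (0 < th)%R by rewrite /th oppr_gt0 ln_lt0// r0.
pose eta := (th / (2 * lam))%R.
have eta0 : (0 < eta)%R by rewrite divr_gt0// mulr_gt0.
pose l := ln (n.+1%:R : R).
have l0 : (0 <= l)%R by rewrite ln_ge0// ler1n.
pose beta := (lam + 1 + 2 * lam * l / th)%R.
have lb : (lam < beta)%R.
  rewrite /beta -addrA ltrDl ltr_pwDl// divr_ge0 ?(ltW th0)//.
  exact: (mulr_ge0 (mulr_ge0 (ler0n R 2) (ltW lam0)) l0).
have beta0 : (0 < beta)%R by exact: lt_trans lb.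
have rho01 : (0 < lam / beta < 1)%R by rewrite divr_gt0// ltr_pdivrMr// mul1r.
have h1 := gPhi_le lb eta0; have h2 := gPhi_ge lb eta0 delta0.
have h3 := gordon_gPhi beta0 eta0 rho01 (fun=> 0%R).
have {h1 h2 h3} h := le_trans h2 (le_trans h3 h1).
have h4 : (lam / beta * l <= th / 2)%R.
  rewrite mulrAC ler_pdivrMr//.
  have -> : (th / 2 * beta = th / 2 * (lam + 1) + lam * l)%R by rewrite /beta; field; rewrite gt_eqF.
  by rewrite lerDr mulr_ge0// ?divr_ge0 ?addr_ge0 ?ltW.
have pE : (r = expR (- th / 2) * expR (- lam * eta))%R.
  rewrite -expRD -[LHS]lnK ?posrE//; congr expR; rewrite -[ln r]opprK -/th /eta.
  by field; rewrite gt_eqF.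
set Q := gauss_list (gY m N) F _ in h *.
have Q0 : 0 <= Q by exact: (pmeas_gauss_list (gY m N) mF).1.
have -> : r%:E * ((expR (lam ^+ 2 / 2 - lam * delta))%:E *
    P [set w | exists k, (\sum_i (\sum_j a i j w * x k j) ^+ 2 < delta ^+ 2)%R]) =
  (expR (- th / 2))%:E * ((expR (lam ^+ 2 / 2 - lam * (eta + delta)))%:E *
    P [set w | exists k, (\sum_i (\sum_j a i j w * x k j) ^+ 2 < delta ^+ 2)%R]).
  rewrite !muleA -!EFinM; congr (_%:E * _); rewrite pE -mulrA; congr (_ * _)%R.
  by rewrite -expRD; congr expR; ring.
apply: (@le_trans _ _ ((expR (- th / 2))%:E * ((expR (lam / beta * l))%:E * Q))).
  by rewrite lee_wpmul2l ?lee_fin ?expR_ge0.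
rewrite muleA -EFinM -expRD -[leRHS]mul1e lee_wpmul2r// lee_fin -[leRHS]expR0 ler_expR.
by rewrite mulNr addrC subr_le0.
Qed.

End Probability.

End Gordon.

(** * Majorants of product form *)

Section ProductBound.
Variables (R : realType) (m N n : nat).
Variable x : 'I_n.+1 -> 'I_N -> R.
Hypothesis x1 : forall k, \sum_j x k j ^+ 2 = 1.
Notation gauss := (@normal_prob R 0 1).
Local Notation gidx := (gidx m N).
Notation V := (gidx -> R).
Local Open Scope ereal_scope.

Lemma lee_prod (I : finType) (f g : I -> \bar R) : (forall i, 0 <= f i <= g i) ->
  \prod_i f i <= \prod_i g i.
Proof.
move=> fg; suff /andP[] : 0 <= \prod_i f i <= \prod_i g i by [].
elim/big_rec2: _ => [|i u v _ /andP[u0 uv]]; first by rewrite lee01 lexx.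
by have /andP[f0 fi] := fg i; rewrite mule_ge0//= lee_pmul.
Qed.

Lemma pmeas_sum Q (F : 'I_Q -> V -> \bar R) : (forall q, pmeas (F q)) ->
  pmeas (fun z => \sum_(q < Q) F q z).
Proof.
move=> mF; split=> [z|d T c mc]; first by apply: sume_ge0 => q _; exact: (mF q).1.
by apply: emeasurable_sum => q; exact: (mF q).2.
Qed.

Lemma gauss_list_sum Q (js : seq gidx) (F : 'I_Q -> V -> \bar R) z : (forall q, pmeas (F q)) ->
  gauss_list js (fun z => \sum_(q < Q) F q z) z = \sum_(q < Q) gauss_list js (F q) z.
Proof.
elim: Q F => [|Q IH] F mF.
  rewrite big_ord0; elim: js z => [|j js IH] z /=; first by rewrite big_ord0.
  by apply: integral0_eq => w _; exact: IH.
under eq_fun do rewrite big_ord_recl.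
rewrite gauss_listD//; last by apply: pmeas_sum.
by rewrite big_ord_recl IH.
Qed.

Lemma gauss_list_gY_prod (c : R) (f : R -> R) (g : 'I_N -> R -> R) :
  (0 <= c)%R -> measurable_fun setT f -> (forall j, measurable_fun setT (g j)) ->
  (forall w, 0 <= f w)%R -> (forall j w, 0 <= g j w)%R ->
  let F (z : V) := (c * (\prod_(i < m) f (z (inr (inl i))) * \prod_(j < N) g j (z (inr (inr j)))))%:E in
  pmeas F /\
  gauss_list (gY m N) F (fun=> 0%R) =
  c%:E * ((\prod_(i < m) \int[gauss]_w (f w)%:E) * (\prod_(j < N) \int[gauss]_w (g j w)%:E)).
Proof.
move=> c0 mf mg f0 g0 F.
pose H (p : gidx) (w : R) : \bar R :=
  match p with inl _ => 1 | inr (inl _) => (f w)%:E | inr (inr j) => (g j w)%:E end.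
have mH p : measurable_fun setT (H p).
  by case: p => [p|[i|j]] //=; apply/measurable_EFinP.
have H0 p w : 0 <= H p w by case: p => [p|[i|j]] //=; rewrite lee_fin.
have FE : F = fun z => c%:E * \prod_p H p (z p).
  apply/funext => z; rewrite /F EFinM EFinM -!prodEFin; congr (_ * _).
  by rewrite big_sumType/= [X in _ = X * _]big1// mul1e big_sumType.
have mP : pmeas (fun z => \prod_p H p (z p)).
  split=> [z|d T b mb]; first by apply: prode_ge0 => p _.
  rewrite (_ : (fun t => _) = fun t => (\prod_(i < m) f (b (inr (inl i)) t) * \prod_(j < N) g j (b (inr (inr j)) t))%:E).
    apply/measurable_EFinP; apply: measurable_funM.
      apply: measurable_prod => i _; exact: measurableT_comp.
    apply: measurable_prod => j _; exact: measurableT_comp.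
  apply/funext => t; rewrite big_sumType/= [X in X * _]big1// mul1e big_sumType/=.
  by rewrite EFinM -!prodEFin.
split; first by rewrite FE; exact: pmeasZ.
rewrite FE gauss_listZ// gauss_list_prod//; last first.
  by rewrite map_inj_uniq ?enum_uniq// => p q [].
congr (_ * _); rewrite big_sumType/= [X in X * _]big1 ?mul1e; last first.
  by move=> p _; case: ifP => // /mapP[].
rewrite big_sumType/=; congr (_ * _); apply: eq_bigr => p _.
  rewrite map_f ?mem_enum//; by apply: eq_integral => w _; rewrite add0r.
rewrite map_f ?mem_enum//; by apply: eq_integral => w _; rewrite add0r.
Qed.

Variables (d : measure_display) (T : measurableType d) (P : probability T R).
Variable a : 'I_m -> 'I_N -> T -> R.
Hypothesis iid : iid_std_gaussian P a.

(** A majorant that is a sum of products of one-variable functions has a Gaussian mean computed one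
    coordinate at a time, so no multivariate integral remains. *)
Lemma gordon_product_bound (lam delta : R) Q (c alp : 'I_Q -> R) (f : 'I_Q -> R -> R)
    (b : R) (bet : 'I_N -> R) (g : 'I_N -> R -> R) :
  (0 < lam)%R -> (0 < delta)%R ->
  (forall q, 0 <= c q)%R -> (0 <= b)%R ->
  (forall q, measurable_fun setT (f q)) -> (forall j, measurable_fun setT (g j)) ->
  (forall q w, 0 <= f q w)%R -> (forall j w, 0 <= g j w)%R ->
  (forall q, \int[gauss]_w (f q w)%:E <= (alp q)%:E) ->
  (forall j, \int[gauss]_w (g j w)%:E <= (bet j)%:E) ->
  (forall u : 'I_m -> R, expR (- lam * Num.sqrt (\sum_i u i ^+ 2)) <=
     \sum_(q < Q) c q * \prod_i f q (u i))%R ->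
  (forall h k, expR (lam * \sum_j h j * x k j) <= b * \prod_j g j (h j))%R ->
  (expR (lam ^+ 2 / 2 - lam * delta))%:E *
    P [set w | exists k, (\sum_i (\sum_j a i j w * x k j) ^+ 2 < delta ^+ 2)%R] <=
  (b * (\sum_(q < Q) c q * alp q ^+ m) * \prod_j bet j)%:E.
Proof.
move=> lam0 delta0 c0 b0 mf mg f0 g0 fa gb hf hg.
pose F q (z : V) := (c q * b * (\prod_(i < m) f q (z (inr (inl i))) * \prod_(j < N) g j (z (inr (inr j)))))%:E.
have FP q := gauss_list_gY_prod (mulr_ge0 (c0 q) b0) (mf q) mg (f0 q) g0.
have mF q : pmeas (F q) by case: (FP q).
apply: (le_trans (gordon_prob x1 lam0 (pmeas_sum mF) _ iid delta0)).
  move=> z k; rewrite sumEFin lee_fin mulrBr expRD -mulNr.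
  have h1 := hg (fun j => z (inr (inr j))) k; have h2 := hf (fun i => z (inr (inl i))).
  apply: le_trans (ler_pM (expR_ge0 _) (expR_ge0 _) h1 h2) _.
  rewrite mulr_sumr; apply: ler_sum => q _.
  by rewrite le_eqVlt; apply/orP; left; apply/eqP; ring.
rewrite gauss_list_sum//.
have -> : (b * (\sum_(q < Q) c q * alp q ^+ m) * \prod_j bet j)%R =
   (\sum_(q < Q) c q * b * (alp q ^+ m * \prod_j bet j))%R.
  by rewrite mulr_sumr mulr_suml; apply: eq_bigr => q _; ring.
rewrite -sumEFin; apply: lee_sum => q _.
rewrite (FP q).2 [leRHS]EFinM lee_wpmul2l ?lee_fin ?mulr_ge0// EFinM.
have -> : (alp q ^+ m = \prod_(i < m) alp q)%R by rewrite prodr_const card_ord.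
rewrite -!prodEFin; apply: lee_pmul.
- by apply: prode_ge0 => i _; apply: integral_ge0 => w _; rewrite lee_fin.
- by apply: prode_ge0 => i _; apply: integral_ge0 => w _; rewrite lee_fin.
- apply: lee_prod => i; rewrite fa andbT; apply: integral_ge0 => w _; by rewrite lee_fin.
- apply: lee_prod => i; rewrite gb andbT; apply: integral_ge0 => w _; by rewrite lee_fin.
Qed.

End ProductBound.

(** * Estimates for the two Gaussian factors *)

Section Estimates.
Variable R : realType.
Notation gauss := (@normal_prob R 0 1).

(** The quotient of the two sides is monotone in [u] and equals 1 at 0. *)
Lemma expR1Dx_sqr_le (u : R) : 0 <= u -> expR (u - u ^+ 2 / 2) <= 1 + u.
Proof.
move=> u0.
pose f (x : R) := (1 + x) * expR (- (x - x ^+ 2 / 2)).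
have df (x : R) : is_derive x (1 : R) f (x ^+ 2 * expR (- (x - x ^+ 2 / 2))).
  by apply: is_derive_eq; rewrite /GRing.scale/=; field.
have := is_derive_le df u0; rewrite /f expr0n/= !mul0r subr0 oppr0 expR0 addr0 mulr1.
have nn y : 0 <= y <= u -> 0 <= y ^+ 2 * expR (- (y - y ^+ 2 / 2)).
  by move=> _; rewrite mulr_ge0 ?sqr_ge0 ?expR_ge0.
move=> /(_ nn).
by rewrite expRN ler_pdivlMr ?expR_gt0// mul1r.
Qed.

(** Replaces a scalar product by a sum of squares, which separates the coordinates of [h]; the
    weight [s] is tuned by each application. *)
Lemma weighted_am_gm (lam s p y : R) : 0 < lam -> 0 < s ->
  lam * (p * y) <= lam / (2 * s) * p ^+ 2 + lam * s / 2 * y ^+ 2.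
Proof.
move=> l0 s0; rewrite -subr_ge0.
have -> : lam / (2 * s) * p ^+ 2 + lam * s / 2 * y ^+ 2 - lam * (p * y) =
  lam / (2 * s) * (p - s * y) ^+ 2 by field; rewrite gt_eqF.
by rewrite mulr_ge0 ?sqr_ge0// divr_ge0 ?ltW// mulr_gt0.
Qed.

(** The 20th power of [expR (3 / 40)], which is at most [40 / 37] by [1 - x <= expR (- x)]. *)
Lemma expR_3half_le : expR (3 / 2 : R) <= 5.
Proof.
have h : 1 - 3 / 40 <= expR (- (3 / 40)) :> R by exact: expR_ge1Dx.
have {}h : expR (3 / 40) <= 40 / 37 :> R.
  rewrite -[expR _]invrK -expRN -[leRHS]invrK lef_pV2 ?posrE ?invr_gt0 ?expR_gt0//; last lra.
have -> : 3 / 2 = 5%:R * (4%:R * (3 / 40)) :> R by field.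
rewrite expRM_natl expRM_natl.
have h4 : expR (3 / 40) ^+ 4 <= 137 / 100 :> R.
  apply: (@le_trans _ _ ((40 / 37) ^+ 4)); first by rewrite lerXn2r ?nnegrE ?expR_ge0//; lra.
  by rewrite !exprS expr0; lra.
apply: (@le_trans _ _ ((137 / 100) ^+ 5)); last by rewrite !exprS expr0; lra.
by rewrite lerXn2r ?nnegrE ?exprn_ge0 ?expR_ge0//; lra.
Qed.

(* The three terms dominate for [rho <= r], [3 / 7 * rho <= r <= rho] and [r <= 3 / 7 * rho]. *)
Lemma expRN_le_gauss (lam rho r : R) : 0 < lam -> 0 < rho -> 0 <= r ->
  expR (- lam * r) <= expR (- lam * rho)
    + expR (- lam * rho + 7 * lam / (10 * rho) * (rho ^+ 2 - r ^+ 2))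
    + expR (2 * (9 / 49 * rho ^+ 2 - r ^+ 2)).
Proof.
move=> l0 rho0 r0.
have e1 := expR_ge0 (- lam * rho).
have e2 := expR_ge0 (- lam * rho + 7 * lam / (10 * rho) * (rho ^+ 2 - r ^+ 2)).
have e3 := expR_ge0 (2 * (9 / 49 * rho ^+ 2 - r ^+ 2)).
have [rr|rr] := leP rho r.
  have : expR (- lam * r) <= expR (- lam * rho) by rewrite ler_expR; nra.
  by move=> h; rewrite -addrA (le_trans h)// lerDl addr_ge0.
have [rs|rs] := leP (3 / 7 * rho) r.
  suff h : expR (- lam * r) <= expR (- lam * rho + 7 * lam / (10 * rho) * (rho ^+ 2 - r ^+ 2)).
    by rewrite (le_trans h)// addrAC lerDr addr_ge0.
  rewrite ler_expR.
  have -> : 7 * lam / (10 * rho) * (rho ^+ 2 - r ^+ 2) = lam * ((7 * (rho - r) * (rho + r)) / (10 * rho)).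
    by field; rewrite gt_eqF.
  suff : rho - r <= (7 * (rho - r) * (rho + r)) / (10 * rho) by move=> h; have := ler_wpM2l (ltW l0) h; lra.
  by rewrite ler_pdivlMr; nra.
suff h : expR (- lam * r) <= expR (2 * (9 / 49 * rho ^+ 2 - r ^+ 2)).
  by rewrite (le_trans h)// lerDr addr_ge0.
rewrite ler_expR; apply: (@le_trans _ _ 0); first by rewrite mulNr oppr_le0 mulr_ge0// ltW.
by nra.
Qed.

Lemma integral_gauss_dist_sq (l t : R) (b : bool) : 0 < l < 1 / 2 ->
  (\int[gauss]_w (expR (l * (Num.max (if b then t - w else w - t) 0) ^+ 2))%:E
   <= (expR (l / (1 - 2 * l) * (if b then sqmean t else sqmean (- t))))%:E)%E.
Proof.
move=> l01; case: b; last exact: integral_gauss_expR_sq.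
apply: le_trans (integral_gauss_expR_sq l01 t).
rewrite -(integral_gauss_opp (k := fun w => expR (l * Num.max (w + t) 0 ^+ 2))).
- by rewrite le_eqVlt; apply/orP; left; apply/eqP; apply: eq_integral => w _; rewrite addrC.
- move=> w; apply: continuous_comp; last exact: continuous_expR.
  apply: cvgM; first exact: cvg_cst.
  rewrite /continuous_at; apply: (@continuous_comp _ _ _ (fun w => Num.max (w + t) 0) (fun w => w ^+ 2)).
    apply: continuous_max; last exact: cvg_cst.
    by apply: cvgD; [exact: cvg_id|exact: cvg_cst].
  exact: exprn_continuous.
- by move=> w; exact: expR_ge0.
Qed.

(** The Euclidean norm dominates the average of the [|u i|]; crude, but it separates the
    coordinates. *)
Lemma expRN_norm2_le m (lam : R) (u : 'I_m -> R) : 0 < lam -> 0 < m%:R :> R ->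
  expR (- lam * Num.sqrt (\sum_i u i ^+ 2)) <= \prod_i expR (- (lam / m%:R) * `|u i|).
Proof.
move=> lam0 m0; rewrite -expR_sum -mulr_sumr ler_expR !mulNr lerN2 -mulrA ler_pM2l//.
rewrite mulrC ler_pdivrMr// mulr_natr.
rewrite (_ : _ *+ m = \sum_(i < m) Num.sqrt (\sum_i u i ^+ 2)); last by rewrite sumr_const card_ord.
apply: ler_sum => i _; rewrite -sqrtr_sqr ler_wsqrtr// (bigD1 i)//= lerDl sumr_ge0// => i' _.
exact: sqr_ge0.
Qed.

End Estimates.

(** * Probability bounds for finite families of unit vectors *)

Section FamilyBounds.
Variables (R : realType) (m N n : nat).
Variable x : 'I_n.+1 -> 'I_N -> R.
Hypothesis x1 : forall k, \sum_j x k j ^+ 2 = 1.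
Notation gauss := (@normal_prob R 0 1).
Variables (d : measure_display) (T : measurableType d) (P : probability T R).
Variable a : 'I_m -> 'I_N -> T -> R.
Hypothesis iid : iid_std_gaussian P a.

Let bad delta := [set w | exists k, \sum_i (\sum_j a i j w * x k j) ^+ 2 < delta ^+ 2].

Let cancel_expR (u v w : R) (p : \bar R) :
  ((expR (u + v))%:E * p <= (expR u * w)%:E -> (expR v)%:E * p <= w%:E)%E.
Proof.
rewrite expRD !EFinM -muleA; case: p => [p||].
- by rewrite -!EFinM !lee_fin ler_pM2l// expR_gt0.
- by rewrite !gt0_muley ?lte_fin ?expR_gt0.
- by rewrite !gt0_muleNy ?lte_fin ?expR_gt0// !leNye.
Qed.

Lemma cone_family_bound (K : {set 'I_N}) (tau D delta lam : R) :
  (forall k j, if j \in K then x k j <= 0 else 0 <= x k j) ->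
  (forall k, \sum_j x k j <= 0) ->
  0 <= tau -> 0 < D -> D < m%:R ->
  #|K|%:R * sqmean tau + (N - #|K|)%:R * sqmean (- tau) <= D ->
  0 < delta ->
  lam = Num.sqrt m%:R - Num.sqrt D ->
  ((expR (- lam * delta))%:E * P (bad delta) <=
   (2 * expR (- lam ^+ 2 / 2) + expR (- m%:R / 8))%:E)%E.
Proof.
move=> xK xs t0 D0 Dm hD delta0.
set sD := Num.sqrt D; set rho := Num.sqrt m%:R => lamE.
have sD0 : 0 < sD by rewrite sqrtr_gt0.
have sD2 : sD ^+ 2 = D by rewrite sqr_sqrtr// ltW.
have rho2 : rho ^+ 2 = m%:R by rewrite sqr_sqrtr.
have lam0 : 0 < lam by rewrite lamE subr_gt0 ltr_sqrt// (lt_trans D0).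
have rho0 : 0 < rho by rewrite sqrtr_gt0 (lt_trans D0).
(* Minimizes the total exponent [lam * s / 2 + lam * D / (2 * (s - lam))], whose value is then
   [lam * sD + lam ^+ 2 / 2]. *)
pose s := sD + lam.
have s0 : 0 < s by rewrite addr_gt0.
pose l := lam / (2 * s).
have l01 : 0 < l < 1 / 2.
  rewrite divr_gt0 ?mulr_gt0//= ltr_pdivrMr ?mulr_gt0// /s; lra.
(* The ratio [7 / 10] lies just below [1 / sqrt 2], so that [kap ^+ 2 * rho ^+ 2 <= lam ^+ 2 / 2].
   It also fixes the radius [3 / 7 * rho], since [10 / 7 - 1 = 3 / 7]. *)
pose kap := 7 * lam / (10 * rho).
have kap0 : 0 < kap by rewrite divr_gt0 ?mulr_gt0.
pose ks := [:: 0; kap; 2]; pose cs := [:: expR (- lam * rho); expR (- lam * rho + kap * rho ^+ 2); expR (18 / 49 * rho ^+ 2)].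
pose f (q : 'I_3) (w : R) := expR (- nth 0 ks q * w ^+ 2).
pose g (j : 'I_N) (w : R) := expR (l * (Num.max (if j \in K then tau - w else w - tau) 0) ^+ 2).
have ks0 (q : 'I_3) : 0 <= nth 0 ks q by case: q => [[|[|[|]]]]//= _; exact: ltW.
have := @gordon_product_bound R m N n x x1 d T P a iid lam delta 3 (fun q => nth 0 cs q)
  (fun q => (Num.sqrt (1 + 2 * nth 0 ks q))^-1) f (expR (lam * s / 2))
  (fun j => expR (l / (1 - 2 * l) * (if j \in K then sqmean tau else sqmean (- tau)))) g
  lam0 delta0.
set LHS := (_ * P _)%E; set RHS := (X in (_ <= X%:E)%E).
move=> main.
have {}main : (LHS <= RHS%:E)%E.
  apply: main.
  - by case=> [[|[|[|]]]]//= _; exact: expR_ge0.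
  - exact: expR_ge0.
  - move=> q; apply: measurableT_comp => //; apply: measurable_funM => //; exact: measurable_funX.
  - move=> j; apply: measurableT_comp => //; apply: measurable_funM => //; apply: measurable_funX.
    by apply: measurable_maxr => //; case: (j \in K); apply: measurable_funB.
  - by move=> q w; exact: expR_ge0.
  - by move=> j w; exact: expR_ge0.
  - by move=> q; rewrite integral_gauss_expRN2// ltr_wpDr// mulr_ge0.
  - by move=> j; exact: integral_gauss_dist_sq.
  - move=> u; set r := Num.sqrt _.
    have r2 : \sum_i u i ^+ 2 = r ^+ 2 by rewrite sqr_sqrtr// sumr_ge0// => i _; exact: sqr_ge0.
    have fE q : \prod_i f q (u i) = expR (- nth 0 ks q * r ^+ 2).
      by rewrite -expR_sum -mulr_sumr r2.
    rewrite !big_ord_recl big_ord0 !fE /= addr0 !addrA.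
    apply: le_trans (expRN_le_gauss lam0 rho0 (sqrtr_ge0 _)) _.
    rewrite -!expRD -/kap -/r oppr0 mul0r addr0.
    by rewrite le_eqVlt; apply/orP; left; apply/eqP; congr (_ + expR _ + expR _); field.
  - move=> h k; rewrite -expR_sum -expRD ler_expR.
    have -> : lam * s / 2 = \sum_j lam * s / 2 * x k j ^+ 2 by rewrite -mulr_sumr x1 mulr1.
    rewrite -big_split/= -subr_ge0.
    (* As [tau >= 0] and the entries of [x k] have a nonpositive sum, [h] may be replaced by
       [h - tau]. *)
    apply: (@le_trans _ _ (- (lam * tau * \sum_j x k j))).
      by rewrite oppr_ge0 mulr_ge0_le0// mulr_ge0// ltW.
    rewrite !mulr_sumr -sumrN -sumrB; apply: ler_sum => j _.
    set p := Num.max _ 0.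
    have := weighted_am_gm p `|x k j| lam0 s0; rewrite real_normK ?num_real// -/l.
    suff : (h j - tau) * x k j <= p * `|x k j| by move=> /(ler_wpM2l (ltW lam0)); lra.
    have := xK k j; rewrite /p; case: (j \in K) => xj.
      rewrite ler0_norm// -mulrNN; apply: ler_wpM2r; first by rewrite oppr_ge0.
      by rewrite opprB le_max lexx.
    by rewrite ger0_norm//; apply: ler_wpM2r => //; rewrite le_max lexx.
have RHSE : RHS <= expR (lam ^+ 2 / 2) * (2 * expR (- lam ^+ 2 / 2) + expR (- m%:R / 8)).
  have sumK : \sum_j (if j \in K then sqmean tau else sqmean (- tau)) <= D.
    rewrite (bigID (mem K))/=; apply: le_trans hD; rewrite le_eqVlt; apply/orP; left; apply/eqP.
    congr (_ + _).
      rewrite (eq_bigr (fun=> sqmean tau)); first by rewrite sumr_const mulr_natl.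
      by move=> j ->.
    rewrite (eq_bigr (fun=> sqmean (- tau))); last by move=> j /negPf ->.
    rewrite sumr_const mulr_natl; congr (_ *+ _).
    by have := cardC (mem K); rewrite card_ord => /(congr1 (subn^~ #|K|)) <-; rewrite addKn.
  have lE : l / (1 - 2 * l) = lam / (2 * sD).
    rewrite /l /s; field; rewrite !gt_eqF//=; rewrite /s in s0; lra.
  have prodE : \prod_j expR (l / (1 - 2 * l) * (if j \in K then sqmean tau else sqmean (- tau))) <= expR (lam * sD / 2).
    rewrite -expR_sum -mulr_sumr lE ler_expR.
    have -> : lam * sD / 2 = lam / (2 * sD) * D by rewrite -sD2; field; rewrite gt_eqF.
    by apply: ler_wpM2l => //; rewrite divr_ge0 ?mulr_ge0 ?ltW.
  (* With [sqrt (1 + 2 * kap) >= expR (kap - kap ^+ 2)] and [m = rho ^+ 2] the linear terms in [kap]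
     cancel, and [expR (49 / 100 * lam ^+ 2)] remains. *)
  have a1 : expR (kap * rho ^+ 2) * (Num.sqrt (1 + 2 * kap))^-1 ^+ m <= expR (lam ^+ 2 / 2).
    have sk0 : 0 < Num.sqrt (1 + 2 * kap) by rewrite sqrtr_gt0; lra.
    have h : expR (kap - kap ^+ 2) <= Num.sqrt (1 + 2 * kap).
      rewrite -[leLHS]ger0_norm ?expR_ge0// -sqrtr_sqr ler_wsqrtr// -expRM_natl.
      have := expR1Dx_sqr_le (mulr_ge0 (ler0n R 2) (ltW kap0)).
      by apply: le_trans; rewrite ler_expR; lra.
    rewrite exprVn ler_pdivrMr ?exprn_gt0//.
    apply: (@le_trans _ _ (expR (lam ^+ 2 / 2) * expR (kap - kap ^+ 2) ^+ m)); last first.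
      by rewrite ler_pM2l ?expR_gt0// lerXn2r ?nnegrE ?expR_ge0 ?sqrtr_ge0.
    rewrite -expRM_natl -expRD ler_expR -rho2.
    have kE : kap ^+ 2 * rho ^+ 2 = 49 / 100 * lam ^+ 2 by rewrite /kap; field; rewrite gt_eqF.
    by have := sqr_ge0 lam; lra.
  (* Here [18 / 49 + 3 / 8 < 3 / 4], and [expR (3 / 4) <= sqrt 5]. *)
  have a2 : expR (18 / 49 * rho ^+ 2) * (Num.sqrt (1 + 2 * 2))^-1 ^+ m <= expR (- 3 / 8 * m%:R).
    have s5 : 0 < Num.sqrt (1 + 2 * 2) :> R by rewrite sqrtr_gt0.
    have h : expR (3 / 4) <= Num.sqrt (1 + 2 * 2) :> R.
      rewrite -[leLHS]ger0_norm ?expR_ge0// -sqrtr_sqr ler_wsqrtr// -expRM_natl.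
      by have := expR_3half_le R; rewrite (_ : 2 * (3 / 4) = 3 / 2 :> R); [lra|field].
    rewrite exprVn ler_pdivrMr ?exprn_gt0//.
    apply: (@le_trans _ _ (expR (- 3 / 8 * m%:R) * expR (3 / 4) ^+ m)); last first.
      by rewrite ler_pM2l ?expR_gt0// lerXn2r ?nnegrE ?expR_ge0 ?sqrtr_ge0.
    rewrite -expRM_natl -expRD ler_expR rho2.
    by have := ler0n R m; lra.
  have sumE : \sum_(q < 3) cs`_q * (Num.sqrt (1 + 2 * ks`_q))^-1 ^+ m <=
      expR (- lam * rho) + expR (- lam * rho) * expR (lam ^+ 2 / 2) + expR (- 3 / 8 * m%:R).
    rewrite !big_ord_recl big_ord0/= addr0 !addrA mulr0 addr0 sqrtr1 invr1 expr1n mulr1.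
    apply: lerD; last exact: a2.
    by rewrite lerD2l expRD -mulrA ler_pM2l ?expR_gt0.
  apply: (@le_trans _ _ (expR (lam * s / 2) * (expR (- lam * rho) + expR (- lam * rho) * expR (lam ^+ 2 / 2)
      + expR (- 3 / 8 * m%:R)) * expR (lam * sD / 2))).
    apply: ler_pM => //.
    - rewrite mulr_ge0 ?expR_ge0// sumr_ge0// => q _; rewrite mulr_ge0 ?exprn_ge0 ?invr_ge0 ?sqrtr_ge0//.
      by case: q => [[|[|[|]]]]//= _; exact: expR_ge0.
    - by apply: prodr_ge0 => j _; exact: expR_ge0.
    - by rewrite ler_pM2l ?expR_gt0.
  have -> : expR (lam * s / 2) * (expR (- lam * rho) + expR (- lam * rho) * expR (lam ^+ 2 / 2)
      + expR (- 3 / 8 * m%:R)) * expR (lam * sD / 2) =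
    expR (lam ^+ 2 / 2) * (expR (- lam ^+ 2) + expR (- lam ^+ 2 / 2) + expR (lam * sD - 3 / 8 * m%:R)).
    rewrite !mulrDr !mulrDl -!expRD /s lamE.
    by congr (expR _ + expR _ + expR _); field.
  rewrite ler_pM2l ?expR_gt0// [2 * expR _]mulr_natl [expR _ *+ 2]mulr2n; apply: lerD; [apply: lerD => //|]; rewrite ler_expR.
    by have := sqr_ge0 lam; lra.
  (* This square gives [lam * sD <= m / 4], so [3 / 8] drops to [1 / 8]. *)
  have := sqr_ge0 (rho - 2 * sD); rewrite lamE -rho2; nra.
apply: (@cancel_expR (lam ^+ 2 / 2)); rewrite [_ + _](_ : _ = lam ^+ 2 / 2 - lam * delta); last by rewrite mulNr.
by apply: (le_trans main); rewrite lee_fin.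
Qed.

(** Only [<h, x> <= |h|] is used. After [expR (lam ^+ 2 / 2)] cancels, [h] costs a factor of order
    [lam ^+ N] and [g] gains [lam ^- m], so [N < m] leaves at least one factor [lam^-1]. *)
Lemma wide_family_bound (lam delta : R) : (N < m)%N -> 1 <= lam -> 0 < delta ->
  ((expR (- lam * delta))%:E * P (bad delta) <=
   (expR (1 / 2) * Num.sqrt 2 ^+ N * m%:R ^+ m / lam)%:E)%E.
Proof.
move=> Nm lam1 delta0.
have lam0 : 0 < lam by lra.
have m0 : 0 < m%:R :> R by rewrite ltr0n (leq_trans _ Nm).
(* Makes [1 - 2 * l] equal to [(1 + lam ^+ 2)^-1] and [lam * s / 2] equal to
   [lam ^+ 2 / 2 + 1 / 2]. *)
pose s := lam + lam^-1.
have s0 : 0 < s by rewrite addr_gt0 ?invr_gt0.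
pose l := lam / (2 * s).
have l0 : 0 < l by rewrite divr_gt0 ?mulr_gt0.
have lE : 1 + 2 * - l = (1 + lam ^+ 2)^-1.
  by rewrite /l /s; field; rewrite !gt_eqF//=; have := sqr_ge0 lam; lra.
have lam2 : 0 < 1 + lam ^+ 2 by have := sqr_ge0 lam; lra.
have := @gordon_product_bound R m N n x x1 d T P a iid lam delta 1 (fun=> 1)
  (fun q => (lam / m%:R)^-1) (fun q w => expR (- (lam / m%:R) * `|w|)) (expR (lam * s / 2))
  (fun j => Num.sqrt (1 + lam ^+ 2)) (fun j w => expR (l * w ^+ 2))
  lam0 delta0.
set LHS := (_ * P _)%E => main.
pose RHS : R := expR (lam * s / 2) * (\sum_(q < 1) 1 * (lam / m%:R)^-1 ^+ m) *
  \prod_(j < N) Num.sqrt (1 + lam ^+ 2).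
have {}main : (LHS <= RHS%:E)%E.
  apply: main => //.
  - by move=> q; apply: measurableT_comp => //; apply: measurable_funM => //; exact: measurableT_comp.
  - by move=> j; apply: measurableT_comp => //; apply: measurable_funM => //; exact: measurable_funX.
  - by move=> q; apply: integral_gauss_expRN_abs; rewrite divr_gt0.
  - move=> j; under eq_integral do rewrite -[l]opprK.
    rewrite integral_gauss_expRN2 lE ?invr_gt0//.
    by rewrite sqrtrV ?invrK// ltW.
  - by move=> u; rewrite big_ord1 mul1r; exact: expRN_norm2_le.
  - move=> h k; rewrite -expR_sum -expRD ler_expR.
    have -> : lam * s / 2 = \sum_j lam * s / 2 * x k j ^+ 2 by rewrite -mulr_sumr x1 mulr1.
    rewrite -big_split/= mulr_sumr; apply: ler_sum => j _.
    by rewrite addrC; exact: weighted_am_gm.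
have RHSE : RHS <= expR (lam ^+ 2 / 2) * (expR (1 / 2) * Num.sqrt 2 ^+ N * m%:R ^+ m / lam).
  rewrite /RHS big_ord1 mul1r prodr_const card_ord invf_div.
  have -> : lam * s / 2 = lam ^+ 2 / 2 + 1 / 2 by rewrite /s; field; rewrite gt_eqF.
  rewrite expRD -!mulrA ler_pM2l ?expR_gt0// ler_pM2l ?expR_gt0//.
  rewrite mulrC expr_div_n.
  apply: (@le_trans _ _ ((Num.sqrt 2 * lam) ^+ N * (m%:R ^+ m / lam ^+ m))).
    apply: ler_wpM2r; first by rewrite divr_ge0 ?exprn_ge0// ltW.
    rewrite lerXn2r ?nnegrE ?sqrtr_ge0 ?mulr_ge0 ?sqrtr_ge0 ?(ltW lam0)//.
    rewrite -{2}(ger0_norm (ltW lam0)) -sqrtr_sqr -sqrtrM// ler_wsqrtr//.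
    have : 1 <= lam ^+ 2 by rewrite exprn_ege1.
    lra.
  rewrite exprMn -mulrA ler_pM2l ?exprn_gt0 ?sqrtr_gt0//.
  rewrite mulrCA ler_pM2l ?exprn_gt0// ler_pdivrMr ?exprn_gt0// mulrC ler_pdivlMr//.
  by rewrite -exprSr ler_weXn2l.
apply: (@cancel_expR (lam ^+ 2 / 2)); rewrite [_ + _](_ : _ = lam ^+ 2 / 2 - lam * delta); last by rewrite mulNr.
by apply: (le_trans main); rewrite lee_fin.
Qed.

(** For a constant family [<h, x>] is a standard Gaussian, whose exponential moment
    [expR (lam ^+ 2 / 2)] cancels exactly. *)
Lemma point_family_bound (lam delta : R) : (forall k, x k = x ord0) -> 0 < lam -> 0 < delta -> (0 < m)%N ->
  ((expR (- lam * delta))%:E * P (bad delta) <= ((m%:R / lam) ^+ m)%:E)%E.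
Proof.
move=> xx lam0 delta0 m_gt0.
have m0 : 0 < m%:R :> R by rewrite ltr0n.
have := @gordon_product_bound R m N n x x1 d T P a iid lam delta 1 (fun=> 1)
  (fun q => (lam / m%:R)^-1) (fun q w => expR (- (lam / m%:R) * `|w|)) 1
  (fun j => expR ((lam * x ord0 j) ^+ 2 / 2)) (fun j w => expR (lam * x ord0 j * w))
  lam0 delta0.
set LHS := (_ * P _)%E => main.
pose RHS : R := 1 * (\sum_(q < 1) 1 * (lam / m%:R)^-1 ^+ m) *
  \prod_(j < N) expR ((lam * x ord0 j) ^+ 2 / 2).
have {}main : (LHS <= RHS%:E)%E.
  apply: main => //.
  - by move=> q; apply: measurableT_comp => //; apply: measurable_funM => //; exact: measurableT_comp.
  - by move=> j; apply: measurableT_comp => //; exact: measurable_funM.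
  - by move=> q; apply: integral_gauss_expRN_abs; rewrite divr_gt0.
  - by move=> j; rewrite integral_gauss_expR.
  - by move=> u; rewrite big_ord1 mul1r; exact: expRN_norm2_le.
  - move=> h k; rewrite -expR_sum mul1r ler_expR xx mulr_sumr le_eqVlt; apply/orP; left; apply/eqP.
    by apply: eq_bigr => j _; ring.
have RHSE : RHS = expR (lam ^+ 2 / 2) * (m%:R / lam) ^+ m.
  rewrite /RHS big_ord1 !mul1r invf_div -expR_sum mulrC; congr (expR _ * _).
  rewrite -mulr_suml; congr (_ / _).
  by under eq_bigr do rewrite exprMn; rewrite -mulr_sumr x1 mulr1.
apply: (@cancel_expR (lam ^+ 2 / 2)); rewrite [_ + _](_ : _ = lam ^+ 2 / 2 - lam * delta); last by rewrite mulNr.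
by apply: (le_trans main); rewrite lee_fin RHSE.
Qed.

End FamilyBounds.

(** * The kernel avoids the cone *)

Section Events.
Variables (R : realType) (m N : nat).
Variables (d : measure_display) (T : measurableType d) (P : probability T R).
Variable a : 'I_m -> 'I_N -> T -> R.
Hypothesis ma : forall i j, measurable_fun setT (a i j).

Lemma measurable_image_lt (x : 'I_N -> R) (b : R) :
  measurable [set w | \sum_i (\sum_j a i j w * x j) ^+ 2 < b].
Proof.
rewrite -[X in measurable X]setTI; apply: measurable_fun_ltr => //.
apply: measurable_sum => i; apply: measurable_funX; apply: measurable_sum => j.
exact: measurable_funM.
Qed.

Lemma measurable_exists_image_lt n (x : 'I_n.+1 -> 'I_N -> R) (b : R) :
  measurable [set w | exists k, \sum_i (\sum_j a i j w * x k j) ^+ 2 < b].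
Proof.
rewrite (_ : mkset _ = \bigcup_(k in [set: 'I_n.+1])
   [set w | \sum_i (\sum_j a i j w * x k j) ^+ 2 < b]); last first.
  by apply/seteqP; split=> w /= [k] => [h|_ h]; exists k.
by apply: fin_bigcup_measurable => // k _; exact: measurable_image_lt.
Qed.

Variables (C : ('I_N -> R) -> Prop) (q : nat -> 'I_N -> R) (lam Q : R).
Hypothesis CZ : forall t c, C t -> 0 < c -> C (fun j => c * t j).
Hypothesis q_dense : forall t, C t -> forall e, 0 < e ->
  exists k, C (q k) /\ forall j, `|q k j - t j| <= e.
Hypothesis Q0 : 0 <= Q.
Hypothesis PQ : forall n (x : 'I_n.+1 -> 'I_N -> R),
  (forall k, \sum_j x k j ^+ 2 = 1) -> (forall k, C (x k)) -> forall delta, 0 < delta ->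
  ((expR (- lam * delta))%:E *
    P [set w | exists k, (\sum_i (\sum_j a i j w * x k j) ^+ 2 < delta ^+ 2)%R] <= Q%:E)%E.

Let nq k := \sum_j q k j ^+ 2.
Let u k j := (Num.sqrt (nq k))^-1 * q k j.
Let good k := C (q k) /\ 0 < nq k.
Let F delta k := [set w | good k /\ \sum_i (\sum_j a i j w * u k j) ^+ 2 < delta ^+ 2].
Let bad delta := \bigcup_k F delta k.

Let mF delta k : measurable (F delta k).
Proof.
have [g|g] := pselect (good k); last first.
  by rewrite (_ : F _ _ = set0)//; apply/seteqP; split=> w //= -[].
rewrite (_ : F _ _ = [set w | \sum_i (\sum_j a i j w * u k j) ^+ 2 < delta ^+ 2]); last first.
  by apply/seteqP; split=> w //= -[].
exact: measurable_image_lt.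
Qed.

Let mbad delta : measurable (bad delta).
Proof. exact: bigcup_measurable. Qed.

Let u_unit k : good k -> \sum_j u k j ^+ 2 = 1.
Proof.
move=> [_ n0]; under eq_bigr do rewrite exprMn.
by rewrite -mulr_sumr exprVn sqr_sqrtr ?ltW// mulVf// gt_eqF.
Qed.

Let uC k : good k -> C (u k).
Proof. by move=> [Ck n0]; apply: CZ => //; rewrite invr_gt0 sqrtr_gt0. Qed.

Let G delta n := \bigcup_(k < n.+1) F delta k.

Let mG delta n : measurable (G delta n).
Proof. by apply: bigcup_measurable. Qed.

Let PG delta n : 0 < delta -> (P (G delta n) <= (Q * expR (lam * delta))%:E)%E.
Proof.
move=> delta0; have e0 : 0 <= Q * expR (lam * delta) by rewrite mulr_ge0 ?expR_ge0.
have [[k0 g0]|ng] := pselect (exists k, good k); last first.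
  rewrite (_ : G _ _ = set0) ?measure0 ?lee_fin//.
  by apply/seteqP; split=> w //= [k _ [g _]]; apply: ng; exists k.
(* Indices that are not good are sent to one good index [k0], so that the whole family consists of
   unit vectors of [C]. *)
pose c (k : 'I_n.+1) := if pselect (good k) then nat_of_ord k else k0.
have gc k : good (c k) by rewrite /c; case: pselect.
have := PQ (fun k => u_unit (gc k)) (fun k => uC (gc k)) delta0.
set B := [set w | _].
have GB : G delta n `<=` B.
  move=> w [k /= kn [g h]]; exists (Ordinal kn).
  by rewrite /c; case: pselect.
have PGB : (P (G delta n) <= P B)%E.
  by apply: le_measure => //; rewrite inE//; exact: measurable_exists_image_lt.
move=> h; apply: (le_trans PGB).
rewrite mulNr expRN in h; rewrite EFinM.
have {h} := lee_wpmul2r (_ : 0 <= (expR (lam * delta))%:E)%E h.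
rewrite lee_fin expR_ge0 => /(_ isT); apply: le_trans.
by rewrite muleAC -EFinM mulVf ?mul1e// gt_eqF// expR_gt0.
Qed.

Let Pbad delta : 0 < delta -> (P (bad delta) <= (Q * expR (lam * delta))%:E)%E.
Proof.
move=> delta0.
have badE : bad delta = \bigcup_n G delta n.
  apply/seteqP; split=> w [k _ h]; first by exists k => //; exists k => //=.
  by case: h => k' _ h; exists k'.
have hcvg : (P \o G delta) x @[x --> \oo] --> P (bad delta).
  rewrite badE; apply: nondecreasing_cvg_mu; first exact: mG.
    by rewrite -badE; exact: mbad.
  by move=> n n' nn'; rewrite subsetEset => w [k /= kn h]; exists k => //=; exact: leq_trans kn _.
rewrite -(cvg_lim _ hcvg)//; apply: lime_le; first by apply/cvg_ex; eexists; exact: hcvg.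
by near=> n; exact: PG.
Unshelve. all: by end_near. Qed.

Let delta_ n : R := n.+1%:R^-1.

(** A kernel vector in [C] is approximated by dense points of norm bounded below and arbitrarily
    small image, which places [w] in every [bad delta]. Since [Q] depends neither on the size of the
    family nor on [delta], the bound survives the union over families and the limit [delta] to 0. *)
Lemma cone_event : exists B : set T, [/\ measurable B, (P B <= Q%:E)%E &
  forall w, ~ B w -> forall t, C t -> (exists j, t j != 0) -> exists i, \sum_j a i j w * t j != 0].
Proof.
have delta0 n : 0 < delta_ n by rewrite invr_gt0.
exists (\bigcap_n bad (delta_ n)); split.
- exact: bigcap_measurable.
- apply/lee_addgt0Pr => e e0.
  have e1 : 0 < e / (Q + 1) by rewrite divr_gt0// ltr_wpDl.
  pose l := ln (1 + e / (Q + 1)).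
  have l0 : 0 < l by rewrite ln_gt0// ltrDl.
  pose n := Num.truncn (lam / l).
  have nl : lam * delta_ n <= l.
    by rewrite ler_pdivrMr// mulrC -ler_pdivrMr// ltW// truncnS_gt.
  have Bn : (P (\bigcap_n bad (delta_ n)) <= P (bad (delta_ n)))%E.
    apply: le_measure; rewrite ?inE//; first exact: bigcap_measurable.
    exact: bigcap_inf.
  apply: (le_trans Bn); apply: (le_trans (Pbad (delta0 n))).
  rewrite -EFinD lee_fin; apply: (@le_trans _ _ (Q * (1 + e / (Q + 1)))).
    by rewrite ler_wpM2l// -[leRHS]lnK ?posrE ?addr_gt0// ler_expR.
  rewrite mulrDr mulr1 lerD2l mulrA ler_pdivrMr ?ltr_wpDl// mulrDr mulr1 mulrC lerDl; exact: ltW.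
move=> w nB t Ct [j0 tj0]; apply: contrapT => ni; apply: nB => n _.
have At i : \sum_j a i j w * t j = 0.
  by apply/eqP/negP => /negP h; apply: ni; exists i.
pose A : R := \sum_i \sum_j `|a i j w|.
have A0 : 0 <= A by apply: sumr_ge0 => i _; apply: sumr_ge0.
(* Lower bound for the norm of the approximating point. With [M] and [e] as below, the squared
   length of its image is at most [m * (A * e) ^+ 2 < (M * e) ^+ 2 <= (delta_ n * c) ^+ 2]. *)
pose c := `|t j0| / 2.
have c0 : 0 < c by rewrite divr_gt0// normr_gt0.
pose M : R := (A + 1) * (m%:R + 1).
have m0 : 0 <= m%:R :> R by [].
have M0 : 0 < M by apply: mulr_gt0; lra.
pose e := Num.min c (delta_ n * c / M).
have e0 : 0 < e by rewrite lt_min c0/= divr_gt0// mulr_gt0.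
have [k [Ck qk]] := q_dense Ct e0.
have ec : e <= c by rewrite ge_min lexx.
have eM : M * e <= delta_ n * c by rewrite mulrC -ler_pdivlMr// ge_min lexx orbT.
have cq : c ^+ 2 <= nq k.
  rewrite /nq (bigD1 j0)//= (le_trans _ (_ : q k j0 ^+ 2 <= _))//; last first.
    by rewrite lerDl sumr_ge0// => j _; exact: sqr_ge0.
  rewrite -[leRHS]real_normK ?num_real// lerXn2r ?nnegrE ?(ltW c0)//.
  have := qk j0; rewrite distrC => h.
  have := ler_normD (t j0 - q k j0) (q k j0); rewrite subrK /c in ec *; lra.
have nq0 : 0 < nq k by apply: lt_le_trans cq; rewrite exprn_gt0.
exists k => //; split=> //.
have imE i : (\sum_j a i j w * u k j) ^+ 2 = (nq k)^-1 * (\sum_j a i j w * q k j) ^+ 2.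
  have -> : \sum_j a i j w * u k j = (Num.sqrt (nq k))^-1 * \sum_j a i j w * q k j.
    by rewrite mulr_sumr; apply: eq_bigr => j _; rewrite /u; ring.
  by rewrite exprMn exprVn sqr_sqrtr// ltW.
under eq_bigr do rewrite imE.
rewrite -mulr_sumr mulrC ltr_pdivrMr//.
have im i : (\sum_j a i j w * q k j) ^+ 2 <= (A * e) ^+ 2.
  rewrite -[leLHS]real_normK ?num_real// lerXn2r ?nnegrE ?mulr_ge0 ?(ltW e0)//.
  have -> : \sum_j a i j w * q k j = \sum_j a i j w * (q k j - t j).
    by under [RHS]eq_bigr do rewrite mulrBr; rewrite sumrB At subr0.
  rewrite (le_trans (ler_norm_sum _ _ _))//.
  apply: (@le_trans _ _ (\sum_j `|a i j w| * e)).
    by apply: ler_sum => j _; rewrite normrM ler_wpM2l.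
  rewrite -mulr_suml ler_wpM2r ?(ltW e0)// /A (bigD1 i)//= lerDl sumr_ge0// => i' _.
  exact: sumr_ge0.
apply: (@le_lt_trans _ _ (m%:R * (A * e) ^+ 2)).
  rewrite (_ : m%:R * _ = \sum_(i < m) (A * e) ^+ 2); last by rewrite sumr_const card_ord mulr_natl.
  exact: ler_sum.
apply: (@lt_le_trans _ _ ((M * e) ^+ 2)).
  rewrite !exprMn mulrA ltr_pM2r ?exprn_gt0//.
  have : A ^+ 2 < (A + 1) ^+ 2 by rewrite ltr_pXn2r ?nnegrE//; lra.
  have : m%:R < (m%:R + 1) ^+ 2 :> R by nra.
  have := sqr_ge0 A; nra.
apply: (@le_trans _ _ ((delta_ n * c) ^+ 2)).
  have Me0 : 0 <= M * e by exact: (mulr_ge0 (ltW M0) (ltW e0)).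
  by rewrite lerXn2r ?nnegrE// (le_trans Me0).
by rewrite exprMn ler_pM2l ?exprn_gt0.
Qed.

End Events.

(** * Rational points of the cone and the choice of parameters *)

Section Cone.
Variables (R : realType) (m N : nat).

Definition in_cone (K : {set 'I_N}) (t : 'I_N -> R) : Prop :=
  (forall j, if j \in K then t j <= 0 else 0 <= t j) /\ \sum_j t j <= 0.

Definition ratvec (k : nat) : 'I_N -> R :=
  if @unpickle {ffun 'I_N -> rat} k is Some f then fun j => ratr (f j) else fun=> 0.

(** Rounding down preserves every constraint of the cone: nonpositive entries remain so, the sum
    does not grow, and the last clause protects the nonnegative entries. *)
Lemma rat_below (x e : R) : 0 < e ->
  exists r : rat, [/\ x - e <= ratr r, ratr r <= x & 0 <= x -> 0 <= (ratr r : R)].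
Proof.
move=> e0; have [x0|x0|<-] := ltgtP 0 x; last by exists 0; rewrite rmorph0 sub0r oppr_le0 ltW.
  have [|r] := @rat_in_itvoo R (Num.max 0 (x - e)) x; first by rewrite gt_max x0/=; lra.
  rewrite in_itv/= gt_max => /andP[/andP[r0 rx] rx']; exists r; split=> [||_]; exact: ltW.
have [|r] := @rat_in_itvoo R (x - e) x; first lra.
rewrite in_itv/= => /andP[r0 rx]; exists r; split=> [||h]; try exact: ltW; lra.
Qed.

Lemma ratvec_dense K (t : 'I_N -> R) : in_cone K t -> forall e, 0 < e ->
  exists k, in_cone K (ratvec k) /\ forall j, `|ratvec k j - t j| <= e.
Proof.
move=> [tK ts] e e0.
have /choice[f hf] := fun j => rat_below (t j) e0.
exists (pickle [ffun j => f j]); rewrite /ratvec pickleK.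
split; first split.
- move=> j; rewrite ffunE; have [h1 h2 h3] := hf j; have := tK j; case: ifP => _; last exact: h3.
  exact: le_trans.
- by apply: le_trans ts; apply: ler_sum => j _; rewrite ffunE; have [] := hf j.
- move=> j; rewrite ffunE; have [h1 h2 h3] := hf j; rewrite ler_norml; apply/andP; split; lra.
Qed.

Lemma in_coneZ K (t : 'I_N -> R) c : in_cone K t -> 0 < c -> in_cone K (fun j => c * t j).
Proof.
move=> [tK ts] c0; split; last by rewrite -mulr_sumr pmulr_rle0.
by move=> j; have := tK j; case: ifP => _; rewrite ?pmulr_rle0 ?pmulr_rge0.
Qed.

Variables (d : measure_display) (T : measurableType d) (P : probability T R).
Variable a : 'I_m -> 'I_N -> T -> R.
Hypothesis iid : iid_std_gaussian P a.

Let ma i j : measurable_fun setT (a i j). Proof. by case: iid. Qed.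

Lemma point_null (v : 'I_N -> R) : (0 < m)%N -> (exists j, v j != 0) ->
  measurable [set w | forall i, \sum_j a i j w * v j = 0] /\
  P [set w | forall i, \sum_j a i j w * v j = 0] = 0%E.
Proof.
move=> m0 [j0 vj0]; set B := [set w | _].
have mB : measurable B.
  rewrite (_ : B = \bigcap_(i in [set: 'I_m]) [set w | \sum_j a i j w * v j = 0]); last first.
    by apply/seteqP; split=> w /= h i => [_|]; exact: h.
  apply: fin_bigcap_measurable; first exact: finite_finset.
  move=> i _; rewrite (_ : mkset _ = (fun w => \sum_j a i j w * v j) @^-1` [set 0]); last by apply/seteqP; split.
  rewrite -[X in measurable X]setTI; apply: measurable_sum => //.
  by move=> j; exact: measurable_funM.
split=> //; apply/eqP; rewrite eq_le measure_ge0 andbT.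
pose nv := \sum_j v j ^+ 2.
have nv0 : 0 < nv.
  by rewrite /nv (bigD1 j0)//= ltr_pwDl ?exprn_even_gt0// sumr_ge0// => j _; exact: sqr_ge0.
pose x (k : 'I_1) j := (Num.sqrt nv)^-1 * v j.
have x1 k : \sum_j x k j ^+ 2 = 1.
  under eq_bigr do rewrite exprMn.
  by rewrite -mulr_sumr exprVn sqr_sqrtr ?ltW// mulVf// gt_eqF.
apply/lee_addgt0Pr => e e0; rewrite add0e.
have m1 : 0 < m%:R :> R by rewrite ltr0n.
(* With [delta = lam^-1] the prefactor is [expR (- 1)]. The first bound on [lam] reduces the power
   [m] to the first power, the second makes the result at most [e]. *)
pose lam := Num.max m%:R (expR 1 * m%:R / e).
have lam_m : m%:R <= lam by rewrite le_max lexx.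
have lam_e : expR 1 * m%:R / e <= lam by rewrite le_max lexx orbT.
have lam0 : 0 < lam by apply: lt_le_trans lam_m.
have l0 : 0 < lam^-1 by rewrite invr_gt0.
have := point_family_bound x1 iid (fun=> erefl) lam0 l0 m0.
set B' := [set w | _] => h.
have BB' : (P B <= P B')%E.
  apply: le_measure; rewrite ?inE//; first exact: measurable_exists_image_lt.
  move=> w Bw; exists ord0; rewrite big1 ?exprn_gt0// => i _.
  have -> : \sum_j a i j w * x ord0 j = (Num.sqrt nv)^-1 * \sum_j a i j w * v j.
    by rewrite mulr_sumr; apply: eq_bigr => j _; rewrite /x; ring.
  by rewrite Bw mulr0 expr0n.
apply: (le_trans BB').
have {}h : (P B' <= (expR 1 * (m%:R / lam) ^+ m)%:E)%E.
  rewrite mulNr mulfV ?gt_eqF// expRN in h; rewrite EFinM.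
  have {h} := lee_wpmul2l (_ : 0 <= (expR 1)%:E)%E h.
  rewrite lee_fin expR_ge0 => /(_ isT); apply: le_trans.
  by rewrite muleA -EFinM mulfV ?mul1e// gt_eqF// expR_gt0.
apply: (le_trans h); rewrite lee_fin.
apply: (@le_trans _ _ (expR 1 * (m%:R / lam))).
  rewrite ler_pM2l ?expR_gt0// -[leRHS]expr1 ler_wiXn2l//.
    by rewrite divr_ge0// ltW.
  by rewrite ler_pdivrMr// mul1r.
by rewrite mulrA ler_pdivrMr// -ler_pdivrMl// mulrC.
Qed.

(** The sum is at most [3 * expR (1 / 8) * eps / 4 <= 6 / 7 * eps]; the loss [1 / 8] comes from a
    near-minimizer of [Delta_bin]. *)
Lemma lt_sum_expR (L q u v eps : R) : 0 < eps -> L = ln (4 / eps) -> L - 1 / 8 <= q ->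
  u <= expR (- q) -> v <= expR (- q) -> 2 * u + v < eps.
Proof.
move=> e0 LE Lq uq vq.
have h : expR (- q) <= expR (1 / 8) * (eps / 4).
  rewrite -[eps / 4]invrK invf_div -[4 / eps]lnK ?posrE ?divr_gt0// -LE -expRN -expRD ler_expR; lra.
have h8 : expR (1 / 8) <= 8 / 7 :> R.
  have g : 1 - 1 / 8 <= expR (- (1 / 8)) :> R by exact: expR_ge1Dx.
  rewrite -[expR _]invrK -expRN -[leRHS]invrK lef_pV2 ?posrE ?invr_gt0 ?expR_gt0//.
  by rewrite invf_div; lra.
have e4 : 0 <= eps / 4 by lra.
have := ler_wpM2r e4 h8; lra.
Qed.

Lemma Delta_bin_lt (k : nat) (b : R) : (Delta_bin R N k < b%:E)%E ->
  exists2 tau : R, 0 <= tau & k%:R * sqmean tau + (N - k)%:R * sqmean (- tau) < b.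
Proof.
move=> /ereal_inf_lt[_ [tau tau0 <-]].
move: tau0; rewrite /= in_itv/= andbT => tau0.
rewrite integral_sqdist_left integral_sqdist_right -!EFinM -EFinD lte_fin => h.
by exists tau.
Qed.

Lemma cone_avoidance (K : {set 'I_N}) (eps : R) : (0 < N)%N -> 0 < eps <= 1 ->
  (Delta_bin R N #|K| + (Num.sqrt (8 * ln (4 / eps) * N%:R))%:E <= m%:R%:E)%E ->
  exists B : set T, [/\ (0 < m)%N, measurable B, (P B < eps%:E)%E &
    forall w, ~ B w -> forall t, in_cone K t -> (exists j, t j != 0) ->
      exists i, \sum_j a i j w * t j != 0].
Proof.
move=> N0 /andP[eps0 eps1].
set L := ln (4 / eps); set tt := Num.sqrt _ => hm.
have Np : 0 < N%:R :> R by rewrite ltr0n.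
have [Nm|mN] := ltnP N m.
  pose C := expR (1 / 2) * Num.sqrt 2 ^+ N * m%:R ^+ m : R.
  have C0 : 0 < C.
    have mp : 0 < m%:R :> R by rewrite ltr0n (leq_trans _ Nm).
    by rewrite /C mulr_gt0 ?exprn_gt0// mulr_gt0 ?expR_gt0 ?exprn_gt0// sqrtr_gt0.
  (* The bound [C / lam] then is at most [eps / 2]. *)
  pose lam := Num.max 1 (2 * C / eps).
  have lam1 : 1 <= lam by rewrite le_max lexx.
  have lam0 : 0 < lam by exact: lt_le_trans lam1.
  have lamC : 2 * C / eps <= lam by rewrite le_max lexx orbT.
  have Q0 : 0 <= C / lam by rewrite divr_ge0 ?ltW.
  have [|B [mB PB hB]] := @cone_event R m N d T P a ma (in_cone K) ratvec lam (C / lam)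
      (@in_coneZ K) (@ratvec_dense K) Q0.
    by move=> n x x1 xC delta delta0; exact: wide_family_bound.
  exists B; split=> //; first exact: leq_ltn_trans Nm.
  apply: (le_lt_trans PB); rewrite lte_fin.
  apply: (@le_lt_trans _ _ (eps / 2)); last by rewrite ltr_pdivrMr//; lra.
  rewrite ler_pdivrMr//; have := ler_wpM2l (ltW eps0) lamC.
  by rewrite mulrCA mulfV ?gt_eqF// mulr1; lra.
have L2 : 1 / 2 <= L.
  have h : 1 - 1 / 2 <= expR (- (1 / 2)) :> R by exact: expR_ge1Dx.
  rewrite -ler_expR lnK ?posrE ?divr_gt0// ler_pdivlMr//.
  have : expR (1 / 2) <= 2 :> R.
    rewrite -[expR _]invrK -expRN -[leRHS]invrK lef_pV2 ?posrE ?invr_gt0 ?expR_gt0//; lra.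
  have := expR_ge0 (1 / 2 : R); nra.
have tt2 : tt ^+ 2 = 8 * L * N%:R by rewrite sqr_sqrtr//; nra.
have tt0 : 0 < tt by rewrite sqrtr_gt0; nra.
(* Allowance for a near-minimizer [tau]: as [2 * tt * r = N], one has
   [(tt - r) ^+ 2 >= 8 * L * N - N], a loss of [1 / 8] in the exponent. *)
pose r := N%:R / (2 * tt).
have rE : 2 * (tt * r) = N%:R by rewrite /r; field; rewrite gt_eqF.
have r0 : 0 < r by rewrite divr_gt0// mulr_gt0.
have rt : r < tt by rewrite ltr_pdivrMr ?mulr_gt0//; nra.
have [|tau tau0 htau] := @Delta_bin_lt #|K| (m%:R - tt + r).
  rewrite (@le_lt_trans _ _ (m%:R - tt)%:E)//; last by rewrite lte_fin ltrDl.
  by rewrite EFinB leeBrDr.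
set Dt := _ + _ in htau.
have Dt0 : 0 <= Dt by rewrite /Dt addr_ge0// mulr_ge0// sqmean_ge0.
(* A midpoint rather than [Dt] itself, so that [D] is positive and [Num.sqrt D] can be divided
   by. *)
pose D := (Dt + (m%:R - tt + r)) / 2.
have DtD : Dt <= D by rewrite /D; lra.
have D0 : 0 < D by rewrite /D; lra.
have Dr : D < m%:R - tt + r by rewrite /D; lra.
have Dm : D < m%:R by lra.
clearbody D.
pose lam := Num.sqrt m%:R - Num.sqrt D.
have mp : 0 < m%:R :> R by exact: lt_trans Dm.
have lam0 : 0 < lam by rewrite subr_gt0 ltr_sqrt.
pose Q := 2 * expR (- lam ^+ 2 / 2) + expR (- m%:R / 8).
have Q0 : 0 <= Q by rewrite addr_ge0 ?mulr_ge0 ?expR_ge0.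
have [|B [mB PB hB]] := @cone_event R m N d T P a ma (in_cone K) ratvec lam Q
    (@in_coneZ K) (@ratvec_dense K) Q0.
  move=> n x x1 xC delta delta0.
  apply: (cone_family_bound x1 iid (K := K) (tau := tau) (D := D)) => //.
  - by move=> k j; have [h _] := xC k; exact: h.
  - by move=> k; have [_ h] := xC k.
exists B; split=> //; first by rewrite -(ltr0n R).
apply: (le_lt_trans PB); rewrite lte_fin.
pose t' := m%:R - D.
have t'0 : 0 < t' by rewrite subr_gt0.
have tr2 : 8 * L * N%:R - N%:R <= t' ^+ 2.
  apply: (@le_trans _ _ ((tt - r) ^+ 2)); first by rewrite sqrrB tt2 -[_ *+ 2]mulr_natl rE; have := sqr_ge0 r; lra.
  by rewrite lerXn2r ?nnegrE /t'; lra.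
have mN' : m%:R <= N%:R :> R by rewrite ler_nat.
have qL : L - 1 / 8 <= t' ^+ 2 / (8 * N%:R).
  by rewrite ler_pdivlMr ?mulr_gt0//; lra.
(* The estimates below have [8 * m] in the denominator; [m <= N] passes to the [8 * N] of the
   hypothesis. *)
have qm : t' ^+ 2 / (8 * N%:R) <= t' ^+ 2 / (8 * m%:R).
  by rewrite ler_pM2l ?exprn_gt0// lef_pV2 ?posrE ?mulr_gt0// ler_pM2l.
have sm2 : Num.sqrt m%:R ^+ 2 = m%:R :> R by rewrite sqr_sqrtr.
have sD2 : Num.sqrt D ^+ 2 = D by rewrite sqr_sqrtr// ltW.
have sD0 := sqrtr_ge0 D; have sm0 : 0 < Num.sqrt m%:R :> R by rewrite sqrtr_gt0.
apply: (lt_sum_expR eps0 (erefl L) qL); rewrite ler_expR.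
  rewrite mulNr lerN2 (le_trans qm)//.
  rewrite ler_pdivrMr ?mulr_gt0//.
  have -> : lam ^+ 2 / 2 * (8 * m%:R) = (2 * lam * Num.sqrt m%:R) ^+ 2 by rewrite -{1}sm2; field.
  rewrite lerXn2r ?nnegrE ?(ltW t'0) ?mulr_ge0 ?(ltW lam0) ?(ltW sm0)//.
  by rewrite /t' -{1}sm2 -sD2; rewrite /lam in lam0 *; nra.
rewrite mulNr lerN2 (le_trans qm)// ler_pdivrMr ?mulr_gt0//.
have -> : m%:R / 8 * (8 * m%:R) = m%:R ^+ 2 :> R by field.
by rewrite lerXn2r ?nnegrE ?(ltW t'0) ?(ltW mp)// /t'; lra.
Qed.

End Cone.

(** * Uniqueness of the output *)

Section Deterministic.
Variables (R : realType) (m N : nat).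
Implicit Types (A : 'M[R]_(m, N)) (x y : 'cV[R]_N).

Lemma continuous_sum_ord (U : topologicalType) n (f : 'I_n -> U -> R) :
  (forall i, continuous (f i)) -> continuous (fun u => \sum_i f i u).
Proof.
elim: n f => [|n IH] f cf.
  by under eq_fun do rewrite big_ord0; move=> u; exact: cvg_cst.
under eq_fun do rewrite big_ord_recl.
by move=> u; apply: cvgD; [exact: cf|apply: (IH (fun i => f (lift ord0 i)))].
Qed.

(** That [x0] is an output at all requires a minimizer of the other program as well. The feasible
    set is compact: a closed condition [gap = 0] inside a cube. *)
Lemma exists_minimizer A b (g : 'I_N -> R -> R) x0 : (forall j, continuous (g j)) ->
  feasible A b x0 -> exists x, is_minimizer (fun x => \sum_j g j (x j 0)) A b x.
Proof.
move=> cg [Ax0 x01].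
pose gap (v : 'rV[R]_N) := \sum_i `|\sum_j A i j * v ord0 j - b i 0|.
pose F := [set v : 'rV[R]_N | forall j, `[0, 1]%classic (v ord0 j)] `&` gap @^-1` [set 0].
have gapP (x : 'cV[R]_N) : gap x^T = 0 <-> A *m x = b.
  split=> [h|h]; last first.
    by rewrite /gap -h big1// => i _; under eq_bigr do rewrite mxE; rewrite mxE subrr normr0.
  apply/matrixP => i j; rewrite ord1 mxE.
  have /eqP := h; rewrite psumr_eq0// => /allP /(_ i (mem_index_enum _)) /=.
  rewrite normr_eq0 subr_eq0 => /eqP <-.
  by apply: eq_bigr => k _; rewrite mxE.
have FP (x : 'cV[R]_N) : F x^T <-> feasible A b x.
  split=> [[h /gapP gx]|[gx h]]; split=> //; last exact/gapP.
    by move=> j; have := h j; rewrite /= mxE in_itv.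
  by move=> j; rewrite /= mxE in_itv; exact: h.
have cgap : continuous gap.
  apply: continuous_sum_ord => i v.
  apply: (@continuous_comp _ _ _ (fun v : 'rV[R]_N => \sum_j A i j * v ord0 j - b i 0) (fun t : R => `|t|)); last first.
    exact: (@norm_continuous _ R^o).
  apply: continuousB; last exact: cst_continuous.
  apply: (continuous_sum_ord (f := fun j (v : 'rV[R]_N) => A i j * v ord0 j)) => j u.
  by apply: continuousM; [exact: cst_continuous|exact: coord_continuous].
have compF : compact F.
  apply: compact_closedI.
    have c01 (j : 'I_N) : compact (`[0, 1]%classic : set R) by exact: segment_compact.
    exact: (@rV_compact R N _ c01).
  by apply: closed_comp; [move=> v _; exact: cgap|exact: closed_eq].
have [||c cF cmin] := @compact_EVT_min _ R (fun v : 'rV[R]_N => \sum_j g j (v ord0 j)) F _ compF.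
- by exists x0^T; apply/FP.
- apply: continuous_subspaceT; apply: continuous_sum_ord => j v.
  by apply: continuous_comp; [exact: coord_continuous|exact: cg].
exists c^T; split; first by apply/FP; rewrite trmxK; exact: set_mem.
move=> y /FP Fy; have := cmin _ (mem_set Fy).
have e (z : 'rV[R]_N) : \sum_j g j (z^T j 0) = \sum_j g j (z ord0 j).
  by apply: eq_bigr => j _; rewrite mxE.
by rewrite -(e y^T) trmxK -(e c).
Qed.

Lemma exists_round x : exists r, is_round x r.
Proof.
exists (\col_i (Num.floor (x i 0 + 2^-1))%:~R) => i; split; first by rewrite mxE; eexists.
rewrite mxE; have /andP[h1 h2] := floor_itv (x i 0 + 2^-1).
rewrite ler_norml; move: h1 h2; rewrite intrD1; lra.
Qed.

(** Integers at distance at most [1 / 2] coincide, so the freedom in breaking ties does not affect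
    [x0]. *)
Lemma binary_round (K : {set 'I_N}) r : is_round (indicator R K) r -> r = indicator R K.
Proof.
move=> h; apply/matrixP => i j; rewrite ord1; have [[z rz] hz] := h i; move: hz; rewrite rz.
have [k ->] : exists k : int, indicator R K i 0 = k%:~R.
  by rewrite mxE; case: ifP => _; [exists 1|exists 0].
rewrite -intrB -intr_norm => hz; congr (_%:~R); apply/eqP; rewrite eq_sym -subr_eq0 -normr_eq0.
have : (`|k - z| < 1)%R by rewrite -(ltr_int R); apply: le_lt_trans hz _; lra.
by have := normr_ge0 (k - z); lia.
Qed.

Lemma is_norm0 (nu : 'cV[R]_N -> R) : is_norm nu -> nu 0 = 0.
Proof. by move=> [_ _ nuZ _]; rewrite -(scale0r 0) nuZ normr0 mul0r. Qed.

Lemma indicator01 (K : {set 'I_N}) i : 0 <= indicator R K i 0 <= 1.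
Proof. by rewrite mxE; case: ifP => _; rewrite ?lexx ?ler01. Qed.

Lemma minimizer_ext A b x (f g : 'cV[R]_N -> R) : (forall x, f x = g x) ->
  is_minimizer f A b x -> is_minimizer g A b x.
Proof. by move=> fg [Fx h]; split=> // y Fy; rewrite -!fg; exact: h. Qed.

Lemma is_minimizer_unique A (f : 'cV[R]_N -> R) x0 :
  (forall x, feasible A (A *m x0) x -> f x <= f x0 -> x = x0) ->
  feasible A (A *m x0) x0 ->
  is_minimizer f A (A *m x0) x0 /\ (forall x, is_minimizer f A (A *m x0) x -> x = x0).
Proof.
move=> u F0; split; last by move=> x [Fx /(_ _ F0)]; exact: u.
by split=> // y Fy; rewrite leNgt; apply/negP => h; move: (h); rewrite (u y Fy) ?ltxx// ltW.
Qed.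

Lemma binary_feasible_unique A (K : {set 'I_N}) x r :
  (forall v : 'cV[R]_N, (forall i, v i 0 \in [:: -1; 0; 1]) -> A *m v = 0 -> v = 0) ->
  feasible A (A *m indicator R K) x -> is_round x r -> r = x -> x = indicator R K.
Proof.
move=> bin [Ax x01] rx rE; apply/eqP; rewrite -subr_eq0; apply/eqP; apply: bin; last first.
  by rewrite mulmxBr Ax subrr.
move=> i; rewrite !mxE; have [[z +] _] := rx i; rewrite rE => xz.
have := x01 i; rewrite xz => /andP[z0 z1].
have : z = 0 \/ z = 1 by move: z0 z1; rewrite -[1]/(1%:~R) ler0z ler_int; lia.
by case=> ->; case: ifP => _; rewrite !inE ?subrr ?eqxx ?sub0r ?subr0 ?eqxx ?orbT.
Qed.

Lemma MiBiBP_uniqueP A (K : {set 'I_N}) (nu : 'cV[R]_N -> R) (x0 := indicator R K) :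
  is_norm nu ->
  (forall v : 'cV[R]_N, (forall i, v i 0 \in [:: -1; 0; 1]) -> A *m v = 0 -> v = 0) ->
  (forall x, feasible A (A *m x0) x -> l1norm x <= l1norm x0 -> x = x0) \/
  (forall x, feasible A (A *m x0) x -> l1norm (ones R N - x) <= l1norm (ones R N - x0) -> x = x0) ->
  MiBiBP_unique nu A (A *m x0) x0.
Proof.
move=> hnu bin hu.
have F0 : feasible A (A *m x0) x0 by split=> // i; exact: indicator01.
have nu00 := is_norm0 hnu.
have [nu_ge0 nu_eq0 _ _] := hnu.
have r0 : is_round x0 x0.
  move=> i; split; last by rewrite subrr normr0.
  by rewrite mxE; case: ifP => _; [exists 1|exists 0].
have [x1 m1] : exists x, is_minimizer (@l1norm R N) A (A *m x0) x.
  have [|x] := exists_minimizer (g := fun=> Num.norm) _ F0; last by exists x.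
  by move=> j; exact: norm_continuous.
have [x2 m2] : exists x, is_minimizer (fun y => l1norm (ones R N - y)) A (A *m x0) x.
  have [|x h] := exists_minimizer (g := fun=> fun t : R => `|1 - t|) _ F0.
    move=> j t; apply: (@continuous_comp _ _ _ (fun t : R => 1 - t) (fun t => `|t|)); last exact: (@norm_continuous _ R^o).
    by apply: cvgB; [exact: cvg_cst|exact: cvg_id].
  exists x; apply: minimizer_ext h => y; rewrite /l1norm; apply: eq_bigr => j _.
  by rewrite !mxE.
have [r1 h1] := exists_round x1; have [r2 h2] := exists_round x2.
have lex r x : nu (x0 - x0) <= nu (r - x) by rewrite subrr nu00.
(* Ties are covered too: a rounding error at most 0 forces [r = x] because [nu] is definite. *)
have eqx (x y r r' : 'cV[R]_N) : is_round x r -> is_round x0 r' -> feasible A (A *m x0) x ->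
    nu (r - x) <= nu (r' - x0) -> x = x0.
  move=> rx rx0 Fx; rewrite (binary_round rx0) subrr nu00 => h.
  apply: (binary_feasible_unique bin Fx rx); apply/eqP; rewrite -subr_eq0; apply/eqP/nu_eq0.
  by apply/eqP; rewrite eq_le h nu_ge0.
case: hu => hu; have [mx0 ux0] := is_minimizer_unique hu F0; split.
- by exists x0, x2, x0, r2; split=> //; left.
- move=> x [y1 [y2 [s1 [s2 [n1 n2 q1 q2]]]]].
  have y1E := ux0 _ n1; rewrite y1E in q1 *.
  case=> [[]//|[-> h]]; apply: eqx h => //; by case: n2.
- by exists x1, x0, r1, x0; split=> //; right.
- move=> x [y1 [y2 [s1 [s2 [n1 n2 q1 q2]]]]].
  have y2E := ux0 _ n2; rewrite y2E in q2 *.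
  case=> [[-> h]|[]//]; apply: eqx h => //; by case: n1.
Qed.

(** On [[0, 1]] the norms are plain sums, so a competitor [x] makes [x - x0] a kernel vector of the
    cone. *)
Lemma l1_unique_of_cone A (K : {set 'I_N}) (x0 := indicator R K) :
  (forall v : 'cV[R]_N, in_cone K (fun j => v j 0) -> A *m v = 0 -> v = 0) ->
  forall x, feasible A (A *m x0) x -> l1norm x <= l1norm x0 -> x = x0.
Proof.
move=> hC x [Ax x01] h; apply/eqP; rewrite -subr_eq0; apply/eqP; apply: hC; last by rewrite mulmxBr Ax subrr.
split=> [j|].
  by rewrite !mxE; have /andP[] := x01 j; case: (j \in K); lra.
under eq_bigr do rewrite !mxE; rewrite sumrB subr_le0.
move: h; rewrite /l1norm; congr (_ <= _); apply: eq_bigr => j _.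
  by rewrite ger0_norm//; have /andP[] := x01 j.
by rewrite mxE ger0_norm//; case: ifP.
Qed.

(** Here the kernel vector is [x0 - x], in the cone of the complement of [K]. *)
Lemma l1_compl_unique_of_cone A (K : {set 'I_N}) (x0 := indicator R K) :
  (forall v : 'cV[R]_N, in_cone (~: K) (fun j => v j 0) -> A *m v = 0 -> v = 0) ->
  forall x, feasible A (A *m x0) x -> l1norm (ones R N - x) <= l1norm (ones R N - x0) -> x = x0.
Proof.
move=> hC x [Ax x01] h; apply/esym/eqP; rewrite -subr_eq0; apply/eqP; apply: hC; last by rewrite mulmxBr Ax subrr.
split=> [j|].
  by rewrite !mxE inE; have /andP[] := x01 j; case: (j \in K) => /=; lra.
under eq_bigr do rewrite !mxE; rewrite sumrB subr_le0 -lerN2 -!sumrN -(lerD2l (\sum_(j < N) 1)) -!big_split/=.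
move: h; rewrite /l1norm; congr (_ <= _); apply: eq_bigr => j _.
  by rewrite !mxE ger0_norm// subr_ge0; have /andP[] := x01 j.
by rewrite !mxE ger0_norm//; case: ifP; rewrite ?subrr ?subr0.
Qed.

End Deterministic.

Theorem theorem2p1 (R : realType) (N m : nat)
  (d : measure_display) (T : measurableType d) (P : probability T R)
  (a : 'I_m -> 'I_N -> T -> R) (K : {set 'I_N}) (eps : R)
  (nu : 'cV[R]_N -> R) :
  iid_std_gaussian P a ->
  is_norm nu ->
  0 < eps ->
  ((m%:R)%:E >= mine (Delta_bin R N #|K|) (Delta_bin R N (N - #|K|))
                + (Num.sqrt (8 * ln (4 / eps) * N%:R))%:E)%E ->
  exists E : set T,
    [/\ measurable E,
        E `<=` [set w | MiBiBP_unique nu (gauss_matrix a w)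
                          (gauss_matrix a w *m indicator R K) (indicator R K)] &
        (P E > (1 - eps)%:E)%E].
Proof.
move=> iid hnu eps0 hm.
(* For [eps > 1] the number [1 - eps] is negative and the empty event is enough. *)
have [eps1|eps1] := ltP 1 eps.
  by exists set0; split => //; rewrite measure0 lte_fin subr_lt0.
have [N0|N0] := posnP N.
  exists setT; split => //; last by rewrite probability_setT lte_fin; lra.
  move=> w _; apply: MiBiBP_uniqueP => //.
    by move=> v _ _; apply/matrixP => i; have := ltn_ord i; rewrite {2}N0.
  by left=> x _ _; apply/matrixP => i; have := ltn_ord i; rewrite {2}N0.
have cardC : #|~: K| = (N - #|K|)%N by have := cardsC K; rewrite card_ord; lia.
have eps01 : 0 < eps <= 1 by rewrite eps0.
(* Positivity of [m] makes the scaling factor of [gauss_matrix] nonzero, so it can be removed. *)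
have imE w (v : 'cV[R]_N) : (0 < m)%N -> gauss_matrix a w *m v = 0 ->
    forall i, \sum_j a i j w * v j 0 = 0.
  move=> m0 h i; have := congr1 (fun M : 'cV[R]_m => M i 0) h.
  rewrite /gauss_matrix -scalemxAl !mxE => /eqP; rewrite mulf_eq0 invr_eq0 sqrtr_eq0.
  by rewrite leNgt ltr0n m0/= => /eqP e; rewrite -[RHS]e; apply: eq_bigr => j _; rewrite mxE.
have nz (v : 'cV[R]_N) : v != 0 -> exists j, v j 0 != 0.
  move=> vn0; apply: contrapT => h; move/eqP: vn0; apply; apply/matrixP => j k.
  rewrite ord1 mxE; apply/eqP/negP => /negP hj; apply: h; by exists j.
(* The values 0, 1, 2 shifted by 1 encode the entries -1, 0, 1. Numbering the codes gives a sequence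
   of null events, with the empty set for numbers that encode nothing or the zero vector. *)
pose vec (f : {ffun 'I_N -> 'I_3}) j : R := (f j)%:R - 1.
pose null k : set T := if @unpickle {ffun 'I_N -> 'I_3} k is Some f then
  (if [exists j, vec f j != 0] then [set w | forall i, \sum_j a i j w * vec f j = 0] else set0) else set0.
have key (K' : {set 'I_N}) :
    (Delta_bin R N #|K'| + (Num.sqrt (8 * ln (4 / eps) * N%:R))%:E <= m%:R%:E)%E ->
    exists E : set T, [/\ measurable E, ((1 - eps)%:E < P E)%E &
      forall w, E w ->
       (forall v : 'cV[R]_N, (forall i, v i 0 \in [:: -1; 0; 1]) -> gauss_matrix a w *m v = 0 -> v = 0) /\
       (forall v : 'cV[R]_N, in_cone K' (fun j => v j 0) -> gauss_matrix a w *m v = 0 -> v = 0)].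
  move=> h; have [B [m0 mB PB hB]] := cone_avoidance iid N0 eps01 h.
  have null0 k : measurable (null k) /\ P (null k) = 0%E.
    rewrite /null; case: unpickle => [f|]; last by split=> //; rewrite measure0.
    case: ifPn => [/existsP vf|_]; last by split=> //; rewrite measure0.
    exact: point_null.
  have mnull : measurable (\bigcup_k null k) by apply: bigcup_measurable => k _; case: (null0 k).
  have Pnull : P (\bigcup_k null k) = 0%E.
    apply/negligibleP => //; apply: negligible_bigcup => k.
    by have [mk Pk] := null0 k; exact/negligibleP.
  exists (~` (B `|` \bigcup_k null k)); split.
  - by apply: measurableC; exact: measurableU.
  - rewrite probability_setC; last exact: measurableU.
    have : (P (B `|` \bigcup_k null k) < eps%:E)%E.
      apply: le_lt_trans PB; apply: (le_trans (measureU2 _ _ _)) => //.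
      by rewrite [X in (_ + X)%E]Pnull adde0.
    rewrite -(@fineK _ (P (B `|` _))) ?fin_num_measure//; last exact: measurableU.
    by rewrite lte_fin -EFinB lte_fin => h'; lra.
  move=> w /= /not_orP[nB nN]; split=> v hv Gv; apply/eqP/negP => /negP vn0.
    have [j0 vj0] := nz _ vn0.
    apply: nN.
    pose f : {ffun 'I_N -> 'I_3} := [ffun j => if v j 0 == -1 then ord0 else if v j 0 == 0 then inord 1 else inord 2].
    have fE j : vec f j = v j 0.
      rewrite /vec ffunE; have := hv j; rewrite !inE => /or3P[] /eqP ->.
      - by rewrite eqxx/= sub0r.
      - by rewrite eq_sym oppr_eq0 oner_eq0 eqxx inordK// subrr.
      - have -> : (1 == -1 :> R) = false by apply/negP => /eqP; lra.
        by rewrite oner_eq0 inordK//; lra.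
    exists (pickle f) => //; rewrite /null pickleK.
    have -> : [exists j, vec f j != 0] by apply/existsP; exists j0; rewrite fE.
    move=> i; under eq_bigr do rewrite fE.
    exact: imE.
  have [i /eqP] := hB w nB _ hv (nz _ vn0); apply.
  exact: imE.
move: hm; rewrite minEle; case: ifP => _ hm.
  have [E [mE PE hE]] := key K hm.
  exists E; split=> // w /hE [h1 h2]; apply: MiBiBP_uniqueP => //.
  by left; exact: l1_unique_of_cone.
rewrite -cardC in hm; have [E [mE PE hE]] := key _ hm.
exists E; split=> // w /hE [h1 h2]; apply: MiBiBP_uniqueP => //.
by right; exact: l1_compl_unique_of_cone.
Qed.
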